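(* Let $R$ be a universally catenary locally equidimensional Noetherian ring and let $\Delta$ be a flag of prime ideals of $R$, or $\Delta = \varnothing$. Then the ring $C_\Delta R$ is locally equidimensional.
   Context: All rings are commutative with identity. A Noetherian ring $R$ is equidimensional if $\dim R = \dim R/\mathfrak{p}$ for every minimal prime ideal $\mathfrak{p}$ of $R$; it is locally equidimensional if $R_{\mathfrak{p}}$ is equidimensional for every prime ideal $\mathfrak{p}$ of $R$. A ring is catenary if for every pair of primes $\mathfrak{p}\subset\mathfrak{q}$ all maximal strictly increasing chains of primes between $\mathfrak{p}$ and $\mathfrak{q}$ have the same finite length; it is universally catenary if every finitely generated algebra over it is catenary. A flag of prime ideals $\Delta = (\mathfrak{p}_0,\ldots,\mathfrak{p}_n)$ of a ring $R$ ($n \ge 0$) is a non-empty finite set of prime ideals with $\mathfrak{p}_i \subsetneq \mathfrak{p}_{i+1}$ for $0 \le i < n$. For a prime $\mathfrak{p}$ of $R$ and an $R$-module (or $R$-algebra) $M$, $S^{-1}_{\mathfrak{p}}M$ denotes the localization of $M$ at $\mathfrak{p}$ (inverting the elements of $R\setminus\mathfrak{p}$), and $C_{\mathfrak{p}}M = \varprojlim_l M/\mathfrak{p}^l M$ denotes the $\mathfrak{p}$-adic completion of $M$. For a Noetherian ring $R$ the ind-pro completion of $R$ along $\Delta$ is the ring $$C_\Delta R = C_{\mathfrak{p}_0}S^{-1}_{\mathfrak{p}_0}\cdots C_{\mathfrak{p}_n}S^{-1}_{\mathfrak{p}_n}R$$ (first localize at and complete along $\mathfrak{p}_n$, ...,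 last along $\mathfrak{p}_0$). Also $C_\varnothing R = R$. *)

(* Defs.v *)
From HB Require Import structures.
From mathcomp Require Import all_boot all_order all_algebra ring.
From mathcomp Require Import boolp classical_sets cardinality constructive_ereal.

Set Implicit Arguments.
Unset Strict Implicit.
Unset Printing Implicit Defensive.

Import Order.TTheory GRing.Theory Num.Theory.
Local Open Scope classical_set_scope.
Local Open Scope ring_scope.
Local Open Scope quotient_scope.
Local Open Scope card_scope.

(* Rings are [comPzRingType]s: the zero ring is allowed.  The ideals of
   [ring_quotient] are proper ideals of nontrivial rings, which excludes the
   unit ideal p^0 and the zero ring as a quotient; hence these notions. *)

Record ideal (A : comPzRingType) := Ideal {
  ideal_set :> A -> Prop;
  ideal0 : ideal_set 0;
  idealD : forall x y, ideal_set x -> ideal_set y -> ideal_set (x + y);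
  idealM : forall a x, ideal_set x -> ideal_set (a * x)
}.

Record spec (A : comPzRingType) := Spec {
  spec_ideal :> ideal A;
  spec_proper : ~ spec_ideal 1;
  spec_prime : forall a b, spec_ideal (a * b) -> spec_ideal a \/ spec_ideal b
}.

Lemma idealN (A : comPzRingType) (I : ideal A) x : I x -> I (- x).
Proof. by move=> Ix; rewrite -mulN1r; apply: idealM. Qed.

Section IdealGen.
Variable A : comPzRingType.
Implicit Types (X : set A) (I J : ideal A).

Definition gen_set X : set A :=
  fun x => forall I : ideal A, X `<=` I -> I x.

Lemma gen_set0 X : gen_set X 0.
Proof. by move=> I _; apply: ideal0. Qed.

Lemma gen_setD X x y : gen_set X x -> gen_set X y -> gen_set X (x + y).
Proof. by move=> hx hy I XI; apply: idealD; [apply: hx|apply: hy]. Qed.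

Lemma gen_setM X a x : gen_set X x -> gen_set X (a * x).
Proof. by move=> hx I XI; apply: idealM; apply: hx. Qed.

Definition ideal_gen X : ideal A := Ideal (@gen_set0 X) (@gen_setD X) (@gen_setM X).

Lemma sub_ideal_gen X : X `<=` ideal_gen X.
Proof. by move=> x Xx I; apply. Qed.

Lemma ideal_gen_sub X I : X `<=` I -> ideal_gen X `<=` I.
Proof. by move=> XI x; apply. Qed.

Definition ideal_mul I J : ideal A :=
  ideal_gen [set z | exists x y, [/\ I x, J y & z = x * y]].

Definition ideal_exp I n : ideal A := iter n (ideal_mul I) (ideal_gen [set 1]).

Lemma ideal_exp_sub I l m : (l <= m)%N -> ideal_exp I m `<=` ideal_exp I l.
Proof.
move=> /subnK <-; elim: (m - l)%N => [//|k IHk]; rewrite addSn.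
apply: ideal_gen_sub => _ [x [y [_ Iy ->]]].
by apply: idealM; apply: IHk.
Qed.

End IdealGen.

Section Quotient.
Variables (A : comPzRingType) (I : ideal A).

Definition eqmod (x y : A) : bool := `[< I (x - y) >].

Lemma eqmod_refl : reflexive eqmod.
Proof. by move=> x; apply/asboolP; rewrite subrr; apply: ideal0. Qed.

Lemma eqmod_sym : symmetric eqmod.
Proof.
by move=> x y; apply/asboolP/asboolP => /idealN; rewrite opprB.
Qed.

Lemma eqmod_trans : transitive eqmod.
Proof.
move=> y x z /asboolP Ixy /asboolP Iyz; apply/asboolP.
by rewrite -[x](subrK y) -addrA; apply: idealD.
Qed.

Definition eqmod_equiv := EquivRel eqmod eqmod_refl eqmod_sym eqmod_trans.
Canonical eqmod_equiv.

Definition quot := {eq_quot eqmod}.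
HB.instance Definition _ : EqQuotient A eqmod quot := EqQuotient.on quot.
HB.instance Definition _ := Choice.on quot.

Lemma quotP (x y : A) : \pi_quot x = \pi_quot y <-> I (x - y).
Proof.
split=> [/eqmodP/asboolP //|Ixy].
by apply/eqmodP/asboolP.
Qed.

Lemma quotI (P : quot -> Prop) : (forall a, P (\pi_quot a)) -> forall x, P x.
Proof. by move=> h x; rewrite -[x]reprK; apply: h. Qed.

Lemma quot_repr (x : A) : I (repr (\pi_quot x) - x).
Proof. by apply/quotP; rewrite reprK. Qed.

Definition quot_zero : quot := \pi_quot 0.
Definition quot_one : quot := \pi_quot 1.
Definition quot_opp (x : quot) : quot := \pi_quot (- repr x).
Definition quot_add (x y : quot) : quot := \pi_quot (repr x + repr y).
Definition quot_mul (x y : quot) : quot := \pi_quot (repr x * repr y).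

Lemma quot_oppE x : quot_opp (\pi_quot x) = \pi_quot (- x).
Proof. by apply/quotP; rewrite -opprD; apply: idealN; apply: quot_repr. Qed.

Lemma quot_addE x y : quot_add (\pi_quot x) (\pi_quot y) = \pi_quot (x + y).
Proof.
apply/quotP; rewrite opprD addrACA.
by apply: idealD; apply: quot_repr.
Qed.

Lemma quot_mulE x y : quot_mul (\pi_quot x) (\pi_quot y) = \pi_quot (x * y).
Proof.
apply/quotP.
set a := repr _; set b := repr _.
have -> : a * b - x * y = a * (b - y) + y * (a - x) by ring.
by apply: idealD; apply: idealM; apply: quot_repr.
Qed.

Fact quot_addA : associative quot_add.
Proof.
elim/quotI=> x; elim/quotI=> y; elim/quotI=> z.
by rewrite !quot_addE addrA.
Qed.

Fact quot_addC : commutative quot_add.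
Proof. by move=> x y; rewrite /quot_add addrC. Qed.

Fact quot_add0 : left_id quot_zero quot_add.
Proof. by elim/quotI=> x; rewrite quot_addE add0r. Qed.

Fact quot_addN : left_inverse quot_zero quot_opp quot_add.
Proof. by elim/quotI=> x; rewrite quot_oppE quot_addE addNr. Qed.

HB.instance Definition _ :=
  GRing.isZmodule.Build quot quot_addA quot_addC quot_add0 quot_addN.

Fact quot_mulA : associative quot_mul.
Proof.
elim/quotI=> x; elim/quotI=> y; elim/quotI=> z.
by rewrite !quot_mulE mulrA.
Qed.

Fact quot_mulC : commutative quot_mul.
Proof. by move=> x y; rewrite /quot_mul mulrC. Qed.

Fact quot_mul1 : left_id quot_one quot_mul.
Proof. by elim/quotI=> x; rewrite quot_mulE mul1r. Qed.

Fact quot_mulDl : left_distributive quot_mul quot_add.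
Proof.
elim/quotI=> x; elim/quotI=> y; elim/quotI=> z.
by rewrite !(quot_mulE, quot_addE) mulrDl.
Qed.

HB.instance Definition _ :=
  GRing.Zmodule_isComPzRing.Build quot quot_mulA quot_mulC quot_mul1 quot_mulDl.

Lemma pi_quotB : {morph \pi_quot : x y / x - y}.
Proof. by move=> x y; rewrite -quot_addE -quot_oppE. Qed.

Lemma pi_quotD : {morph \pi_quot : x y / x + y}.
Proof. by move=> x y; rewrite -quot_addE. Qed.

Lemma pi_quotN : {morph \pi_quot : x / - x}.
Proof. by move=> x; rewrite -quot_oppE. Qed.

Lemma pi_quotM : {morph \pi_quot : x y / x * y}.
Proof. by move=> x y; rewrite -quot_mulE. Qed.

Lemma pi_quot1 : \pi_quot 1 = 1.
Proof. by []. Qed.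

End Quotient.

(* [loc f p] is the localization S_p^-1 A of the R-algebra [f : R -> A] at the
   elements of R outside p: classes of fractions (a, s) with a in A and
   s in R \ p, where (a, s) ~ (b, t) iff u (t a - s b) = 0 for some u in R \ p. *)
Section Localization.
Variables (R A : comPzRingType) (f : {rmorphism R -> A}) (p : spec R).

Definition denom := {s : R | `[< ~ p s >]}.

Lemma denomP (s : denom) : ~ p (val s).
Proof. exact/asboolP/(valP s). Qed.

Lemma denom1_subproof : `[< ~ p 1 >].
Proof. exact/asboolP/spec_proper. Qed.

Lemma denomM_subproof (s t : denom) : `[< ~ p (val s * val t) >].
Proof. by apply/asboolP => /spec_prime[]; apply: denomP. Qed.

Definition denom1 : denom := Sub 1 denom1_subproof.
Definition denomM (s t : denom) : denom := Sub (val s * val t) (denomM_subproof s t).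

Definition fraction := (A * denom)%type.
Implicit Types x y z : fraction.

Definition eqfrac x y : bool :=
  `[< exists u : denom, f (val u) * (f (val y.2) * x.1 - f (val x.2) * y.1) = 0 >].

Lemma eqfrac_refl : reflexive eqfrac.
Proof. by move=> x; apply/asboolP; exists denom1; rewrite subrr mulr0. Qed.

Lemma eqfrac_sym : symmetric eqfrac.
Proof.
by move=> x y; apply/asboolP/asboolP => -[u hu]; exists u;
  apply: oppr_inj; rewrite oppr0 -mulrN opprB.
Qed.

Lemma eqfrac_trans : transitive eqfrac.
Proof.
move=> [b t] [a s] [c r] /asboolP[u /= hu] /asboolP[v /= hv].
apply/asboolP; exists (denomM (denomM u v) t) => /=.
rewrite !rmorphM /=.
set ft := f (val t) in hu hv *; set fs := f (val s) in hu hv *.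
set fr := f (val r) in hu hv *; set fu := f (val u) in hu *.
set fv := f (val v) in hv *.
have -> : fu * fv * ft * (fr * a - fs * c)
   = fv * fr * (fu * (ft * a - fs * b)) + fu * fs * (fv * (fr * b - ft * c)) by ring.
by rewrite hu hv !mulr0 addr0.
Qed.

Definition eqfrac_equiv := EquivRel eqfrac eqfrac_refl eqfrac_sym eqfrac_trans.
Canonical eqfrac_equiv.

Definition loc := {eq_quot eqfrac}.
HB.instance Definition _ : EqQuotient fraction eqfrac loc := EqQuotient.on loc.
HB.instance Definition _ := Choice.on loc.

Lemma locP x y : \pi_loc x = \pi_loc y <->
  exists u : denom, f (val u) * (f (val y.2) * x.1 - f (val x.2) * y.1) = 0.
Proof.
split=> [/eqmodP/asboolP //|h].
by apply/eqmodP/asboolP.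
Qed.

Lemma locI (P : loc -> Prop) : (forall a, P (\pi_loc a)) -> forall z : loc, P z.
Proof. by move=> h x; rewrite -[x]reprK; apply: h. Qed.

Lemma loc_repr x : exists u : denom,
  f (val u) * (f (val x.2) * (repr (\pi_loc x)).1 - f (val (repr (\pi_loc x)).2) * x.1) = 0.
Proof. by apply/locP; rewrite reprK. Qed.

Definition frac_opp x : fraction := (- x.1, x.2).
Definition frac_add x y : fraction :=
  (f (val y.2) * x.1 + f (val x.2) * y.1, denomM x.2 y.2).
Definition frac_mul x y : fraction := (x.1 * y.1, denomM x.2 y.2).

Definition loc_zero : loc := \pi_loc (0, denom1).
Definition loc_one : loc := \pi_loc (1, denom1).
Definition loc_opp (x : loc) : loc := \pi_loc (frac_opp (repr x)).
Definition loc_add (x y : loc) : loc := \pi_loc (frac_add (repr x) (repr y)).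
Definition loc_mul (x y : loc) : loc := \pi_loc (frac_mul (repr x) (repr y)).

Lemma loc_oppE x : loc_opp (\pi_loc x) = \pi_loc (frac_opp x).
Proof.
apply/locP; have [u hu] := loc_repr x; exists u => /=.
by rewrite !mulrN -opprD mulrN hu oppr0.
Qed.

Lemma loc_addE x y : loc_add (\pi_loc x) (\pi_loc y) = \pi_loc (frac_add x y).
Proof.
apply/locP; have [u hu] := loc_repr x; have [v hv] := loc_repr y.
move: (repr _) (repr _) hu hv => [b' t'] [a' s'] /=.
case: x y => [a s] [b t] /=.
exists (denomM u v) => /=; rewrite !rmorphM /=.
move: (f (val u)) (f (val v)) (f (val s)) (f (val t)) (f (val s')) (f (val t')) hu hv.
move=> fu fv fs ft fs' ft' hu hv.
rewrite [LHS](_ : _ = fv * ft * ft' * (fu * (fs * a' - fs' * a))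
  + fu * fs * fs' * (fv * (ft * b' - ft' * b))); last by ring.
by rewrite hu hv !mulr0 addr0.
Qed.

Lemma loc_mulE x y : loc_mul (\pi_loc x) (\pi_loc y) = \pi_loc (frac_mul x y).
Proof.
apply/locP; have [u hu] := loc_repr x; have [v hv] := loc_repr y.
move: (repr _) (repr _) hu hv => [b' t'] [a' s'] /=.
case: x y => [a s] [b t] /=.
exists (denomM u v) => /=; rewrite !rmorphM /=.
move: (f (val u)) (f (val v)) (f (val s)) (f (val t)) (f (val s')) (f (val t')) hu hv.
move=> fu fv fs ft fs' ft' hu hv.
rewrite [LHS](_ : _ = fv * ft * b' * (fu * (fs * a' - fs' * a))
  + fu * fs' * a * (fv * (ft * b' - ft' * b))); last by ring.
by rewrite hu hv !mulr0 addr0.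
Qed.

Lemma loc_eq x y : f (val y.2) * x.1 = f (val x.2) * y.1 -> \pi_loc x = \pi_loc y.
Proof. by move=> h; apply/locP; exists denom1; rewrite h subrr mulr0. Qed.

Fact loc_addA : associative loc_add.
Proof.
elim/locI=> x; elim/locI=> y; elim/locI=> z.
by rewrite !loc_addE; apply: loc_eq; rewrite /= !rmorphM /=; ring.
Qed.

Fact loc_addC : commutative loc_add.
Proof.
elim/locI=> x; elim/locI=> y.
by rewrite !loc_addE; apply: loc_eq; rewrite /= !rmorphM /=; ring.
Qed.

Fact loc_add0 : left_id loc_zero loc_add.
Proof.
elim/locI=> x.
by rewrite !loc_addE; apply: loc_eq; rewrite /= !rmorphM rmorph1 /=; ring.
Qed.

Fact loc_addN : left_inverse loc_zero loc_opp loc_add.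
Proof.
elim/locI=> x.
by rewrite loc_oppE loc_addE; apply: loc_eq; rewrite /= !rmorphM rmorph1 /=; ring.
Qed.

HB.instance Definition _ :=
  GRing.isZmodule.Build loc loc_addA loc_addC loc_add0 loc_addN.

Fact loc_mulA : associative loc_mul.
Proof.
elim/locI=> x; elim/locI=> y; elim/locI=> z.
by rewrite !loc_mulE; apply: loc_eq; rewrite /= !rmorphM /=; ring.
Qed.

Fact loc_mulC : commutative loc_mul.
Proof.
elim/locI=> x; elim/locI=> y.
by rewrite !loc_mulE; apply: loc_eq; rewrite /= !rmorphM /=; ring.
Qed.

Fact loc_mul1 : left_id loc_one loc_mul.
Proof.
elim/locI=> x.
by rewrite !loc_mulE; apply: loc_eq; rewrite /= !rmorphM rmorph1 /=; ring.
Qed.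

Fact loc_mulDl : left_distributive loc_mul loc_add.
Proof.
elim/locI=> x; elim/locI=> y; elim/locI=> z.
by rewrite !(loc_mulE, loc_addE); apply: loc_eq; rewrite /= !rmorphM /=; ring.
Qed.

HB.instance Definition _ :=
  GRing.Zmodule_isComPzRing.Build loc loc_mulA loc_mulC loc_mul1 loc_mulDl.

Definition loc_map (a : A) : loc := \pi_loc (a, denom1).

Fact loc_map_is_zmod_morphism : zmod_morphism loc_map.
Proof.
move=> a b; rewrite /loc_map.
transitivity (loc_add (\pi_loc (a, denom1)) (loc_opp (\pi_loc (b, denom1)))) => //.
rewrite loc_oppE loc_addE; apply: loc_eq; rewrite /= !rmorphM rmorph1 /=; ring.
Qed.

Fact loc_map_is_monoid_morphism : monoid_morphism loc_map.
Proof.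
split=> // a b; rewrite /loc_map.
transitivity (loc_mul (\pi_loc (a, denom1)) (\pi_loc (b, denom1))) => //.
by rewrite loc_mulE; apply: loc_eq; rewrite /= !rmorphM rmorph1 /=; ring.
Qed.

HB.instance Definition _ :=
  GRing.isZmodMorphism.Build A loc loc_map loc_map_is_zmod_morphism.
HB.instance Definition _ :=
  GRing.isMonoidMorphism.Build A loc loc_map loc_map_is_monoid_morphism.

End Localization.

(* [compl f p] is the inverse limit of the rings A / p^l A, for an R-algebra
   [f : R -> A]. *)
Section Completion.
Variables (R A : comPzRingType) (f : {rmorphism R -> A}) (p : ideal R).

Definition adic (l : nat) : ideal A := ideal_gen (f @` ideal_exp p l).

Lemma adic_sub l m : (l <= m)%N -> adic m `<=` adic l.
Proof.
move=> lm; apply: ideal_gen_sub => _ [r pr <-].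
by apply: sub_ideal_gen; exists r => //; apply: ideal_exp_sub pr.
Qed.

(* The transition map sends the class of a mod p^m A to the class of a. *)
Record compl := Compl {
  compl_val :> forall l, quot (adic l);
  compl_compat : forall l m, (l <= m)%N ->
    compl_val l = \pi_(quot (adic l)) (repr (compl_val m))
}.

HB.instance Definition _ := gen_eqMixin compl.
HB.instance Definition _ := gen_choiceMixin compl.

Lemma compl_eq (x y : compl) : (forall l, x l = y l) -> x = y.
Proof.
case: x y => [x hx] [y hy] /= xy.
have e : x = y by apply: functional_extensionality_dep.
by case: _ / e hy {xy} => hy; rewrite (Prop_irrelevance hx hy).
Qed.

Lemma trans_pi l m (a : A) : (l <= m)%N ->
  \pi_(quot (adic l)) (repr (\pi_(quot (adic m)) a)) = \pi_(quot (adic l)) a.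
Proof. by move=> lm; apply/quotP; apply: (adic_sub lm); apply: quot_repr. Qed.

Fact const_compat (a : A) l m : (l <= m)%N ->
  \pi_(quot (adic l)) a = \pi_(quot (adic l)) (repr (\pi_(quot (adic m)) a)).
Proof. by move=> lm; rewrite trans_pi. Qed.

Fact opp_compat (x : compl) l m : (l <= m)%N ->
  - x l = \pi_(quot (adic l)) (repr (- x m)).
Proof.
move=> lm; rewrite (compl_compat x lm) -[x m in RHS]reprK.
by rewrite -!pi_quotN trans_pi.
Qed.

Fact add_compat (x y : compl) l m : (l <= m)%N ->
  x l + y l = \pi_(quot (adic l)) (repr (x m + y m)).
Proof.
move=> lm; rewrite (compl_compat x lm) (compl_compat y lm).
by rewrite -[x m in RHS]reprK -[y m in RHS]reprK -!pi_quotD trans_pi.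
Qed.

Fact mul_compat (x y : compl) l m : (l <= m)%N ->
  x l * y l = \pi_(quot (adic l)) (repr (x m * y m)).
Proof.
move=> lm; rewrite (compl_compat x lm) (compl_compat y lm).
by rewrite -[x m in RHS]reprK -[y m in RHS]reprK -!pi_quotM trans_pi.
Qed.

Definition compl_map (a : A) : compl := Compl (const_compat a).
Definition compl_opp (x : compl) : compl := Compl (opp_compat x).
Definition compl_add (x y : compl) : compl := Compl (add_compat x y).
Definition compl_mul (x y : compl) : compl := Compl (mul_compat x y).

Fact compl_addA : associative compl_add.
Proof. by move=> x y z; apply: compl_eq => l /=; rewrite addrA. Qed.

Fact compl_addC : commutative compl_add.
Proof. by move=> x y; apply: compl_eq => l /=; rewrite addrC. Qed.

Fact compl_add0 : left_id (compl_map 0) compl_add.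
Proof. by move=> x; apply: compl_eq => l /=; rewrite [_ + _]add0r. Qed.

Fact compl_addN : left_inverse (compl_map 0) compl_opp compl_add.
Proof. by move=> x; apply: compl_eq => l /=; rewrite addNr. Qed.

HB.instance Definition _ :=
  GRing.isZmodule.Build compl compl_addA compl_addC compl_add0 compl_addN.

Fact compl_mulA : associative compl_mul.
Proof. by move=> x y z; apply: compl_eq => l /=; rewrite mulrA. Qed.

Fact compl_mulC : commutative compl_mul.
Proof. by move=> x y; apply: compl_eq => l /=; rewrite mulrC. Qed.

Fact compl_mul1 : left_id (compl_map 1) compl_mul.
Proof. by move=> x; apply: compl_eq => l /=; rewrite [_ * _]mul1r. Qed.

Fact compl_mulDl : left_distributive compl_mul compl_add.
Proof. by move=> x y z; apply: compl_eq => l /=; rewrite mulrDl. Qed.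

HB.instance Definition _ := GRing.Zmodule_isComPzRing.Build compl
  compl_mulA compl_mulC compl_mul1 compl_mulDl.

Fact compl_map_is_zmod_morphism : zmod_morphism compl_map.
Proof. by move=> a b; apply: compl_eq => l /=; rewrite pi_quotB. Qed.

Fact compl_map_is_monoid_morphism : monoid_morphism compl_map.
Proof. by split=> // a b; apply: compl_eq => l /=; rewrite pi_quotM. Qed.

HB.instance Definition _ :=
  GRing.isZmodMorphism.Build A compl compl_map compl_map_is_zmod_morphism.
HB.instance Definition _ :=
  GRing.isMonoidMorphism.Build A compl compl_map compl_map_is_monoid_morphism.

End Completion.

(* [algType] only covers nontrivial algebras. *)
Record ralgebra (R : comPzRingType) := RAlgebra {
  ralg_sort :> comPzRingType;
  ralg_map : {rmorphism R -> ralg_sort}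
}.

Definition localization (R : comPzRingType) (p : spec R) (A : ralgebra R) : ralgebra R :=
  let f := ralg_map A in
  @RAlgebra R (loc f p) (@loc_map R A f p \o f : {rmorphism R -> loc f p}).

Definition completion (R : comPzRingType) (p : ideal R) (A : ralgebra R) : ralgebra R :=
  let f := ralg_map A in
  @RAlgebra R (compl f p) (@compl_map R A f p \o f : {rmorphism R -> compl f p}).

Definition base_algebra (R : comPzRingType) : ralgebra R :=
  @RAlgebra R R (idfun : {rmorphism R -> R}).

(* A flag (p_0, ..., p_n) is listed in increasing order, so that the head p_0 is
   the prime used last.  The value on the empty list is C_0 R = R. *)
Fixpoint indpro_completion (R : comPzRingType) (D : seq (spec R)) : ralgebra R :=
  if D is p :: D' then completion p (localization p (indpro_completion D'))
  else base_algebra R.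

Definition local_ring (A : comPzRingType) (p : spec A) : comPzRingType :=
  localization p (base_algebra A).

Definition flag (A : comPzRingType) (D : seq (spec A)) : Prop :=
  D <> [::] /\ sorted (fun p q : spec A => `[< p `<` q >]) D.

Definition noetherian (A : comPzRingType) : Prop :=
  forall I : ideal A, exists s : seq A, (I : set A) = ideal_gen [set` s].

(* The supremum is [+oo] for unbounded lengths and [-oo] for the zero ring. *)
Definition krull_dim (A : comPzRingType) : \bar int :=
  supremum -oo%E
    [set (n%:Z)%:E | n in [set n | exists D : seq (spec A), flag D /\ size D = n.+1]].

Definition minimal_prime (A : comPzRingType) (p : spec A) : Prop :=
  forall q : spec A, q `<=` p -> p `<=` q.

(* Both notions are defined for Noetherian rings only, hence they include it. *)
Definition equidimensional (A : comPzRingType) : Prop :=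
  noetherian A /\
  forall p : spec A, minimal_prime p -> krull_dim A = krull_dim (quot p).

Definition locally_equidimensional (A : comPzRingType) : Prop :=
  noetherian A /\ forall p : spec A, equidimensional (local_ring p).

(* A chain is a totally ordered set of primes, so that a maximal chain is not
   assumed to be finite. *)
Definition chain_between (A : comPzRingType) (p q : spec A) (C : set (spec A)) : Prop :=
  (forall r, C r -> p `<=` r /\ r `<=` q) /\
  total_on C (fun r r' : spec A => r `<=` r').

Definition maximal_chain (A : comPzRingType) (p q : spec A) (C : set (spec A)) : Prop :=
  chain_between p q C /\
  forall C' : set (spec A), chain_between p q C' -> C `<=` C' -> C' `<=` C.

Definition catenary (A : comPzRingType) : Prop :=
  forall p q : spec A, p `<=` q ->
  exists n : nat, forall C : set (spec A), maximal_chain p q C -> C #= `I_n.+1.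

Definition fg_algebra (R B : comPzRingType) (f : {rmorphism R -> B}) : Prop :=
  exists s : seq B, forall S : {pred B}, subring_closed S ->
    (forall r, f r \in S) -> {subset s <= S} -> forall b, b \in S.

Definition universally_catenary (R : comPzRingType) : Prop :=
  forall (B : comPzRingType) (f : {rmorphism R -> B}), fg_algebra f -> catenary B.

(* Main.v *)
From HB Require Import structures.
From mathcomp Require Import all_boot all_order all_algebra ring zify.
From mathcomp Require Import boolp classical_sets cardinality constructive_ereal.
Require Import Defs.

Set Implicit Arguments.
Unset Strict Implicit.
Unset Printing Implicit Defensive.

Import Order.TTheory GRing.Theory Num.Theory.
Local Open Scope classical_set_scope.
Local Open Scope ring_scope.
Local Open Scope quotient_scope.

(* For a prime p of height d consider the colon property: whenever p is minimal over
   (x_1, .., x_d), every g with g x_d in I = (x_1, .., x_(d-1)) is integral over I R_p.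
   It implies ht P + ht(p/P) = ht p for every P below p, so it passes to smaller primes
   and makes R_p equidimensional.

   A universally catenary locally equidimensional ring has it: if g is not integral over
   I R_p, then for some prime P the fractions x_1/g, .., x_(d-1)/g and p generate a proper
   prime N of E = (R/P)[x_1/g, .., x_(d-1)/g].  Adjoining the fractions one at a time,
   catenarity keeps a chain of length d below N.  But g x_d in I makes x_d a combination
   of the x_i/g, so N is minimal over these d-1 elements, against Krull's height theorem.

   The property is local.  Since integrality over I R_p can be tested modulo all powers
   of p, approximating elements of a completion by elements of the ring carries the
   property to the completion.  So it survives every step of the construction of
   C_Delta R. *)

(** * Ideals and primes *)

(** The colon property only asks for integral dependence, which tolerates errors in high powers of
    p, so a relation over the completion can be replaced by one over the ring. In a completion along
    p only maximal ideals n are treated directly: they contain the extension of p, which makes the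
    elements of the ring n-adically dense; every other prime lies below a maximal one. Heights are
    expressed throughout by chains [chn P k p], and most local statements at p carry denominators
    outside p instead of passing to [loc]. *)

Section IdealBasics.
Variable A : comPzRingType.
Implicit Types (I J K : ideal A) (p q : spec A) (x y z : A) (xs ys : seq A).

Lemma idealB I x y : I x -> I y -> I (x - y).
Proof. by move=> Ix Iy; apply: idealD => //; apply: idealN. Qed.

Lemma idealMr I a x : I x -> I (x * a).
Proof. by move=> Ix; rewrite mulrC; apply: idealM. Qed.

Lemma idealDl I x y : I x -> I (x + y) -> I y.
Proof. by move=> Ix Ixy; rewrite -[y](addKr x); apply: idealD => //; apply: idealN. Qed.

Lemma idealDr I x y : I y -> I (x + y) -> I x.
Proof. by move=> Iy; rewrite addrC; apply: idealDl. Qed.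

Lemma ideal_ext I J : I `<=` J -> J `<=` I -> I = J.
Proof.
case: I J => I I0 ID IM [J J0 JD JM] /= IJ JI.
have e : I = J by apply/seteqP.
by case: _ / e J0 JD JM {IJ JI} => J0 JD JM; congr Ideal; apply: Prop_irrelevance.
Qed.

Lemma spec_ext p q : p `<=` q -> q `<=` p -> p = q.
Proof.
move=> pq qp; have e : spec_ideal p = spec_ideal q by apply: ideal_ext.
case: p q e {pq qp} => [I i1 i2] [J j1 j2] /= e.
by case: _ / e j1 j2 => j1 j2; congr Spec; apply: Prop_irrelevance.
Qed.

Lemma prime_exp p x n : p (x ^+ n) -> p x.
Proof.
elim: n => [|n IHn]; first by move=> /(spec_proper (s := p)).
by rewrite exprS => /spec_prime[].
Qed.

Lemma notin_primeM p x y : ~ p x -> ~ p y -> ~ p (x * y).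
Proof. by move=> px py /spec_prime[]. Qed.

Lemma notin_primeX p x n : ~ p x -> ~ p (x ^+ n).
Proof. by move=> px /prime_exp. Qed.

Definition iadd_def I J : ideal A.
Proof.
exists [set z | exists x y, [/\ I x, J y & z = x + y]].
- by exists 0, 0; split; rewrite ?addr0 //; apply: ideal0.
- move=> _ _ [x [y [Ix Jy ->]]] [x' [y' [Ix' Jy' ->]]].
  by exists (x + x'), (y + y'); split; [exact: idealD|exact: idealD|rewrite addrACA].
- move=> a _ [x [y [Ix Jy ->]]].
  by exists (a * x), (a * y); split; [exact: idealM|exact: idealM|rewrite mulrDr].
Defined.

(** Locking keeps unification from unfolding a sum of ideals to its existential; [iaddP] opens it.
    [princ], [ipre] and [isat] are locked for the same reason. *)
Fact iadd_key : unit. Proof. exact: tt. Qed.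
Definition iadd := locked_with iadd_key iadd_def.

Lemma iaddP I J z : iadd I J z <-> exists x y, [/\ I x, J y & z = x + y].
Proof. by rewrite /iadd unlock. Qed.

Lemma iaddl I J : I `<=` iadd I J.
Proof. by move=> x Ix; apply/iaddP; exists x, 0; split; rewrite ?addr0 //; apply: ideal0. Qed.

Lemma iaddr I J : J `<=` iadd I J.
Proof. by move=> x Ix; apply/iaddP; exists 0, x; split; rewrite ?add0r //; apply: ideal0. Qed.

Lemma iadd_sub I J K : I `<=` K -> J `<=` K -> iadd I J `<=` K.
Proof. by move=> IK JK _ /iaddP[x [y [Ix Jy ->]]]; apply: idealD; [apply: IK|apply: JK]. Qed.

Lemma iaddS I J I' J' : I `<=` I' -> J `<=` J' -> iadd I J `<=` iadd I' J'.
Proof. by move=> s t; apply: iadd_sub => x h; [apply/iaddl/s|apply/iaddr/t]. Qed.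

Definition princ_def x : ideal A.
Proof.
exists [set z | exists a, z = a * x].
- by exists 0; rewrite mul0r.
- by move=> _ _ [a ->] [b ->]; exists (a + b); rewrite mulrDl.
- by move=> c _ [a ->]; exists (c * a); rewrite mulrA.
Defined.

Fact princ_key : unit. Proof. exact: tt. Qed.
Definition princ := locked_with princ_key princ_def.

Lemma princP x z : princ x z <-> exists a, z = a * x.
Proof. by rewrite /princ unlock. Qed.

Lemma princ_id x : princ x x.
Proof. by apply/princP; exists 1; rewrite mul1r. Qed.

Lemma princ_sub x I : I x -> princ x `<=` I.
Proof. by move=> Ix _ /princP[a ->]; apply: idealM. Qed.

Definition gen xs : ideal A := foldr (fun x I => iadd (princ x) I) (princ 0) xs.

Lemma gen_nil z : gen [::] z -> z = 0.
Proof. by move=> /princP[a ->]; rewrite mulr0. Qed.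

Lemma gen_sub xs I : (forall x, x \in xs -> I x) -> gen xs `<=` I.
Proof.
elim: xs => [|x xs IHxs] h /=.
  by apply: princ_sub; apply: ideal0.
apply: iadd_sub; first by apply/princ_sub/h; rewrite mem_head.
by apply: IHxs => y ys; apply: h; rewrite inE ys orbT.
Qed.

Lemma mem_gen xs x : x \in xs -> gen xs x.
Proof.
elim: xs => //= y xs IHxs; rewrite inE => /orP[/eqP ->|/IHxs h].
  by apply/iaddl/princ_id.
exact: iaddr.
Qed.

Lemma genS xs ys : {subset xs <= ys} -> gen xs `<=` gen ys.
Proof. by move=> s; apply: gen_sub => x /s; apply: mem_gen. Qed.

Lemma ideal_genE xs : ideal_gen [set` xs] = gen xs.
Proof.
apply: ideal_ext; first by apply: ideal_gen_sub => x /=; apply: mem_gen.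
by apply: gen_sub => x xs_x; apply: sub_ideal_gen.
Qed.

Lemma gen_cat xs ys : gen (xs ++ ys) `<=` iadd (gen xs) (gen ys).
Proof.
apply: gen_sub => x; rewrite mem_cat => /orP[]/mem_gen h.
  exact: iaddl.
exact: iaddr.
Qed.

Lemma gen_catl xs ys : gen xs `<=` gen (xs ++ ys).
Proof. by apply: genS => x; rewrite mem_cat => ->. Qed.

Lemma gen_catr xs ys : gen ys `<=` gen (xs ++ ys).
Proof. by apply: genS => x; rewrite mem_cat => ->; rewrite orbT. Qed.

Lemma imulM I J x y : I x -> J y -> ideal_mul I J (x * y).
Proof. by move=> Ix Jy; apply: sub_ideal_gen; exists x, y. Qed.

Lemma imul_sub I J K : (forall x y, I x -> J y -> K (x * y)) -> ideal_mul I J `<=` K.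
Proof. by move=> h; apply: ideal_gen_sub => _ [x [y [Ix Jy ->]]]; apply: h. Qed.

Lemma imulS I J I' J' : I `<=` I' -> J `<=` J' -> ideal_mul I J `<=` ideal_mul I' J'.
Proof. by move=> s t; apply: imul_sub => x y /s ? /t ?; apply: imulM. Qed.

Lemma imul_subl I J : ideal_mul I J `<=` I.
Proof. by apply: imul_sub => x y Ix _; apply: idealMr. Qed.

Lemma imul_subr I J : ideal_mul I J `<=` J.
Proof. by apply: imul_sub => x y _ Jy; apply: idealM. Qed.

Lemma iexp0 I x : ideal_exp I 0 x.
Proof. by rewrite -[x]mulr1; apply: idealM; apply: sub_ideal_gen. Qed.

Lemma iexpS I n : ideal_exp I n.+1 = ideal_mul I (ideal_exp I n).
Proof. by []. Qed.

Lemma iexp1 I : I `<=` ideal_exp I 1.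
Proof. by move=> x Ix; rewrite -[x]mulr1; apply: imulM => //; apply: iexp0. Qed.

Lemma iexp1E I : ideal_exp I 1 `<=` I.
Proof. exact: imul_subl. Qed.

Lemma iexpX I n x : I x -> ideal_exp I n (x ^+ n).
Proof.
move=> Ix; elim: n => [|n IHn]; first exact: iexp0.
by rewrite exprS iexpS; apply: imulM.
Qed.

Lemma iexpD I m n x y : ideal_exp I m x -> ideal_exp I n y -> ideal_exp I (m + n) (x * y).
Proof.
move=> + In; elim: m x => [|m IHm] x Im; first exact: idealM.
suff: ideal_exp I m.+1 `<=` [set x | ideal_exp I (m.+1 + n) (x * y)] by apply.
have K0 : ideal_exp I (m.+1 + n) (0 * y) by rewrite mul0r; apply: ideal0.
have KD a b : ideal_exp I (m.+1 + n) (a * y) -> ideal_exp I (m.+1 + n) (b * y) ->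
    ideal_exp I (m.+1 + n) ((a + b) * y) by rewrite mulrDl; apply: idealD.
have KM a b : ideal_exp I (m.+1 + n) (b * y) -> ideal_exp I (m.+1 + n) (a * b * y).
  by rewrite -mulrA; apply: idealM.
apply: (@imul_sub _ _ (Ideal K0 KD KM)) => /= a b Ia Ib.
by rewrite -mulrA; apply: imulM => //; apply: IHm.
Qed.

Lemma iexp_mono I J n : I `<=` J -> ideal_exp I n `<=` ideal_exp J n.
Proof. by move=> IJ; elim: n => [|n IHn]; [move=> x _; apply: iexp0|apply: imulS]. Qed.

Lemma iexp_sub I n : (0 < n)%N -> ideal_exp I n `<=` I.
Proof. by case: n => // n _; apply: imul_subl. Qed.

(** Every term in the expansion of a product of m + n sums has at least m factors from I or at least
    n factors from J. *)
Lemma iexp_iadd I J m n :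
  ideal_exp (iadd I J) (m + n) `<=` iadd (ideal_exp I m) (ideal_exp J n).
Proof.
have [k] := ubnP (m + n); elim: k m n => // k IHk [|m] [|n] h x.
- by move=> _; apply/iaddl/iexp0.
- by move=> _; apply/iaddl/iexp0.
- by move=> _; apply/iaddr/iexp0.
rewrite addSn iexpS; move: x; apply: imul_sub => _ z /iaddP[x [y [Ix Jy ->]]] hz.
rewrite mulrDl; apply: idealD.
  have [|u [v [hu hv ->]]] := (iaddP _ _ _).1 (IHk m n.+1 _ z hz); first by lia.
  by rewrite mulrDr; apply/iaddP; exists (x * u), (x * v); split => //;
    [apply: imulM|apply: idealM].
have {}hz : ideal_exp (iadd I J) (m.+1 + n) z by rewrite addSn -addnS.
have [|u [v [hu hv ->]]] := (iaddP _ _ _).1 (IHk m.+1 n _ z hz); first by lia.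
by rewrite mulrDr; apply/iaddP; exists (y * u), (y * v); split => //; [apply: idealM|apply: imulM].
Qed.

End IdealBasics.

(** * Prime and maximal ideals from Zorn's lemma *)

Section Zorn.
Variable A : comPzRingType.
Implicit Types (I J : ideal A) (p q : spec A).

Definition ichain (C : ideal A -> Prop) : Prop :=
  (exists I, C I) /\ total_on C (fun I J => I `<=` J).

Lemma chain_union (C : ideal A -> Prop) : ichain C ->
  exists U : ideal A, forall x, U x <-> exists2 I, C I & I x.
Proof.
move=> [[I0 CI0] tot]; unshelve eexists.
  exists [set x | exists2 I, C I & I x].
  - by exists I0 => //; apply: ideal0.
  - move=> x y [I CI Ix] [J CJ Jy]; have [s|s] := tot I J CI CJ.
      by exists J => //; apply: idealD => //; apply: s.
    by exists I => //; apply: idealD => //; apply: s.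
  - by move=> a x [I CI Ix]; exists I => //; apply: idealM.
by [].
Qed.

Lemma zorn_ideal (F : ideal A -> Prop) (I0 : ideal A) : F I0 ->
  (forall C, ichain C -> (forall I, C I -> F I) ->
     exists2 U, F U & forall I, C I -> I `<=` U) ->
  exists M, [/\ F M, I0 `<=` M & forall J, F J -> M `<=` J -> J = M].
Proof.
move=> F0 ub.
pose T := {I : ideal A | `[< F I /\ I0 `<=` I >]}.
have t0 : T by exists I0; apply/asboolP; split.
pose R := fun s t : T => `[< sval s `<=` sval t >].
have [||| [M FIM] hM] := @ZL_preorder T t0 R.
- by move=> t; apply/asboolP.
- by move=> r s t /asboolP rs /asboolP st; apply/asboolP => x /rs/st.
- move=> C totC; have [[s Cs]|nC] := pselect (exists s, C s); last first.
    by exists t0 => s Cs; case: nC; exists s.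
  have [|I [t _ <-]|U FU hU] := ub [set sval t | t in C].
  + split; first by exists (sval s), s.
    by move=> _ _ [u Cu <-] [v Cv <-]; have [/asboolP|/asboolP] := totC u v Cu Cv;
      [left|right].
  + by case: t => I' /= /asboolP[].
  have I0U : I0 `<=` U.
    move=> x I0x; apply: (hU (sval s)); first by exists s.
    by case: (s) => I' /= /asboolP[_]; apply.
  have FU' : `[< F U /\ I0 `<=` U >] by apply/asboolP.
  by exists (exist _ U FU' : T) => u Cu; apply/asboolP/hU; exists u.
have [FM I0M] := asboolW FIM; exists M; split=> // J FJ MJ.
have FJ' : `[< F J /\ I0 `<=` J >] by apply/asboolP; split=> // x /I0M/MJ.
have := hM (exist _ J FJ' : T); rewrite /R /= => h.
apply: ideal_ext => //; apply/asboolP/h; exact/asboolP.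
Qed.

(** An ideal M maximal among those missing S is prime: if a and b lie outside M, then (a) + M and
    (b) + M both meet S, and the product of the two elements of S would lie in M as soon as ab
    does. *)
Lemma prime_avoid_mult (S : A -> Prop) I : S 1 ->
  (forall x y, S x -> S y -> S (x * y)) -> (forall x, S x -> ~ I x) ->
  exists p, I `<=` p /\ (forall x, S x -> ~ p x).
Proof.
move=> S1 SM SI.
have [C chC hC|M [FM IM maxM]] := @zorn_ideal (fun J => forall x, S x -> ~ J x) I SI.
  have [U hU] := chain_union chC; exists U.
    by move=> x Sx /hU[J CJ Jx]; apply: (hC J CJ x).
  by move=> J CJ x Jx; apply/hU; exists J.
have ext a : ~ M a -> exists2 s, S s & iadd (princ a) M s.
  move=> Ma; apply: contrapT => nS.
  have e := maxM (iadd (princ a) M); apply: Ma; rewrite -e; first exact/iaddl/princ_id.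
    by move=> x Sx hx; apply: nS; exists x.
  exact: iaddr.
unshelve eexists (@Spec _ M _ _); first by apply: FM.
  move=> a b Mab; apply: contrapT => /not_orP[Ma Mb].
  have [s Ss /iaddP[_ [m [/princP[r ->] Mm es]]]] := ext a Ma.
  have [t St /iaddP[_ [m' [/princP[r' ->] Mm' et]]]] := ext b Mb.
  apply: (FM (s * t) (SM _ _ Ss St)); rewrite es et.
  rewrite [X in M X](_ : _ = r * r' * (a * b) + (r * a + m) * m' + r' * b * m); last by ring.
  by apply: idealD; [apply: idealD|]; apply: idealM.
by [].
Qed.

Lemma prime_over_ideal I : ~ I 1 -> exists p, I `<=` p.
Proof.
move=> I1; have [//|x y -> ->|x -> //|p [Ip _]] := @prime_avoid_mult (fun x => x = 1) I.
  by rewrite mulr1.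
by exists p.
Qed.

Definition maximal_ideal p := forall q, p `<=` q -> q = p.

Lemma maximal_over p : exists2 m, maximal_ideal m & p `<=` m.
Proof.
have [C chC hC|M [M1 pM maxM]] := @zorn_ideal (fun J => ~ J 1) p (@spec_proper _ p).
  have [U hU] := chain_union chC; exists U; first by move=> /hU[J CJ]; apply: hC.
  by move=> J CJ x Jx; apply/hU; exists J.
have [m Mm] := prime_over_ideal M1.
have em := maxM m (@spec_proper _ m) Mm.
exists m; last by rewrite em.
move=> q mq; apply: spec_ext => //; rewrite em -(maxM q) //; first exact: spec_proper.
by rewrite -em.
Qed.

End Zorn.

(** * Noetherian induction and minimal primes *)

Section Noetherian.
Variable A : comPzRingType.
Implicit Types (I J : ideal A) (p q : spec A).
Hypothesis noeA : noetherian A.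

Lemma noeth_gen I : exists s, I = gen s.
Proof.
have [s Is] := noeA I; exists s; rewrite -ideal_genE.
by apply: ideal_ext; rewrite Is.
Qed.

(** The union of a chain is finitely generated, hence already a member of the chain. *)
Lemma noeth_max (F : ideal A -> Prop) I : F I ->
  exists M, [/\ F M, I `<=` M & forall J, F J -> M `<=` J -> J = M].
Proof.
move=> FI; apply: zorn_ideal => // C chC hC.
have [U hU] := chain_union chC; case: chC => [[J0 CJ0] tot]; exists U; last by move=> J CJ x Jx; apply/hU; exists J.
have [s Us] := noeth_gen U.
suff [J CJ sJ] : exists2 J, C J & forall x, x \in s -> J x.
  rewrite (_ : U = J); first exact: hC.
  apply: ideal_ext; first by rewrite Us; apply: gen_sub.
  by move=> x Jx; apply/hU; exists J.
have : forall x, x \in s -> U x by rewrite Us; apply: mem_gen.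
elim: s {Us} => [_|x s IHs hs]; first by exists J0.
have [|J CJ sJ] := IHs; first by move=> y ys; apply: hs; rewrite inE ys orbT.
have /hU[K CK Kx] := hs x (mem_head _ _).
have [JK|KJ] := tot J K CJ CK.
  by exists K => // y; rewrite inE => /orP[/eqP ->|/sJ/JK].
by exists J => // y; rewrite inE => /orP[/eqP ->|/sJ] //; apply: KJ.
Qed.

Lemma noeth_ind (P : ideal A -> Prop) :
  (forall I, (forall J, I `<=` J -> J <> I -> P J) -> P I) -> forall I, P I.
Proof.
move=> h I; apply: contrapT => nP.
have [M [nPM _ maxM]] := @noeth_max (fun J => ~ P J) I nP.
apply: nPM; apply: h => J MJ JM; apply: contrapT => nPJ.
by apply: JM; apply: maxM.
Qed.

Lemma noeth_max_prime (F : spec A -> Prop) p : F p ->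
  exists m, [/\ F m, p `<=` m & forall q, F q -> m `<=` q -> q = m].
Proof.
move=> Fp.
have [|M [[m Fm em] pM maxM]] := @noeth_max (fun J => exists2 q, F q & spec_ideal q = J) p.
  by exists p.
exists m; split; rewrite ?em // => q Fq mq; apply: spec_ext; rewrite em //.
by rewrite -(maxM q) //; exists q.
Qed.

Lemma primes_over J : exists ps : list (spec A),
  (forall q, List.In q ps -> J `<=` q) /\
  (forall q, J `<=` q -> exists2 p, List.In p ps & p `<=` q).
Proof.
elim/noeth_ind: J => J IHJ.
have [J1|J1] := pselect (J 1).
  by exists nil; split=> // q /(_ _ J1) /(@spec_proper _ q).
have [Jp|] := pselect (forall a b, J (a * b) -> J a \/ J b).
  exists [:: Spec J1 Jp]; split; first by move=> q [<-|//].
  by move=> q Jq; exists (Spec J1 Jp) => //; left.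
move=> /existsNP[a /existsNP[b /not_implyP[Jab /not_orP[Ja Jb]]]].
have nb c : ~ J c -> iadd (princ c) J <> J by move=> Jc e; apply: Jc; rewrite -e; apply/iaddl/princ_id.
have [ps [h1 h2]] := IHJ _ (@iaddr _ (princ a) J) (nb a Ja).
have [qs [k1 k2]] := IHJ _ (@iaddr _ (princ b) J) (nb b Jb).
exists (ps ++ qs)%list; split=> q.
  by move=> /List.in_app_iff[/h1|/k1] hq x Jx; apply: hq; apply: iaddr.
move=> Jq; have [qa|qb] := @spec_prime _ q a b (Jq (a * b) Jab).
  have [|p pin pq] := h2 q; first by apply: iadd_sub => //; apply: princ_sub.
  by exists p => //; apply/List.in_app_iff; left.
have [|p pin pq] := k2 q; first by apply: iadd_sub => //; apply: princ_sub.
by exists p => //; apply/List.in_app_iff; right.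
Qed.

Definition minover p J := J `<=` p /\ forall q, J `<=` q -> q `<=` p -> q = p.

Lemma min_in_list (ps : list (spec A)) p : List.In p ps ->
  exists q, [/\ List.In q ps, q `<=` p & forall r, List.In r ps -> r `<=` q -> r = q].
Proof.
have [n] := ubnP (List.length ps); elim: n ps p => // n IHn ps p.
rewrite ltnS => le_n pin; have [l1 [l2 eps]] := List.in_split _ _ pin.
have [[r [rin rp nrp]]|nr] := pselect (exists r, [/\ List.In r (l1 ++ l2)%list, r `<=` p & r <> p]).
  have [|q [qin qr qmin]] := IHn (l1 ++ l2)%list r _ rin.
    by move: le_n; rewrite eps !List.length_app /=; lia.
  have qp : q `<=` p by move=> x /qr/rp.
  exists q; split=> //.
    by rewrite eps; apply/List.in_app_iff; move/List.in_app_iff: qin => [|]; [left|right; right].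
  move=> s; rewrite eps => /List.in_app_iff[h|[es|h]] sq.
  - by apply: qmin => //; apply/List.in_app_iff; left.
  - by case: nrp; apply: spec_ext => // x px; apply/qr/sq; rewrite -es.
  - by apply: qmin => //; apply/List.in_app_iff; right.
exists p; split=> //.
move=> r; rewrite eps => /List.in_app_iff h rp; apply: contrapT => e.
case: h => [h|[/esym//|h]].
  by apply: nr; exists r; split=> //; apply/List.in_app_iff; left.
by apply: nr; exists r; split=> //; apply/List.in_app_iff; right.
Qed.

Lemma minover_exists J p : J `<=` p -> exists2 q, minover q J & q `<=` p.
Proof.
move=> Jp; have [ps [h1 h2]] := primes_over J.
have [r rin rp] := h2 p Jp; have [q [qin qr qmin]] := min_in_list rin.
exists q; last by move=> x /qr/rp.
split; first exact: h1.
move=> s Js sq; have [t tin ts] := h2 s Js.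
have tq : t = q by apply: qmin => // x /ts/sq.
by apply: spec_ext => //; rewrite -tq.
Qed.

Lemma minoverI p J : J `<=` p -> (forall q, J `<=` q -> q `<=` p -> p `<=` q) -> minover p J.
Proof. by move=> Jp h; split=> // q Jq qp; apply: spec_ext => //; apply: h. Qed.

End Noetherian.

(** * Prime avoidance for cosets *)

Section Avoidance.
Variable A : comPzRingType.
Implicit Types (I J : ideal A) (p q : spec A).

(** An element a that works for the remaining primes but fails at p is corrected by an element of I
    that lies in all of them and not in p. *)
Lemma coset_avoid (ps : list (spec A)) I z : (forall p, List.In p ps -> ~ (I `<=` p /\ p z)) ->
  exists2 a, I a & forall p, List.In p ps -> ~ p (z + a).
Proof.
have [n] := ubnP (List.length ps); elim: n ps => // n IHn [_ _|p ps].
  by exists 0; [apply: ideal0|].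
rewrite /= !ltnS => le_n h.
have [[q [qin qp]]|nq] := pselect (exists q, List.In q ps /\ q `<=` p).
  have [l1 [l2 eps]] := List.in_split _ _ qin.
  have [||a Ia ha] := IHn (p :: l1 ++ l2)%list.
  - by move: le_n; rewrite eps /= !List.length_app /=; lia.
  - move=> r /= [<-|/List.in_app_iff h']; apply: h; first by left.
    by right; rewrite eps; apply/List.in_app_iff; case: h'; [left|right; right].
  exists a => // r /= [<-|]; first by apply: ha; left.
  rewrite eps => /List.in_app_iff[k|[<-|k]].
  - by apply: ha; right; apply/List.in_app_iff; left.
  - by move=> /qp; apply: ha; left.
  - by apply: ha; right; apply/List.in_app_iff; right.
have [//||a Ia ha] := IHn ps; first by move=> r rin; apply: h; right.
have [pa|pa] := pselect (p (z + a)); last first.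
  by exists a => // r /= [<-//|]; apply: ha.
have Ip : ~ I `<=` p.
  move=> Ip; apply: (h p); first by left.
  by split=> //; apply: idealDr pa; apply: Ip.
have [b Ib pb] : exists2 b, I b & ~ p b.
  by apply: contrapT => k; apply: Ip => x Ix; apply: contrapT => px; apply: k; exists x.
have [c cin pc] : exists2 c, (forall r, List.In r ps -> r c) & ~ p c.
  elim: ps nq {IHn le_n h ha} => [|r ps IHps] nq.
    by exists 1 => //; apply: spec_proper.
  have [|c cin pc] := IHps; first by case=> q [qin qp]; apply: nq; exists q; split=> //; right.
  have [d rd pd] : exists2 d, r d & ~ p d.
    apply: contrapT => k; apply: nq; exists r; split; first by left.
    by move=> x rx; apply: contrapT => px; apply: k; exists x.
  exists (c * d); last exact: notin_primeM.
  by move=> s /= [<-|/cin sc]; [apply: idealM|apply: idealMr].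
exists (a + b * c); first by apply: idealD => //; apply: idealMr.
move=> r /= [<-|rin]; rewrite addrA.
  by move/(idealDl pa)/spec_prime => [].
by move=> k; apply: (ha r rin); apply: idealDr k; apply/idealM/cin.
Qed.

End Avoidance.

(** * Chains of primes and Krull's height theorem *)

Section Chains.
Variable A : comPzRingType.
Implicit Types (I J : ideal A) (p q r P : spec A).

Inductive chn : spec A -> nat -> spec A -> Prop :=
| chn0 p : chn p 0 p
| chnS p q r k : p `<=` q -> p <> q -> chn q k r -> chn p k.+1 r.

Lemma chn_sub p k q : chn p k q -> p `<=` q.
Proof. by elim=> {p k q} [p x //|p q r k pq _ _ qr x /pq/qr]. Qed.

Lemma chn_cat p k q l r : chn p k q -> chn q l r -> chn p (k + l) r.
Proof. by elim=> {p k q} [//|p q s k pq npq _ IH] /IH; apply: chnS. Qed.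

Lemma chn1 p q : p `<=` q -> p <> q -> chn p 1 q.
Proof. by move=> pq npq; apply: chnS npq (chn0 q). Qed.

Lemma chnS_inv p k q : chn p k.+1 q -> exists r, [/\ p `<=` r, p <> r & chn r k q].
Proof. by move e : k.+1 => n h; case: h e => // {}p r {}q m pr npr rq [->]; exists r. Qed.

Lemma chn_split p k l q : chn p (k + l) q -> exists2 r, chn p k r & chn r l q.
Proof.
elim: k p => [|k IHk] p; first by exists p => //; apply: chn0.
rewrite addSn => /chnS_inv[s [ps nps sq]].
by have [r sr rq] := IHk _ sq; exists r => //; apply: chnS ps nps sr.
Qed.

Lemma chn_refl p k : chn p k p -> k = 0%N.
Proof.
case: k => // k /chnS_inv[r [pr npr /chn_sub rp]].
by case: npr; apply: spec_ext.
Qed.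

Lemma chn_gt0 p k q : (0 < k)%N -> chn p k q -> p <> q.
Proof. by move=> k0 h e; move: h k0; rewrite e => /chn_refl ->. Qed.

End Chains.

(** * Nakayama's lemma and Krull's theorems at a prime *)

Section Local.
Variable A : comPzRingType.
Implicit Types (I J M C b : ideal A) (p q r P N K : spec A) (x y z s t : A) (xs : seq A).

(** Otherwise some prime over J misses all t z^k with t outside p; it lies in p, so it equals p by
    minimality, although it misses z. *)
Lemma rad_elt p J z : minover p J -> p z -> exists t k, ~ p t /\ J (t * z ^+ k).
Proof.
move=> [Jp minp] pz; apply: contrapT => h.
have [|x y [t [k [pt ->]]] [t' [k' [pt' ->]]]|x [t [k [pt ->]]] Jx|q [Jq hq]] :=
  @prime_avoid_mult _ (fun x => exists t k, ~ p t /\ x = t * z ^+ k) J.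
- by exists 1, 0%N; rewrite mulr1; split=> //; apply: spec_proper.
- by exists (t * t'), (k + k')%N; split; [exact: notin_primeM|rewrite exprD mulrACA].
- by apply: h; exists t, k.
have qp : q `<=` p.
  move=> t qt; apply: contrapT => pt; apply: (hq t) => //.
  by exists t, 0%N; rewrite mulr1.
apply: (hq z); last by rewrite (minp q).
by exists 1, 1%N; rewrite mul1r; split=> //; apply: spec_proper.
Qed.

Lemma princX x n : ideal_exp (princ x) n `<=` princ (x ^+ n).
Proof.
elim: n => [|n IHn]; first by move=> y _; apply/princP; exists y; rewrite mulr1.
rewrite iexpS; apply: imul_sub => _ z /princP[a ->] /IHn/princP[b ->].
by apply/princP; exists (a * b); rewrite exprS mulrACA.
Qed.

Lemma exp_gen_sub p J xs : (forall x, x \in xs -> exists t k, ~ p t /\ J (t * x ^+ k)) ->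
  exists t k, ~ p t /\ forall z, ideal_exp (gen xs) k z -> J (t * z).
Proof.
elim: xs => [_|x xs IHxs h].
  exists 1, 1%N; split; first exact: spec_proper.
  by move=> z /iexp1E/gen_nil ->; rewrite mulr0; apply: ideal0.
have [|t [k [pt ht]]] := IHxs; first by move=> y ys; apply: h; rewrite inE ys orbT.
have [s [l [ps hs]]] := h x (mem_head _ _).
exists (s * t), (l + k)%N; split; first exact: notin_primeM.
move=> z /iexp_iadd/iaddP[_ [v [/princX/princP[a ->] hv ->]]].
rewrite [X in J X](_ : _ = (t * a) * (s * x ^+ l) + s * (t * v)); last by ring.
by apply: idealD; apply: idealM => //; apply: ht.
Qed.

Hypothesis noeA : noetherian A.

Lemma rad_pow p J : minover p J ->
  exists t k, ~ p t /\ forall z, ideal_exp p k z -> J (t * z).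
Proof.
move=> pJ; have [xs ep] := noeth_gen noeA p.
have := @exp_gen_sub p J xs; rewrite -ep; apply => x xs_x; apply: rad_elt => //.
by rewrite ep; apply: mem_gen.
Qed.

(** Nakayama's lemma at p, one generator at a time: t a is congruent to c a with c in C, and t - c
    stays outside p, so a can be eliminated from the other relations. *)
Lemma nak_seq p M' C xs : C `<=` p ->
  (forall x, x \in xs -> exists2 t, ~ p t & iadd M' (ideal_mul C (gen xs)) (t * x)) ->
  exists2 t, ~ p t & forall x, gen xs x -> M' (t * x).
Proof.
move=> Cp; elim: xs => [_|a xs IHxs h].
  by exists 1; [exact: spec_proper|move=> x /gen_nil ->; rewrite mulr0; apply: ideal0].
have split_gen z : iadd M' (ideal_mul C (gen (a :: xs))) z ->
    exists2 c, C c & iadd M' (ideal_mul C (gen xs)) (z - c * a).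
  have K : iadd M' (ideal_mul C (gen (a :: xs))) `<=`
     iadd (iadd M' (ideal_mul C (gen xs))) (ideal_mul C (princ a)).
    apply: iadd_sub; first by move=> x Mx; apply/iaddl/iaddl.
    apply: imul_sub => x _ Cx /iaddP[u [v [hu hv ->]]]; rewrite mulrDr; apply: idealD.
      by apply/iaddr/imulM.
    by apply/iaddl/iaddr/imulM.
  move=> /K/iaddP[x [y [hx hy ->]]].
  suff [c Cc ->] : exists2 c, C c & y = c * a by exists c => //; rewrite addrK.
  have D0 : exists2 c, C c & 0 = c * a by exists 0; rewrite ?mul0r //; apply: ideal0.
  have DD u v : (exists2 c, C c & u = c * a) -> (exists2 c, C c & v = c * a) ->
     exists2 c, C c & u + v = c * a.
    by move=> [c Cc ->] [d Cd ->]; exists (c + d); rewrite ?mulrDl //; apply: idealD.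
  have DM u v : (exists2 c, C c & v = c * a) -> exists2 c, C c & u * v = c * a.
    by move=> [c Cc ->]; exists (u * c); rewrite ?mulrA //; apply: idealM.
  apply: (@imul_sub _ C (princ a) (Ideal D0 DD DM)) hy => /= u _ Cu /princP[v ->].
  by exists (v * u); [apply: idealM|rewrite mulrCA mulrA].
have [t pt /split_gen[c Cc hta]] := h a (mem_head _ _).
pose u := t - c.
have pu : ~ p u by move=> pu; apply: pt; rewrite -[t](subrK c); apply: idealD => //; apply: Cp.
have hua : iadd M' (ideal_mul C (gen xs)) (u * a) by rewrite mulrBl.
have [x xs_x|v pv hv] := IHxs.
  have [|t' pt' /split_gen[c' Cc' h']] := h x; first by rewrite inE xs_x orbT.
  exists (u * t'); first exact: notin_primeM.
  rewrite (_ : _ * x = u * (t' * x - c' * a) + c' * (u * a)); last by ring.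
  by apply: idealD; apply: idealM.
exists (u * v); first exact: notin_primeM.
move=> _ /iaddP[_ [y [/princP[b ->] hy ->]]].
rewrite mulrDr; apply: idealD; last by rewrite -mulrA; apply/idealM/hv.
move/iaddP: hua => [m [z [Mm hz e]]].
rewrite [X in M' X](_ : _ = b * (v * (u * a))); last by ring.
rewrite e mulrDr; apply/idealM/idealD; first exact: idealM.
by apply: hv; apply: imul_subr hz.
Qed.

Lemma nakayama p M' C M : C `<=` p ->
  (forall x, M x -> exists2 t, ~ p t & iadd M' (ideal_mul C M) (t * x)) ->
  exists2 t, ~ p t & forall x, M x -> M' (t * x).
Proof.
have [xs ->] := noeth_gen noeA M => Cp h; apply: nak_seq Cp _ => x /mem_gen; exact: h.
Qed.

Lemma unif_denom p M' M : (forall x, M x -> exists2 t, ~ p t & M' (t * x)) ->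
  exists2 t, ~ p t & forall x, M x -> M' (t * x).
Proof.
move=> h; apply: (@nakayama p M' p M) => // x /h[t pt ht]; exists t => //; exact: iaddl.
Qed.

Lemma minoverS p J J' : minover p J -> J `<=` J' -> J' `<=` p -> minover p J'.
Proof. by move=> [Jp h] JJ' J'p; split=> // q Jq; apply: h => x /JJ'/Jq. Qed.

(** The localization of A/b at p is Artinian. Noetherian induction on b adds a socle element c:
    modulo b + (c) the chain stabilizes, and it remains to see whether c itself stays in the
    chain. *)
Lemma dcc_local p b : minover p b -> forall a : nat -> ideal A,
  (forall n, b `<=` a n) -> (forall n, a n.+1 `<=` a n) ->
  exists n, forall m, (n <= m)%N -> forall x, a m x -> exists2 s, ~ p s & a m.+1 (s * x).
Proof.
elim/(noeth_ind noeA): b => b IHb minb a ba adec.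
have amono m n : (m <= n)%N -> a n `<=` a m.
  by move=> /subnK <-; elim: (n - m)%N => [//|k IHk x /adec/IHk].
(* If b and p agree at p, every term of the chain is either b or the unit ideal there. *)
have [hp|] := pselect (forall c, p c -> exists2 s, ~ p s & b (s * c)).
  have [[n anp]|nap] := pselect (exists n, a n `<=` p).
    exists n => m nm x amx; have [s ps bs] := hp x (anp _ (amono _ _ nm _ amx)).
    by exists s => //; apply: ba.
  exists 0%N => m _ x _.
  have [s as_ ps] : exists2 s, a m.+1 s & ~ p s.
    apply: contrapT => k; apply: nap; exists m.+1 => s as_.
    by apply: contrapT => ps; apply: k; exists s.
  by exists s => //; apply: idealMr.
move=> nhp.
(* The socle element comes from the last power of p that is not contained in b at p. *)
have [c [pc bc [t pt htc]]] : exists c, [/\ p c, forall s, ~ p s -> ~ b (s * c)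
    & exists2 t, ~ p t & forall x, p x -> b (t * (x * c))].
  have [t [L [pt ht]]] := rad_pow minb.
  elim: L t pt ht => [|L IHL] t pt ht.
    by case: pt; apply: (minb.1); rewrite -[t]mulr1; apply/ht/iexp0.
  have [/unif_denom[s ps hs]|] :=
    pselect (forall x, ideal_exp p L x -> exists2 s, ~ p s & b (s * x)).
    exact: (IHL s).
  move=> /existsNP[c /not_implyP[pLc nc]]; exists c; split.
  - case: L {IHL} ht nc pLc => [|L] ht nc pLc; last exact: iexp_sub pLc.
    exfalso; apply: nhp => x px; exists t => //; apply: ht; exact: iexp1.
  - by move=> s ps bs; apply: nc; exists s.
  - by exists t => // x px; apply: ht; rewrite iexpS; apply: imulM.
have bb' : iadd (princ c) b <> b.
  move=> e; apply: (bc 1); first exact: spec_proper.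
  by rewrite mul1r -e; apply/iaddl/princ_id.
have [||n|n1 hn1] := IHb _ (@iaddr _ (princ c) b) bb' _ (fun n => iadd (princ c) (a n)).
- apply: (minoverS minb); first exact: iaddr.
  by apply: iadd_sub (minb.1); apply: princ_sub.
- by move=> n; apply: iaddS.
- by apply: iaddS (adec n).
have [hc|/existsNP[n2 hn2]] := pselect (forall n, exists2 s, ~ p s & a n (s * c)).
  exists n1 => m n1m x amx.
  have [|s ps /iaddP[_ [a' [/princP[r ->] ha' e]]]] := hn1 m n1m x; first exact: iaddr.
  have [s' ps' hs'] := hc m.+1; exists (s' * s); first exact: notin_primeM.
  rewrite -mulrA e mulrDr mulrCA; apply: idealD; exact: idealM.
exists (maxn n1 n2) => m; rewrite geq_max => /andP[n1m n2m] x amx.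
have [|s ps /iaddP[_ [a' [/princP[r ->] ha' e]]]] := hn1 m n1m x; first exact: iaddr.
have pr : p r.
  apply: contrapT => pr; apply: hn2; exists r => //.
  apply: (amono _ _ n2m); rewrite -[r * c](addrK a') -e.
  by apply: idealB; [apply: idealM|apply: adec].
exists (t * s); first exact: notin_primeM.
rewrite -mulrA e mulrDr; apply: idealD; last exact: idealM.
by apply: ba; apply: htc.
Qed.

Definition isat_def q J : ideal A.
Proof.
exists [set a | exists2 s, ~ q s & J (s * a)].
- by exists 1; [exact: spec_proper|rewrite mulr0; apply: ideal0].
- move=> a b [s qs hs] [t qt ht]; exists (s * t); first exact: notin_primeM.
  rewrite mulrDr; apply: idealD; last by rewrite -mulrA; apply: idealM.
  by rewrite mulrAC; apply: idealMr.
- by move=> a b [s qs hs]; exists s => //; rewrite mulrCA; apply: idealM.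
Defined.

Fact isat_key : unit. Proof. exact: tt. Qed.
Definition isat := locked_with isat_key isat_def.

Lemma isatP q J a : isat q J a <-> exists2 s, ~ q s & J (s * a).
Proof. by rewrite /isat unlock. Qed.

Lemma sub_isat q J : J `<=` isat q J.
Proof. by move=> a Ja; apply/isatP; exists 1; [exact: spec_proper|rewrite mul1r]. Qed.

Lemma isat_sat q J s a : ~ q s -> isat q J (s * a) -> isat q J a.
Proof.
move=> qs /isatP[t qt]; rewrite mulrA => h; apply/isatP; exists (t * s) => //.
exact: notin_primeM.
Qed.

Lemma isatS q J J' : J `<=` J' -> isat q J `<=` isat q J'.
Proof. by move=> h a /isatP[s qs /h ?]; apply/isatP; exists s. Qed.

(** Krull's principal ideal theorem in A/P. The symbolic powers [Q n] of q stabilize modulo x at p;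
    since x is outside q, Nakayama at p puts [Q n] into [Q n.+1], and Nakayama at q then makes q^n
    vanish modulo P. *)
Lemma krull_principal P q p x : minover p (iadd (princ x) P) ->
  P `<=` q -> q `<=` p -> q <> p -> q = P.
Proof.
move=> minp Pq qp nqp.
have qx : ~ q x.
  by move=> qx; apply: nqp; apply: (minp.2) => //; apply: iadd_sub => //; apply: princ_sub.
pose Q n := isat q (iadd (ideal_exp q n) P).
have Qdec n : Q n.+1 `<=` Q n.
  by apply: isatS; apply: iaddS => //; apply: ideal_exp_sub.
have [||n hn] := dcc_local minp (a := fun n => iadd (princ x) (Q n)).
- by move=> n; apply: iaddS => // y Py; apply/sub_isat/iaddr.
- by move=> n; apply: iaddS (Qdec n).
have [t pt ht] : exists2 t, ~ p t & forall y, Q n y -> Q n.+1 (t * y).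
  apply: (@nakayama p _ (princ x)).
    apply: princ_sub; apply: (minp.1); exact/iaddl/princ_id.
  move=> y Qy; have [|s ps /iaddP[_ [b [/princP[r ->] Qb e]]]] := hn n (leqnn n) y.
    exact: iaddr.
  exists s => //; rewrite e addrC; apply/iaddP; exists b, (r * x); split=> //.
  rewrite mulrC; apply: imulM; first exact: princ_id.
  apply: (isat_sat qx); rewrite mulrC -[r * x](addrK b) -e; apply: idealB; first exact: idealM.
  exact: Qdec.
have qt : ~ q t by move=> /qp.
have hq y : ideal_exp q n y -> exists2 s, ~ q s & iadd (ideal_exp q n.+1) P (s * y).
  by move=> hy; apply/isatP/(isat_sat qt)/ht/sub_isat/iaddl.
have [s qs hs] : exists2 s, ~ q s & forall y, ideal_exp q n y -> P (s * y).
  apply: (@nakayama q _ q) => // y /hq[s qs h]; exists s => //.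
  by apply: iadd_sub h; [apply: iaddr|apply: iaddl].
apply: spec_ext => // y qy; apply: (@prime_exp _ _ _ n).
have := hs _ (iexpX n qy) => /spec_prime[/Pq//|//].
Qed.

(** The new first prime is minimal over (x) + P. If it already equals [q2], the principal ideal
    theorem leaves no room for [q1] strictly between P and [q2], so [q1] contains x. *)
Lemma chn_push P k p x : chn P k.+1 p -> p x -> exists q, [/\ q x, P `<=` q & chn q k p].
Proof.
elim: k P => [|k IHk] P; first by move=> /chn_sub Pp px; exists p; split=> //; apply: chn0.
move=> /chnS_inv[q1 [Pq1 nPq1 h]] px.
have [q2 [q2x q12 h2]] := IHk _ h px.
have hsub : iadd (princ x) P `<=` q2.
  by apply: iadd_sub; [apply: princ_sub|move=> y /Pq1/q12].
have [q minq qq2] := minover_exists noeA hsub.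
have qx : q x by apply: (minq.1); apply/iaddl/princ_id.
have Pq : P `<=` q by move=> y Py; apply: (minq.1); apply: iaddr.
have [eq|nq] := pselect (q = q2); last by exists q; split=> //; apply: chnS qq2 nq h2.
exists q1; split=> //; rewrite (_ : q1 = q2) //; apply: contrapT => n12.
by apply: nPq1; rewrite [q1](krull_principal minq) // eq.
Qed.

Theorem krull_height xs P p k : minover p (iadd (gen xs) P) -> chn P k p -> (k <= size xs)%N.
Proof.
elim: xs P k => [|x xs IHxs] P k minp h.
  have eP : P = p.
    apply: (minp.2); last exact: chn_sub h.
    by apply: iadd_sub => // y /gen_nil ->; apply: ideal0.
  by rewrite eP in h; rewrite (chn_refl h).
case: k h => // k h; have px : p x by apply: (minp.1); apply/iaddl/mem_gen/mem_head.
have [q [qx Pq hq]] := chn_push h px.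
apply: (IHxs q) => //; apply: minoverI.
  apply: iadd_sub (chn_sub hq) => y hy; apply: (minp.1); apply: iaddl.
  by apply: genS hy => z; rewrite inE orbC => ->.
move=> r hr rp; rewrite (minp.2 r) //; apply: iadd_sub; last first.
  by move=> y /Pq qy; apply/hr/iaddr.
apply: gen_sub => y; rewrite inE => /orP[/eqP ->|ys]; apply: hr; first exact: iaddr.
exact/iaddl/mem_gen.
Qed.

Lemma chn_bound p : exists n, forall P k, chn P k p -> (k <= n)%N.
Proof.
have [xs ep] := noeth_gen noeA p; exists (size xs) => P k h.
apply: (krull_height _ h); apply: minoverI; first by apply: iadd_sub (chn_sub h); rewrite ep.
by move=> q hq qp; rewrite ep => y /iaddl /hq.
Qed.

(** Take pp maximal among the primes between K and N that miss g. If a prime N' strictly below N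
    contained (g) + pp, avoidance would give z in N outside all listed primes over (g) + pp that do
    not contain N. A prime below N minimal over (z) + pp must then be N, and the principal ideal
    theorem forces N' = pp, although g is in N'. *)
Lemma one_dim_prime K N g : K `<=` N -> N g -> ~ K g ->
  exists pp : spec A, [/\ K `<=` pp, pp `<=` N, ~ pp g & minover N (iadd (princ g) pp)].
Proof.
move=> KN Ng nKg.
have [pp [[ppN ppg] Kpp maxpp]] := noeth_max_prime noeA
  (F := fun q => q `<=` N /\ ~ q g) (conj KN nKg).
exists pp; split=> //.
have gppN : iadd (princ g) pp `<=` N by apply: iadd_sub => //; apply: princ_sub.
split=> // N' hN' N'N; apply: contrapT => nN'N.
have [ps [h1 h2]] := primes_over noeA (iadd (princ g) pp).
have [ps' hps'] : exists ps', forall q, List.In q ps' <-> List.In q ps /\ ~ N `<=` q.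
  exists (List.filter (fun q => ~~ `[< N `<=` q >]) ps) => q.
  by rewrite List.filter_In; split=> -[? /asboolPn].
have [|z Nz hz] := @coset_avoid _ ps' N 0.
  by move=> q /hps'[_ h] [].
have [q0 q0in q0N'] := h2 N' hN'.
have nNq0 : ~ N `<=` q0 by move=> h; apply: nN'N; apply: spec_ext => // y /h/q0N'.
have {hz} hz q : List.In q ps' -> ~ q z by move=> /hz; rewrite add0r.
have ppz : ~ pp z.
  by move=> /(@iaddr _ (princ g)) /(h1 _ q0in); apply/hz/hps'.
have hsub : iadd (princ z) pp `<=` N by apply: iadd_sub => //; apply: princ_sub.
have [q minq qN] := minover_exists noeA hsub.
have qz : q z by apply: (minq.1); apply/iaddl/princ_id.
have ppq : pp `<=` q by move=> y hy; apply: (minq.1); apply: iaddr.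
have qg : q g.
  by apply: contrapT => qg; apply: ppz; rewrite -(maxpp q).
have [q1 q1in q1q] := h2 q (iadd_sub (princ_sub qg) ppq).
have q1pp : q1 <> pp by move=> e; apply: ppg; rewrite -e; apply: (h1 _ q1in); apply/iaddl/princ_id.
have ppq1 : pp `<=` q1 by move=> y hy; apply: (h1 _ q1in); apply: iaddr.
have eq1 : q1 = q.
  by apply: contrapT => ne; apply: q1pp; apply: (krull_principal minq).
have eq : q = N.
  apply: spec_ext => //; apply: contrapT => h; apply: (hz q) => //.
  by apply/hps'; rewrite -{1}eq1.
have : N' = pp.
  rewrite eq in minq; apply: (krull_principal minq) => // y hy; apply: hN'; exact: iaddr.
by move=> e; apply: ppg; rewrite -e; apply: hN'; apply/iaddl/princ_id.
Qed.

End Local.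

(** [{poly R}] takes a [comNzRingType]; facts proved with polynomials reach all rings with 1 <> 0 in
    this way. *)
Lemma nz_ring_ind (P : comPzRingType -> Prop) :
  (forall R : comNzRingType, P R) -> forall R : comPzRingType, (1 : R) <> 0 -> P R.
Proof.
move=> h R R1.
have n1 : (1 : R) != 0 by apply/eqP.
pose R' : comNzRingType := HB.pack (R : Type) (GRing.ComPzRing.class R) (GRing.PzSemiRing_isNonZero.Build R n1).
have := h R'.
suff -> : (R' : comPzRingType) = R by [].
by case: R R1 n1 @R'.
Qed.

Lemma noeth_of_gen (A : comPzRingType) :
  (forall I : ideal A, exists s, I = gen s) -> noetherian A.
Proof. by move=> h I; have [s ->] := h I; exists s; rewrite ideal_genE. Qed.

(** * Finitely generated algebras *)

Section Preimage.
Variables (A B : comPzRingType) (f : {rmorphism A -> B}).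

Definition ipre_def (J : ideal B) : ideal A.
Proof.
exists [set x | J (f x)].
- by rewrite /= rmorph0; apply: ideal0.
- by move=> x y Jx Jy; rewrite /= rmorphD; apply: idealD.
- by move=> a x Jx; rewrite /= rmorphM; apply: idealM.
Defined.

Fact ipre_key : unit. Proof. exact: tt. Qed.
Definition ipre := locked_with ipre_key ipre_def.

Lemma ipreE J x : ipre J x <-> J (f x).
Proof. by rewrite /ipre unlock. Qed.

Lemma gen_map xs x : gen xs x -> gen (map f xs) (f x).
Proof.
move=> h; apply/ipreE; move: x h; apply: gen_sub => x xs_x; apply/ipreE/mem_gen.
exact: map_f.
Qed.

Lemma spre_proper (q : spec B) : ~ ipre q 1.
Proof. by move/ipreE; rewrite rmorph1; apply: spec_proper. Qed.

Lemma spre_prime (q : spec B) a b : ipre q (a * b) -> ipre q a \/ ipre q b.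
Proof. by move/ipreE; rewrite rmorphM => /spec_prime[h|h]; [left|right]; apply/ipreE. Qed.

Definition spre (q : spec B) : spec A := Spec (@spre_proper q) (@spre_prime q).

Lemma spreE (q : spec B) x : spre q x <-> q (f x).
Proof. exact: ipreE. Qed.

Hypothesis f_surj : forall y, exists x, f x = y.

Lemma noeth_surj : noetherian A -> noetherian B.
Proof.
move=> noeA; apply: noeth_of_gen => J; have [s hs] := noeth_gen noeA (ipre J).
exists (map f s); apply: ideal_ext => y.
  have [x <-] := f_surj y => Jx; apply: gen_map; rewrite -hs; exact/ipreE.
move: y; apply: gen_sub => _ /mapP[x xs ->]; apply/ipreE; rewrite hs; exact: mem_gen.
Qed.

Definition iimg_def (I : ideal A) : ideal B.
Proof.
exists [set y | exists2 x, I x & f x = y].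
- by exists 0; [apply: ideal0|rewrite rmorph0].
- by move=> _ _ [x Ix <-] [y Iy <-]; exists (x + y); [apply: idealD|rewrite rmorphD].
- move=> b _ [x Ix <-]; have [a <-] := f_surj b.
  by exists (a * x); [apply: idealM|rewrite rmorphM].
Defined.

Lemma iimgE (I : ideal A) x : (forall z, f z = 0 -> I z) -> iimg_def I (f x) <-> I x.
Proof.
move=> hI; split=> [[y Iy e]|]; last by exists x.
rewrite -[x](subrK y); apply: idealD => //; apply: hI.
by rewrite rmorphB e subrr.
Qed.

Lemma simg (p : spec A) : (forall z, f z = 0 -> p z) ->
  exists q : spec B, forall x, q (f x) <-> p x.
Proof.
move=> hp; unshelve eexists (@Spec _ (iimg_def p) _ _).
- by rewrite -(rmorph1 f) => /(iimgE _ hp); apply: spec_proper.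
- move=> a b; have [x <-] := f_surj a; have [y <-] := f_surj b.
  by rewrite -rmorphM => /(iimgE _ hp)/spec_prime[h|h]; [left|right]; apply/iimgE.
by move=> x; apply: iimgE.
Qed.

Lemma chn_surj (P : spec B) (p p' : spec A) k : (forall x, P (f x) <-> p x) ->
  chn p k p' -> exists2 P' : spec B, chn P k P' & (forall x, P' (f x) <-> p' x).
Proof.
move=> + h; elim: h P => {p k p'} [p|p q r k pq npq _ IH] P hP; first by exists P => //; exact: chn0.
have kp z : f z = 0 -> p z by move=> fz; apply/hP; rewrite fz; apply: ideal0.
have [Q hQ] := simg (p := q) (fun z fz => pq _ (kp z fz)).
have [P' h hP'] := IH Q hQ; exists P' => //; apply: chnS h.
  by move=> y; have [x <-] := f_surj y; move/hP/pq/hQ.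
by move=> e; apply: npq; apply: spec_ext => // x; move/hQ; rewrite -e; move/hP.
Qed.

End Preimage.

(** * Hilbert's basis theorem *)

Section Hilbert.
Variable R : comNzRingType.
Hypothesis noeR : noetherian R.
Implicit Types (f g : {poly R}) (s : seq {poly R}).

(** Powers of X lift every member of s to degree m, where combinations of leading coefficients
    become coefficients of combinations. *)
Lemma gen_lead s m c : (forall f, f \in s -> f != 0 /\ (size f <= m.+1)%N) ->
  gen (map lead_coef s) c -> exists h, [/\ gen s h, (size h <= m.+1)%N & h`_m = c].
Proof.
elim: s c => [|f s IHs] c hs.
  by move=> /gen_nil ->; exists 0; rewrite size_poly0 coef0; split=> //; apply: ideal0.
move=> /iaddP[_ [c' [/princP[a ->] hc' ->]]].
have [|h [hh sh ch]] := IHs _ _ hc'; first by move=> g gs; apply: hs; rewrite inE gs orbT.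
have [f0 sf] := hs f (mem_head _ _).
have sf0 : (0 < size f)%N by rewrite size_poly_gt0.
exists (a%:P * 'X^(m.+1 - size f) * f + h); split.
- by apply: idealD; [apply/iaddl/idealM/princ_id|apply: iaddr].
- apply: leq_trans (size_polyD _ _) _; rewrite geq_max sh andbT.
  have [->|nz] := eqVneq (a%:P * 'X^(m.+1 - size f) * f) 0; first by rewrite size_poly0.
  rewrite -mulrA [_ * f]mulrC mul_polyC.
  apply: leq_trans (size_scale_leq _ _) _.
  by rewrite size_mulXn // subnK.
- rewrite coefD ch -mulrA coefCM coefXnM; congr (_ * _ + _).
  rewrite ifF; last by apply/negbTE; rewrite -leqNgt leq_subLR addnC -ltn_subLR; lia.
  by rewrite /lead_coef; congr (_`_ _); lia.
Qed.

(** Choose successively f_n of least degree in J outside the ideal of the earlier ones. Once the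
    ideals of leading coefficients stop growing, a combination of the earlier ones cancels the
    leading term of f_n, against the choice of f_n. *)
Theorem hilbert_basis : noetherian {poly R}.
Proof.
apply: noeth_of_gen => J; apply: contrapT => nJ.
have next s : exists f, (forall g, g \in s -> J g) ->
    [/\ J f, ~ gen s f & forall g, J g -> ~ gen s g -> (size f <= size g)%N].
  have [hs|] := pselect (forall g, g \in s -> J g); last by exists 0.
  have ex : exists n, `[< exists f, [/\ J f, ~ gen s f & size f = n] >].
    have [f Jf nf] : exists2 f, J f & ~ gen s f.
      apply: contrapT => h; apply: nJ; exists s; apply: ideal_ext; last exact: gen_sub.
      by move=> f Jf; apply: contrapT => nf; apply: h; exists f.
    by exists (size f); apply/asboolP; exists f.
  case: (ex_minnP ex) => n /asboolP[f [Jf nf sf]] minn.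
  exists f => _; split=> // g Jg ng.
  by rewrite sf; apply: minn; apply/asboolP; exists g.
have [nx hnx] := choice next.
pose F := fix F n := if n is n'.+1 then nx (F n') :: F n' else [::].
have JF n g : g \in F n -> J g.
  elim: n g => //= n IHn g; rewrite inE => /orP[/eqP ->|/IHn //].
  by have [] := hnx _ IHn.
pose f n := nx (F n).
have fP n : [/\ J (f n), ~ gen (F n) (f n) & forall g, J g -> ~ gen (F n) g -> (size (f n) <= size g)%N].
  by apply: hnx => g; apply: JF.
have Fmono m n : (m <= n)%N -> {subset F m <= F n}.
  by move=> /subnK <-; elim: (n - m)%N => // k IHk x /IHk; rewrite addSn /= inE orbC => ->.
have inF n g : g \in F n -> exists2 m, (m < n)%N & g = f m.
  elim: n => //= n IHn; rewrite inE => /orP[/eqP ->|/IHn[m mn ->]]; first by exists n.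
  by exists m => //; rewrite ltnS ltnW.
have smono m n : (m <= n)%N -> (size (f m) <= size (f n))%N.
  move=> mn; have [_ _ h] := fP m; have [Jn nn _] := fP n; apply: h => //.
  by move=> h; apply: nn; apply: genS h; apply: Fmono.
have fn0 n : f n != 0.
  by apply/eqP => e; have [_ h _] := fP n; apply: h; rewrite e; apply: ideal0.
pose L n := gen (map lead_coef (F n)).
have [_ [[n _ <-] _ maxn]] := @noeth_max _ noeR (fun I => exists2 n, True & L n = I) (L 0%N)
  (ex_intro2 _ _ 0%N I erefl).
have Lf : L n (lead_coef (f n)).
  rewrite -(maxn (L n.+1)); last by apply: genS => x; rewrite inE orbC => ->.
    exact/mem_gen/mem_head.
  by exists n.+1.
have sfn : (0 < size (f n))%N by rewrite size_poly_gt0.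
have [|h [hh sh ch]] := @gen_lead (F n) (size (f n)).-1 _ _ Lf.
  move=> g /inF[m mn ->]; split; first exact: fn0.
  by rewrite prednK // smono // ltnW.
rewrite prednK // in sh.
have [Jf nf minf] := fP n.
have : (size (f n) <= size (f n - h)%R)%N.
  apply: minf; first by apply: idealB => //; apply: gen_sub hh; apply: JF.
  by move=> k; apply: nf; rewrite -(subrK h (f n)); apply: idealD.
apply/negP; rewrite -ltnNge -[X in (_ < X)%N]prednK // ltnS.
apply/leq_sizeP => j; rewrite leq_eqVlt coefB => /orP[/eqP <-|hj].
  by rewrite ch subrr.
have hj' : (size (f n) <= j)%N by rewrite -(prednK sfn).
by rewrite !nth_default ?subrr //; apply: leq_trans hj'.
Qed.

End Hilbert.

Lemma subring_closed_range (R B : comPzRingType) (f : {rmorphism R -> B}) :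
  subring_closed (fun b => `[< exists r, f r = b >]).
Proof.
split=> [|x y /asboolP[a <-] /asboolP[b <-]|x y /asboolP[a <-] /asboolP[b <-]]; apply/asboolP.
- by exists 1; rewrite rmorph1.
- by exists (a - b); rewrite rmorphB.
- by exists (a * b); rewrite rmorphM.
Qed.

Lemma noeth_trivial (B : comPzRingType) : (1 : B) = 0 -> noetherian B.
Proof.
move=> B1; apply: noeth_of_gen => I; exists [::].
have z (x : B) : x = 0 by rewrite -[x]mulr1 B1 mulr0.
by apply: ideal_ext => x _; rewrite (z x); apply: ideal0.
Qed.

Definition generated (R B : comPzRingType) (f : {rmorphism R -> B}) (zs : seq B) : Prop :=
  forall S : {pred B}, subring_closed S ->
    (forall r, f r \in S) -> {subset zs <= S} -> forall b, b \in S.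

Lemma generated_nil (R B : comPzRingType) (f : {rmorphism R -> B}) :
  generated f [::] -> forall b, exists r, f r = b.
Proof.
move=> h b; apply/asboolP; apply: (h _ (subring_closed_range f)) => // r.
by apply/asboolP; exists r.
Qed.

(** The base varies in the induction: one generator is absorbed by replacing R with [{poly R}]. *)
Lemma noeth_generated zs_size (R B : comPzRingType) (f : {rmorphism R -> B}) (zs : seq B) :
  size zs = zs_size -> noetherian R -> generated f zs -> noetherian B.
Proof.
elim: zs_size R B f zs => [|n IHn] R B f zs.
  by move=> /size0nil -> noeR /generated_nil fs; apply: noeth_surj noeR; exact: fs.
have [B0|B1] := pselect ((1 : B) = 0); first by move=> _ _ _; apply: noeth_trivial.
have R1 : (1 : R) <> 0 by move=> e; apply: B1; rewrite -(rmorph1 f) e rmorph0.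
move: R R1 B B1 f zs; apply: (@nz_ring_ind (fun R => forall B : comPzRingType, (1 : B) <> 0 ->
  forall (f : {rmorphism R -> B}) zs, size zs = n.+1 -> noetherian R -> generated f zs -> noetherian B)).
move=> R; apply: (@nz_ring_ind (fun B => 
  forall (f : {rmorphism R -> B}) zs, size zs = n.+1 -> noetherian R -> generated f zs -> noetherian B)).
move=> B f [//|z zs] [szs] noeR gzs.
have cf : commr_rmorph f z by move=> x; apply: mulrC.
pose g : {rmorphism {poly R} -> B} := horner_morph cf.
apply: (IHn _ _ g zs szs (hilbert_basis noeR)) => S S1 gS zsS; apply: gzs => //.
  by move=> r; have := gS r%:P; rewrite /g /= horner_morphC.
move=> x; rewrite inE => /orP[/eqP ->|]; last exact: zsS.
by have := gS 'X; rewrite /g /= horner_morphX.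
Qed.

Section Adjoin.
Variables (R F : comPzRingType) (f : {rmorphism R -> F}) (zs : seq F).

Definition adj_pred : {pred F} := fun z => `[< forall S : {pred F}, subring_closed S ->
  (forall r, f r \in S) -> {subset zs <= S} -> z \in S >].

Lemma adj_pred_closed : subring_closed adj_pred.
Proof.
split=> [|x y /asboolP hx /asboolP hy|x y /asboolP hx /asboolP hy]; apply/asboolP => S S1 fS zS.
- by case: (S1).
- by case: (S1) => _ h _; apply: h; [apply: hx|apply: hy].
- by case: (S1) => _ _ h; apply: h; [apply: hx|apply: hy].
Qed.

HB.instance Definition _ := GRing.isSubringClosed.Build F adj_pred adj_pred_closed.

Definition adj := {z : F | z \in adj_pred}.
HB.instance Definition _ := SubType.on adj.
HB.instance Definition _ := Choice.on adj.
HB.instance Definition _ := GRing.SubChoice_isSubComPzRing.Build F adj_pred adj adj_pred_closed.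

Lemma adj_base r : f r \in adj_pred.
Proof. by apply/asboolP => S _ h _; apply: h. Qed.

Lemma adj_gen z : z \in zs -> z \in adj_pred.
Proof. by move=> zz; apply/asboolP => S _ _ h; apply: h. Qed.

Definition adj_mem z (zz : z \in zs) : adj := Sub z (adj_gen zz).

Definition adj_map r : adj := Sub (f r) (adj_base r).

Fact adj_map_zmod : zmod_morphism adj_map.
Proof. by move=> x y; apply: val_inj; rewrite /= rmorphB. Qed.
Fact adj_map_monoid : monoid_morphism adj_map.
Proof. by split=> [|x y]; apply: val_inj; rewrite /= ?rmorph1 ?rmorphM. Qed.
HB.instance Definition _ := GRing.isZmodMorphism.Build R adj adj_map adj_map_zmod.
HB.instance Definition _ := GRing.isMonoidMorphism.Build R adj adj_map adj_map_monoid.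

Lemma adj_ind (P : F -> Prop) : (forall r, P (f r)) -> (forall z, z \in zs -> P z) ->
  (forall x y, P x -> P y -> P (x - y)) -> (forall x y, P x -> P y -> P (x * y)) ->
  forall x : adj, P (val x).
Proof.
move=> Pf Pz PB PM [x /= /asboolP hx]; apply: asboolW (hx (fun x => `[< P x >]) _ _ _) => [|r|z zz].
- split=> [|a b /asboolP Pa /asboolP Pb|a b /asboolP Pa /asboolP Pb]; apply/asboolP.
  + by rewrite -(rmorph1 f); apply: Pf.
  + exact: PB.
  + exact: PM.
- exact/asboolP.
- by apply/asboolP; apply: Pz.
Qed.

Lemma adj_generated : generated adj_map (pmap insub zs).
Proof.
move=> S S1 fS zS b.
suff : exists2 c : adj, c \in S & val c = val b by move=> [c cS /val_inj <-].
apply: (@adj_ind (fun x => exists2 c : adj, c \in S & val c = x)).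
- by move=> r; exists (adj_map r).
- move=> z zz; exists (Sub z (adj_gen zz)) => //; apply: zS.
  by rewrite mem_pmap; apply/mapP; exists z => //; rewrite insubT ?adj_gen // => h; congr Some; apply: val_inj.
- move=> _ _ [c cS <-] [d dS <-]; exists (c - d) => //.
  by case: S1 => _ h _; apply: h.
- move=> _ _ [c cS <-] [d dS <-]; exists (c * d) => //.
  by case: S1 => _ _; apply.
Qed.

End Adjoin.

Section QuotMap.
Variables (A : comPzRingType) (I : ideal A).

Definition quot_map (x : A) : quot I := \pi_(quot I) x.

Fact quot_map_zmod : zmod_morphism quot_map. Proof. exact: pi_quotB. Qed.
Fact quot_map_monoid : monoid_morphism quot_map.
Proof. by split=> [|x y]; [exact: pi_quot1|exact: pi_quotM]. Qed.
HB.instance Definition _ := GRing.isZmodMorphism.Build A (quot I) quot_map quot_map_zmod.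
HB.instance Definition _ := GRing.isMonoidMorphism.Build A (quot I) quot_map quot_map_monoid.

Lemma quot_map0 x : quot_map x = 0 <-> I x.
Proof. by rewrite -(rmorph0 quot_map) /quot_map quotP subr0. Qed.

Lemma quot_map_surj y : exists x, quot_map x = y.
Proof. by exists (repr y); rewrite /quot_map reprK. Qed.

End QuotMap.

(** The field is D, a copy of R/P, with the images of all elements outside P inverted. *)
Lemma residue_field_aux (R D : comPzRingType) (P : spec R) (q : {rmorphism R -> D}) :
  (forall x, q x = 0 <-> P x) -> (forall y, exists x, q x = y) ->
  exists (F : comPzRingType) (phi : {rmorphism R -> F}),
    [/\ forall a, phi a = 0 <-> P a,
        forall s, ~ P s -> exists t, phi s * t = 1
      & forall x y : F, x * y = 0 -> x = 0 \/ y = 0].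
Proof.
move=> q0 qsurj.
pose phi := @loc_map R D q P \o q : {rmorphism R -> loc q P}.
have phi0 a : phi a = 0 <-> P a.
  split=> [/locP[u /=]|Pa]; last by rewrite /phi /= (q0 _).2 ?rmorph0.
  rewrite mulr0 subr0 -!rmorphM => /q0/spec_prime[/denomP//|/spec_prime[|//]].
  by move=> h; case: (spec_proper h).
have rep x : exists a s, ~ P s /\ x * phi s = phi a.
  elim/locI: x => -[b s]; have [a <-] := qsurj b.
  exists a, (val s); split; first exact: denomP.
  transitivity (loc_mul (\pi_(loc q P) (q a, s)) (\pi_(loc q P) (q (val s), denom1 P))) => //.
  rewrite loc_mulE; apply: loc_eq; rewrite /= -!rmorphM /=; congr (q _); ring.
have inv s : ~ P s -> exists t, phi s * t = 1.
  move=> Ps; have hs : `[< ~ P s >] by apply/asboolP.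
  exists (\pi_(loc q P) (1, Sub s hs)).
  transitivity (loc_mul (\pi_(loc q P) (q s, denom1 P)) (\pi_(loc q P) (1, Sub s hs))) => //.
  rewrite loc_mulE; apply: loc_eq; rewrite /= -(rmorph1 q) -!rmorphM /=; congr (q _); ring.
exists (loc q P), phi; split=> // x y xy.
have [a [s [Ps xs]]] := rep x; have [b [t [Pt yt]]] := rep y.
have : phi (a * b) = 0 by rewrite rmorphM -xs -yt mulrACA xy mul0r.
have [s' ss'] := inv s Ps; have [t' tt'] := inv t Pt.
move=> /phi0/spec_prime[/phi0 h|/phi0 h]; [left|right].
  by rewrite -[x]mulr1 -ss' mulrA xs h mul0r.
by rewrite -[y]mulr1 -tt' mulrA yt h mul0r.
Qed.

Lemma residue_field (R : comPzRingType) (P : spec R) :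
  exists (F : comPzRingType) (phi : {rmorphism R -> F}),
    [/\ forall a, phi a = 0 <-> P a,
        forall s, ~ P s -> exists t, phi s * t = 1
      & forall x y : F, x * y = 0 -> x = 0 \/ y = 0].
Proof.
apply: (@residue_field_aux R (quot P) P (@quot_map R P)); first exact: quot_map0.
exact: quot_map_surj.
Qed.

(** * Local integrality over an ideal *)

Section Closure.
Variable R : comPzRingType.
Implicit Types (I J : ideal R) (p q P Q : spec R) (g s t a b : R).

(** I (I + gR)^n is the sum of the I^i g^(n+1-i) for 1 <= i <= n+1, so membership of g^(n+1) is an
    equation of integral dependence over I. *)
Definition red I g n : ideal R := ideal_mul I (ideal_exp (iadd I (princ g)) n).

(* The fraction g/1 is integral over the ideal I R_p. *)
Definition cl p I g : Prop := exists2 s, ~ p s & exists n, red I g n (s * g ^+ n.+1).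

Lemma redS I I' g n : I `<=` I' -> red I g n `<=` red I' g n.
Proof. by move=> h; apply: imulS => //; apply: iexp_mono; apply: iaddS. Qed.

Lemma clS p I I' g : I `<=` I' -> cl p I g -> cl p I' g.
Proof. by move=> h [s ps [n hn]]; exists s => //; exists n; apply: redS hn. Qed.

Lemma cl_sub p q I g : q `<=` p -> cl p I g -> cl q I g.
Proof. by move=> h [s ps hn]; exists s => // /h. Qed.

Lemma cl_prime p q g : q `<=` p -> cl p q g -> q g.
Proof.
move=> qp [s ps [n]] /imul_subl /spec_prime[/qp//|]; exact: prime_exp.
Qed.

Lemma cl_unit p I g s : I s -> ~ p s -> cl p I g.
Proof.
move=> Is ps; exists s => //; exists 0%N; rewrite expr1; apply: imulM => //; exact: iexp0.
Qed.

Lemma red_mulJ I g m n x y : red I g m x -> ideal_exp (iadd I (princ g)) n y ->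
  red I g (m + n) (x * y).
Proof.
move=> hx hy; have K0 : red I g (m + n) (0 * y) by rewrite mul0r; apply: ideal0.
have KD a b : red I g (m + n) (a * y) -> red I g (m + n) (b * y) -> red I g (m + n) ((a + b) * y).
  by rewrite mulrDl; apply: idealD.
have KM a b : red I g (m + n) (b * y) -> red I g (m + n) (a * b * y).
  by rewrite -mulrA; apply: idealM.
apply: (@imul_sub _ _ _ (Ideal K0 KD KM)) hx => /= a b Ia hb.
by rewrite -mulrA; apply: imulM => //; apply: iexpD.
Qed.

Lemma red_sub I g n : red I g n `<=` ideal_exp (iadd I (princ g)) n.+1.
Proof. by rewrite iexpS; apply: imulS => //; apply: iaddl. Qed.

Lemma exp_red I g n : ideal_exp (iadd I (princ g)) n.+1 `<=`
  iadd (red I g n) (princ (g ^+ n.+1)).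
Proof.
elim: n => [|n IHn].
  move=> x /iexp1E; rewrite expr1; apply: iaddS => // {}x Ix.
  by rewrite -[x]mulr1; apply: imulM => //; apply: iexp0.
rewrite iexpS; apply: imul_sub => _ z /iaddP[i [_ [Ii /princP[a ->] ->]]] hz.
rewrite mulrDl; apply: idealD; first exact/iaddl/imulM.
have /iaddP[u [_ [hu /princP[b ->] ->]]] := IHn z hz.
rewrite mulrDr; apply: idealD; last first.
  by apply/iaddr/princP; exists (a * b); rewrite (exprS g n.+1) mulrACA.
apply: iaddl; rewrite mulrC -(addn1 n); apply: red_mulJ => //.
by apply/iexp1/idealM/iaddr/princ_id.
Qed.

(** The ideals I + (g + b) and I + (g) coincide, and by [exp_red] the power (g + b)^(n+1) is an
    element of [red] plus a multiple of g^(n+1). *)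
Lemma cl_shift p I g b : I b -> cl p I g -> cl p I (g + b).
Proof.
move=> Ib [s ps [n hn]]; exists s => //; exists n.
have e : iadd I (princ (g + b)) = iadd I (princ g).
  apply: ideal_ext; apply: iadd_sub; try exact: iaddl; apply: princ_sub.
    by apply: idealD; [apply/iaddr/princ_id|apply: iaddl].
  by apply: (@idealDr _ _ g b); [apply: iaddl|apply/iaddr/princ_id].
have h : ideal_exp (iadd I (princ g)) n.+1 ((g + b) ^+ n.+1).
  by rewrite -e; apply/iexpX/iaddr/princ_id.
rewrite /red e; have /iaddP[u [_ [hu /princP[c ->] ->]]] := exp_red h.
by rewrite mulrDr mulrCA; apply: idealD; apply: idealM.
Qed.

Lemma cl_denom p I g t : ~ p t -> cl p I (t * g) -> cl p I g.
Proof.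
move=> pt [s ps [n hn]]; exists (s * t ^+ n.+1); first by apply: notin_primeM => //; apply: notin_primeX.
exists n; rewrite -mulrA -exprMn; move: hn; apply: imulS => //; apply: iexp_mono.
by apply: iaddS => //; apply/princ_sub/idealM/princ_id.
Qed.

Lemma exp_scale I J t n x : (forall x, I x -> J (t * x)) -> ideal_exp I n x ->
  ideal_exp J n (t ^+ n * x).
Proof.
move=> h; elim: n x => [|n IHn] x hx; first exact: iexp0.
have K0 : ideal_exp J n.+1 (t ^+ n.+1 * 0) by rewrite mulr0; apply: ideal0.
have KD a b : ideal_exp J n.+1 (t ^+ n.+1 * a) -> ideal_exp J n.+1 (t ^+ n.+1 * b) ->
  ideal_exp J n.+1 (t ^+ n.+1 * (a + b)) by rewrite mulrDr; apply: idealD.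
have KM a b : ideal_exp J n.+1 (t ^+ n.+1 * b) -> ideal_exp J n.+1 (t ^+ n.+1 * (a * b)).
  by rewrite mulrCA; apply: idealM.
apply: (@imul_sub _ _ _ (Ideal K0 KD KM)) hx => /= a b Ia hb.
by rewrite exprS mulrACA; apply: imulM; [apply: h|apply: IHn].
Qed.

Lemma cl_equiv p I J g : noetherian R -> I `<=` isat p J -> cl p I g -> cl p J g.
Proof.
move=> noeR h [s ps [n hn]].
have [t pt ht] : exists2 t, ~ p t & forall x, I x -> J (t * x).
  by apply: unif_denom => // x /h/isatP.
exists (t ^+ n.+1 * s); first by apply: notin_primeM => //; apply: notin_primeX.
exists n; rewrite -mulrA; move: (s * _) hn => x hx.
have K0 : red J g n (t ^+ n.+1 * 0) by rewrite mulr0; apply: ideal0.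
have KD a b : red J g n (t ^+ n.+1 * a) -> red J g n (t ^+ n.+1 * b) ->
  red J g n (t ^+ n.+1 * (a + b)) by rewrite mulrDr; apply: idealD.
have KM a b : red J g n (t ^+ n.+1 * b) -> red J g n (t ^+ n.+1 * (a * b)).
  by rewrite mulrCA; apply: idealM.
apply: (@imul_sub _ _ _ (Ideal K0 KD KM)) hx => /= a b Ia hb.
rewrite exprS mulrACA; apply: imulM; first exact: ht.
apply: exp_scale hb => {}x /iaddP[y [z [Iy hz ->]]].
by rewrite mulrDr; apply: idealD; [apply/iaddl/ht|apply/idealM/iaddr].
Qed.

(* [red] re-indexed by the degree of the monic equation: the possible values of
   [a_1 g^(n-1) + ... + a_n] with [a_i] in [I^i]. *)
Definition redn I g n : ideal R := if n is m.+1 then red I g m else princ 0.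

Lemma redn_mulJ I g m n x y : redn I g m x -> ideal_exp (iadd I (princ g)) n y ->
  redn I g (m + n) (x * y).
Proof.
case: m => [/princP[a ->] _|m hx hy]; first by rewrite mulr0 mul0r; apply: ideal0.
exact: red_mulJ.
Qed.

Lemma redn_mulX I g m n x : redn I g m x -> redn I g (m + n) (x * g ^+ n).
Proof. by move=> h; apply: redn_mulJ => //; apply/iexpX/iaddr/princ_id. Qed.

Lemma redn_mul I g m n x y : redn I g m x -> redn I g n y -> redn I g (m + n) (x * y).
Proof.
move=> hx hy; apply: redn_mulJ => //.
by case: n hy => [_|n]; [apply: iexp0|apply: red_sub].
Qed.

Lemma redn1 I g x : I x -> redn I g 1 x.
Proof. by move=> Ix; rewrite -[x]mulr1; apply: imulM => //; apply: iexp0. Qed.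

(** Homogenized values s g^n + a_1 g^(n-1) + ... + a_n with a_i in I^i and s outside p. The value 0
    occurs exactly when g is integral over I at p. *)
Definition monic_val p I g : R -> Prop := fun a => exists s n, ~ p s /\ redn I g n (a - s * g ^+ n).

Lemma monic_valM p I g x y : monic_val p I g x -> monic_val p I g y -> monic_val p I g (x * y).
Proof.
move=> [s [m [ps hx]]] [t [n [pt hy]]]; exists (s * t), (m + n)%N; split; first exact: notin_primeM.
rewrite (_ : _ - _ = (x - s * g ^+ m) * (y - t * g ^+ n) + s * ((y - t * g ^+ n) * g ^+ m)
  + t * ((x - s * g ^+ m) * g ^+ n)); last by rewrite exprD; ring.
apply: idealD; first apply: idealD.
- exact: redn_mul.
- by apply: idealM; rewrite addnC; apply: redn_mulX.
- by apply: idealM; apply: redn_mulX.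
Qed.

(** The values form a multiplicative set without 0. It contains the complement of p, in degree 0,
    and g, in degree 1. *)
Lemma monic_val_prime p I g : ~ cl p I g ->
  exists P : spec R, [/\ P `<=` p, forall x, monic_val p I g x -> ~ P x & ~ P g].
Proof.
move=> ncl; have [|x y|x|P [_ hP]] := @prime_avoid_mult _ (monic_val p I g) (princ 0).
- by exists 1, 0%N; rewrite expr0 mulr1 subrr; split; [exact: spec_proper|apply: ideal0].
- exact: monic_valM.
- move=> [s [n [ps hx]]] /princP[a xa]; rewrite xa mulr0 sub0r in hx.
  move/idealN: hx; rewrite opprK => hx.
  case: n hx => [|n] hx; last by apply: ncl; exists s => //; exists n.
  by apply: ps; rewrite -[s]mulr1; move/princP: hx => [b ->]; rewrite mulr0; apply: ideal0.
exists P; split=> //.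
  move=> x Px; apply: contrapT => px; apply: (hP x) => //.
  by exists x, 0%N; rewrite expr0 mulr1 subrr; split=> //; apply: ideal0.
apply: hP; exists 1, 1%N; rewrite mul1r expr1 subrr; split; [exact: spec_proper|exact: ideal0].
Qed.

End Closure.

Section DivIdeal.
Variables (A B : comPzRingType) (f : {rmorphism A -> B}).

(** For a prime K missing c, this is the condition that t f(x)/c lies in M modulo K, written without
    division. *)
Definition idiv_def (M K : ideal B) (t c : B) : ideal A.
Proof.
exists [set x | exists2 m, M m & K (t * f x - c * m)].
- by exists 0; [apply: ideal0|rewrite rmorph0 !mulr0 subrr; apply: ideal0].
- move=> x y [m Mm hx] [n Mn hy]; exists (m + n); first exact: idealD.
  by rewrite rmorphD !mulrDr opprD addrACA; apply: idealD.
- move=> a x [m Mm hx]; exists (f a * m); first exact: idealM.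
  by rewrite rmorphM (mulrCA t) (mulrCA c) -mulrBr; apply: idealM.
Defined.

End DivIdeal.

(* The ring [E = (R/P)[x/g : x in xs]] inside the residue field of P, where no
   monic equation of [g] over [I = gen xs] has its value in [P]; then p and the
   fractions [x/g] generate a proper prime N of E. *)
Section BlowupChart.
Variables (R F : comPzRingType) (phi : {rmorphism R -> F}) (p P : spec R).
Variables (g : R) (ginv : F) (xs : seq R).
Let I := gen xs.
Hypothesis phi0 : forall a, phi a = 0 <-> P a.
Hypothesis F_dom : forall x y : F, x * y = 0 -> x = 0 \/ y = 0.
Hypothesis gV : phi g * ginv = 1.
Hypothesis monicP : forall x, monic_val p I g x -> ~ P x.

Definition chart_gens := map (fun x => phi x * ginv) xs.
Definition chart := adj phi chart_gens.

(** In the field z = a + i/g^n, where i/g^n combines products of at least one fraction x/g;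
    membership of z in N will depend on the constant term a only. *)
Definition chart_rep (z : chart) n a i : Prop :=
  redn I g n i /\ phi g ^+ n * val z = phi (a * g ^+ n + i).

Lemma chart_repP z : exists n a i, chart_rep z n a i.
Proof.
apply: (@adj_ind _ _ phi chart_gens (fun z => exists n a i, redn I g n i /\ phi g ^+ n * z = phi (a * g ^+ n + i))).
- by move=> r; exists 0%N, r, 0; split; [apply: ideal0|rewrite !expr0 mul1r mulr1 addr0].
- move=> _ /mapP[x xs_x ->]; exists 1%N, 0, x; split; first exact/redn1/mem_gen.
  by rewrite mul0r add0r expr1 mulrCA gV mulr1.
- move=> x y [n [a [i [hi hx]]]] [m [b [j [hj hy]]]].
  exists (n + m)%N, (a - b), (i * g ^+ m - j * g ^+ n); split.
    by apply: idealB; [|rewrite addnC]; apply: redn_mulX.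
  rewrite (_ : _ * _ = phi g ^+ m * (phi g ^+ n * x) - phi g ^+ n * (phi g ^+ m * y)).
    by rewrite hx hy -!(rmorphXn phi) -!rmorphM -rmorphB exprD; congr (phi _); ring.
  by rewrite exprD; ring.
- move=> x y [n [a [i [hi hx]]]] [m [b [j [hj hy]]]].
  exists (n + m)%N, (a * b), (b * (i * g ^+ m) + a * (j * g ^+ n) + i * j); split.
    apply: idealD; last exact: redn_mul.
    by apply: idealD; apply: idealM; [|rewrite addnC]; apply: redn_mulX.
  by rewrite exprD mulrACA hx hy -rmorphM exprD; congr (phi _); ring.
Qed.

(** Clearing denominators between two representations of z yields an element of P that is a value
    with leading coefficient a - b. So the constant term is determined modulo p. *)
Lemma chart_rep_sub z n a i m b j : chart_rep z n a i -> chart_rep z m b j ->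
  ~ p (a - b) -> False.
Proof.
move=> [hi ha] [hj hb] pab; apply: (@monicP (g ^+ m * (a * g ^+ n + i) - g ^+ n * (b * g ^+ m + j))).
  exists (a - b), (n + m)%N; split=> //.
  rewrite (_ : _ - _ = i * g ^+ m - j * g ^+ n); last by rewrite exprD; ring.
  by apply: idealB; [|rewrite addnC]; apply: redn_mulX.
by apply/phi0; rewrite rmorphB !rmorphM -ha -hb /= !rmorphXn; ring.
Qed.

Lemma chart_rep0 : chart_rep 0 0 0 0.
Proof. by split; [apply: ideal0|rewrite mulr0 mul0r addr0 rmorph0]. Qed.

Lemma chart_rep_base a : chart_rep (adj_map _ _ a) 0 a 0.
Proof. by split; [apply: ideal0|rewrite !expr0 mul1r mulr1 addr0]. Qed.

Lemma chart_repD z w n a i m b j : chart_rep z n a i -> chart_rep w m b j ->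
  chart_rep (z + w) (n + m) (a + b) (i * g ^+ m + j * g ^+ n).
Proof.
move=> [hi ha] [hj hb]; split.
  by apply: idealD; [|rewrite addnC]; apply: redn_mulX.
rewrite (_ : val (z + w) = val z + val w) //.
rewrite (_ : _ * _ = phi g ^+ m * (phi g ^+ n * val z) + phi g ^+ n * (phi g ^+ m * val w)).
  by rewrite ha hb -!(rmorphXn phi) -!rmorphM -rmorphD exprD; congr (phi _); ring.
by rewrite exprD; ring.
Qed.

Lemma chart_repM z w n a i m b j : chart_rep z n a i -> chart_rep w m b j ->
  chart_rep (z * w) (n + m) (a * b) (b * (i * g ^+ m) + a * (j * g ^+ n) + i * j).
Proof.
move=> [hi ha] [hj hb]; split.
  apply: idealD; last exact: redn_mul.
  by apply: idealD; apply: idealM; [|rewrite addnC]; apply: redn_mulX.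
by rewrite (_ : val (z * w) = val z * val w) // exprD mulrACA ha hb -rmorphM exprD; congr (phi _); ring.
Qed.

Definition chart_ideal_def : ideal chart.
Proof.
exists [set z | exists n a i, chart_rep z n a i /\ p a].
- by exists 0%N, 0, 0; split; [exact: chart_rep0|apply: ideal0].
- move=> z w [n [a [i [hz pa]]]] [m [b [j [hw pb]]]].
  by do 3!eexists; split; [apply: chart_repD hz hw|apply: idealD].
- move=> z w [m [b [j [hw pb]]]]; have [n [a [i hz]]] := chart_repP z.
  by do 3!eexists; split; [apply: chart_repM hz hw|apply: idealM].
Defined.

Lemma chart_prime : exists N : spec chart, forall z n a i, chart_rep z n a i -> (N z <-> p a).
Proof.
have key z n a i : chart_rep z n a i -> (chart_ideal_def z <-> p a).
  move=> hz; split=> [[m [b [j [hz' pb]]]]|pa]; last by exists n, a, i.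
  apply: contrapT => pa; apply: (chart_rep_sub hz hz') => pab; apply: pa.
  by rewrite -[a](subrK b); apply: idealD.
unshelve eexists (@Spec _ chart_ideal_def _ _) => //.
- have h : chart_rep 1 0 1 0.
    by split; [apply: ideal0|rewrite !expr0 mul1r mulr1 addr0 rmorph1].
  by move/(key _ _ _ _ h); apply: spec_proper.
- move=> z w; have [n [a [i hz]]] := chart_repP z; have [m [b [j hw]]] := chart_repP w.
  move/(key _ _ _ _ (chart_repM hz hw))/spec_prime => [h|h]; [left|right].
    exact/(key _ _ _ _ hz).
  exact/(key _ _ _ _ hw).
Qed.

Lemma chart_domain (z w : chart) : z * w = 0 -> z = 0 \/ w = 0.
Proof.
move=> /(congr1 val) /= /F_dom[h|h]; [left|right]; exact: val_inj.
Qed.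

Lemma chart_zero_prime : exists K : spec chart, forall z, K z <-> z = 0.
Proof.
have n1 : (1 : chart) <> 0.
  move=> /(congr1 val) /= e; case: (spec_proper (s := P)).
  by apply/phi0; rewrite rmorph1.
unshelve eexists (@Spec _ (princ (0 : chart)) _ _).
- by move/princP => [a]; rewrite mulr0.
- by move=> a b /princP[c]; rewrite mulr0 => /chart_domain[->|->]; [left|right]; apply: ideal0.
- move=> z; split=> [/princP[a ->]|->]; [exact: mulr0|exact: ideal0].
Qed.

Lemma chart_noetherian : noetherian R -> noetherian chart.
Proof. by move=> noeR; apply: noeth_generated erefl noeR (@adj_generated _ _ phi chart_gens). Qed.

End BlowupChart.

(** If g is not integral, take the chart E, its prime N, and a prime pp missing g such that N is
    minimal over (g) + pp. Modulo pp and at N, some N^L lies in (g), hence I + p^(L+1) lies in g N.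
    An integral equation of g over that ideal gives g^(n+1) in g^(n+1) N, and cancelling g puts an
    element outside N into N. *)
Theorem cl_adic (R : comPzRingType) (p : spec R) (I : ideal R) (g : R) : noetherian R ->
  (forall N, cl p (iadd I (ideal_exp p N)) g) -> cl p I g.
Proof.
move=> noeR hN; apply: contrapT => ncl.
have Ip : I `<=` p.
  by move=> s Is; apply: contrapT => ps; apply: ncl; apply: cl_unit Is ps.
have pg : p g.
  apply: (@cl_prime _ p p) => //; apply: clS (hN 1%N).
  by apply: iadd_sub => //; apply: iexp1E.
have [P [Pp hP Pg]] := monic_val_prime ncl.
have [F [phi [phi0 phiV F_dom]]] := residue_field P.
have [ginv gV] := phiV g Pg.
have [xs eI] := noeth_gen noeR I; rewrite eI in hP.
have [N hNE] := chart_prime phi0 gV hP.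
have [K hK] := @chart_zero_prime _ _ phi P ginv xs phi0 F_dom.
pose E := chart phi ginv xs; pose c := @adj_map _ _ phi (chart_gens phi ginv xs) : {rmorphism R -> E}.
have Nc a : N (c a) <-> p a by apply: hNE; apply: chart_rep_base.
have noeE : noetherian E by apply: chart_noetherian.
have [|||pp [_ ppN ppg minN]] := @one_dim_prime E noeE K N (c g).
- by move=> z /hK ->; apply: ideal0.
- exact/Nc.
- move=> /hK/(congr1 val) /= e; case: Pg; exact/phi0.
have [t [L [Nt ht]]] := rad_pow noeE minN.
(* The exponent is L + 1 and not L because the spare factor from p supplies the element of N in
   [step1]. *)
have hL := hN L.+1; set I' := iadd I _ in hL.
have step1 : I' `<=` idiv_def c N pp t (c g).
  apply: iadd_sub.
    rewrite eI; apply: gen_sub => x xs_x.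
    have hz : phi x * ginv \in chart_gens phi ginv xs by apply: map_f.
    pose z : E := adj_mem phi hz.
    have Nz : N z.
      apply/(hNE z 1%N 0 x); last exact: ideal0.
      split; first exact/redn1/mem_gen.
      by rewrite mul0r add0r expr1 /= mulrCA gV mulr1.
    exists (t * z); first exact: idealM.
    rewrite (_ : _ - _ = 0); first exact: ideal0.
    rewrite (_ : c x = c g * z); first by ring.
    by apply: val_inj; rewrite /= mulrCA gV mulr1.
  rewrite iexpS; apply: imul_sub => n y pn py.
  have : ideal_exp N L (c y).
    have sub : ideal_exp p L `<=` ipre c (ideal_exp N L).
      move: (L) => l; elim: l => [|l IHl]; first by move=> x _; apply/ipreE/iexp0.
      rewrite iexpS; apply: imul_sub => a b pa hb; apply/ipreE.
      by rewrite rmorphM; apply: imulM; [apply/Nc|apply/ipreE/IHl].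
    exact/ipreE/sub.
  move=> /ht/iaddP[_ [pi [/princP[r ->] hpi e]]].
  exists (c n * r); first by apply/idealMr/Nc.
  rewrite rmorphM (mulrCA t) e mulrDr.
  rewrite (_ : _ - _ = c n * pi); first exact: idealM.
  by ring.
have step2 n : ideal_exp (iadd I' (princ g)) n `<=` idiv_def c (ideal_exp N 0) pp (t ^+ n) (c g ^+ n).
  elim: n => [|n IHn].
    move=> x _; exists (c x); first exact: iexp0.
    by rewrite !expr0 subrr; apply: ideal0.
  rewrite iexpS; apply: imul_sub => x y hx /IHn[r _ hr].
  have [q hq] : exists q, pp (t * c x - c g * q).
    move/iaddP: hx => [u [_ [/step1[q _ hq] /princP[b ->] ->]]].
    exists (q + t * c b); rewrite rmorphD rmorphM.
    by rewrite (_ : _ - _ = t * c u - c g * q) //; ring.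
  exists (q * r); first exact: iexp0.
  rewrite rmorphM (_ : _ - _ = (t * c x - c g * q) * (t ^+ n * c y) + (c g * q) * (t ^+ n * c y - c g ^+ n * r)).
    by apply: idealD; [apply: idealMr|apply: idealM].
  by rewrite !exprS; ring.
have step3 n : red I' g n `<=` idiv_def c N pp (t ^+ n.+1) (c g ^+ n.+1).
  apply: imul_sub => x y /step1[q Nq hq] /step2[r _ hr].
  exists (q * r); first exact: idealMr.
  rewrite rmorphM (_ : _ - _ = (t * c x - c g * q) * (t ^+ n * c y) + (c g * q) * (t ^+ n * c y - c g ^+ n * r)).
    by apply: idealD; [apply: idealMr|apply: idealM].
  by rewrite !exprS; ring.
have [s ps [n /step3[q Nq hq]]] := hL.
have : pp (c g ^+ n.+1 * (t ^+ n.+1 * c s - q)).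
  rewrite [X in pp X](_ : _ = t ^+ n.+1 * c (s * g ^+ n.+1) - c g ^+ n.+1 * q); first exact: hq.
  by rewrite rmorphM rmorphXn; ring.
move=> /spec_prime[/prime_exp//|/ppN/(idealDr (idealN Nq))/spec_prime[/prime_exp//|]].
by move/Nc.
Qed.

(** * The colon property *)

Section Dimension.
Variable R : comPzRingType.
Implicit Types (I J : ideal R) (p q P Q : spec R) (xs ys zs : seq R).
Hypothesis noeR : noetherian R.

(** This bounds the dimension of R_p / I R_p. *)
Definition dimle p I n : Prop := forall q k, I `<=` q -> chn q k p -> (k <= n)%N.

Lemma dimleS p I J n : I `<=` J -> dimle p I n -> dimle p J n.
Proof. by move=> IJ h q k Jq; apply: h => x /IJ/Jq. Qed.

Lemma princ0_sub I : princ 0 `<=` I.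
Proof. by apply/princ_sub/ideal0. Qed.

Lemma dimle_minover p I : I `<=` p -> dimle p I 0 -> minover p I.
Proof.
move=> Ip h; split=> // q Iq qp; apply: contrapT => e.
by have := h q 1%N Iq (chn1 qp e).
Qed.

Lemma chn_extend P h q q' k p : chn P h q -> q `<=` q' -> chn q' k p ->
  exists2 l, (h + k <= l)%N & chn P l p.
Proof.
move=> hq qq' hp; have [e|ne] := pselect (q = q').
  by exists (h + k)%N => //; apply: chn_cat hq _; rewrite e.
exists (h + k.+1)%N; first by rewrite leq_add2l.
exact: chn_cat hq (chnS qq' ne hp).
Qed.

Lemma exact_height p : exists2 d, dimle p (princ 0) d & exists P, chn P d p.
Proof.
have [n hn] := chn_bound noeR p.
have ex : exists d, `[< exists P, chn P d p >] by exists 0%N; apply/asboolP; exists p; apply: chn0.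
have bd d : `[< exists P, chn P d p >] -> (d <= n)%N by move=> /asboolP[P]; apply: hn.
case: (ex_maxnP ex bd) => d /asboolP hd maxd; exists d => // q k _ hk.
by apply: maxd; apply/asboolP; exists q.
Qed.

(** A prime over I that starts a chain of full length n.+1 up to p is minimal over I, so there are
    finitely many; likewise for I' and p'. Avoiding all of them at once lowers both dimensions. *)
Lemma param_step p p' I I' (a : ideal R) z0 n n' :
  dimle p I n.+1 -> dimle p' I' n'.+1 ->
  (forall q, I `<=` q -> chn q n.+1 p -> ~ (a `<=` q /\ q z0)) ->
  (forall q, I' `<=` q -> chn q n'.+1 p' -> ~ (a `<=` q /\ q z0)) ->
  exists2 c, a c & dimle p (iadd (princ (z0 + c)) I) n /\
                   dimle p' (iadd (princ (z0 + c)) I') n'.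
Proof.
move=> d1 d2 b1 b2.
have [ps [ps1 ps2]] := primes_over noeR I.
have [ps' [ps'1 ps'2]] := primes_over noeR I'.
pose bad := List.filter (fun q => `[< chn q n.+1 p >]) ps.
pose bad' := List.filter (fun q => `[< chn q n'.+1 p' >]) ps'.
have [|c ac hc] := @coset_avoid _ (bad ++ bad')%list a z0.
  move=> q /List.in_app_iff[] /List.filter_In[hin /asboolP hq].
    by apply: b1 => //; apply: ps1.
  by apply: b2 => //; apply: ps'1.
exists c => //; split=> q k hI hq; rewrite leqNgt; apply/negP => nk.
  have Iq : I `<=` q by move=> x Ix; apply/hI/iaddr.
  have ek : k = n.+1 by apply/eqP; rewrite eqn_leq nk (d1 q k Iq hq).
  have [q0 q0in q0q] := ps2 q Iq.
  have e : q0 = q.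
    apply: contrapT => ne; have := d1 q0 k.+1 (ps1 _ q0in) (chnS q0q ne hq).
    by rewrite ek ltnn.
  apply: (hc q); last by apply/hI/iaddl/princ_id.
  by apply/List.in_app_iff; left; apply/List.filter_In; rewrite -{1}e; split=> //; apply/asboolP; rewrite -ek.
have Iq : I' `<=` q by move=> x Ix; apply/hI/iaddr.
have ek : k = n'.+1 by apply/eqP; rewrite eqn_leq nk (d2 q k Iq hq).
have [q0 q0in q0q] := ps'2 q Iq.
have e : q0 = q.
  apply: contrapT => ne; have := d2 q0 k.+1 (ps'1 _ q0in) (chnS q0q ne hq).
  by rewrite ek ltnn.
apply: (hc q); last by apply/hI/iaddl/princ_id.
by apply/List.in_app_iff; right; apply/List.filter_In; rewrite -{1}e; split=> //; apply/asboolP; rewrite -ek.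
Qed.

Lemma param_extend eta p p' (a : ideal R) J zs m :
  dimle p (gen zs) (m + eta) -> dimle p' J eta ->
  (forall q k, gen zs `<=` q -> a `<=` q -> chn q k p -> (k <= m)%N) ->
  (forall q k, J `<=` q -> a `<=` q -> chn q k p' -> k = 0%N) ->
  exists ys, [/\ size ys = eta, forall y, y \in ys -> a y,
     dimle p (gen (ys ++ zs)) m & dimle p' (iadd (gen ys) J) 0].
Proof.
elim: eta J zs => [|eta IH] J zs d1 d2 b1 b2.
  exists [::]; split=> //; first by rewrite addn0 in d1.
  by apply: dimleS d2; apply: iaddr.
rewrite addnS in d1.
have [||c ac [d1' d2']] := param_step (a := a) (z0 := 0) d1 d2.
- by move=> q zq hq [aq _]; have := b1 _ _ zq aq hq; lia.
- by move=> q Jq hq [aq _]; have := b2 _ _ Jq aq hq.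
rewrite add0r in d1' d2'.
have [||ys [sys ays e1 e2]] := IH (iadd (princ c) J) (c :: zs) d1' d2'.
- by move=> q k zq; apply: b1 => x hx; apply/zq/iaddr.
- by move=> q k zq; apply: b2 => x hx; apply/zq/iaddr.
exists (rcons ys c); split.
- by rewrite size_rcons sys.
- by move=> y; rewrite mem_rcons inE => /orP[/eqP ->|/ays].
- by rewrite cat_rcons.
apply: dimleS e2; apply: iadd_sub.
  by move=> x hx; apply/iaddl; apply: genS hx => y ys_y; rewrite mem_rcons inE ys_y orbT.
apply: iaddS => //; apply/princ_sub/mem_gen.
by rewrite mem_rcons mem_head.
Qed.

Lemma pow_primes zs q n : (forall z, z \in zs -> q (z ^+ n)) -> gen zs `<=` q.
Proof. by move=> h; apply: gen_sub => z /h/prime_exp. Qed.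

(* By [krull_height] the hypotheses force [size xs + 1] to be the height of p.
   Formally equidimensional local rings have this property by a theorem of Ratliff. *)
Definition colon_captured p : Prop := forall xs x g P,
  chn P (size xs).+1 p -> minover p (gen (x :: xs)) -> gen xs (g * x) -> cl p (gen xs) g.

Lemma gen_catE xs ys I : gen xs `<=` I -> gen ys `<=` I -> gen (xs ++ ys) `<=` I.
Proof. by move=> h k x /gen_cat; apply: iadd_sub. Qed.

(* Were the height of p larger, parameters z1 at q, z2 in Q cutting out Q modulo q and
   ys cutting out p modulo Q would leave room for a further parameter xd in Q.  Modulo
   high powers, [sg * t ^+ k0.+1] with [sg] outside q and [t] outside Q multiplies a power
   of xd into the ideal of the others, so it is integral over that ideal at p, which
   puts [sg] in q. *)
Lemma dimension_additive p q Q P h0 eta r d' : colon_captured p ->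
  q `<=` Q -> Q `<=` p -> dimle q (princ 0) h0 -> dimle Q q eta -> dimle p Q r ->
  chn P d' p -> (d' <= h0 + eta + r)%N.
Proof.
move=> Dp qQ Qp hh0 heta hr hd'; rewrite leqNgt; apply/negP => ltd'.
have [d hd [P1 Pd]] := exact_height p.
have dd := hd _ _ (@princ0_sub P) hd'.
have [h hh [P0 Ph]] := exact_height q.
have hh' := hh0 _ _ (@princ0_sub P0) Ph.
have {dd hh' ltd'} ltd : (h + eta + r < d)%N by lia.
clear hd' hh0 h0.
(* The h elements z1 also lower the dimension at p by h, since a chain from a prime over q up to p
   has at most d - h steps. *)
have [||||z1 [sz1 z1q d1 e1]] := @param_extend h p q q (princ 0) [::] (d - h).
- by rewrite subnK; [apply: hd|lia].
- exact: hh.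
- move=> q' k _ qq' hk; have [l hl /(hd _ _ (@princ0_sub _))] := chn_extend Ph qq' hk.
  by lia.
- move=> q' k _ qq' hk; have e : q = q' by apply: spec_ext => //; apply: chn_sub hk.
  by rewrite e in hk; apply: chn_refl hk.
have {e1} minq : minover q (gen z1).
  apply: dimle_minover; first exact: gen_sub.
  by apply: dimleS e1; apply: iadd_sub => //; apply: princ0_sub.
rewrite cats0 in d1.
have [||||z2 [sz2 z2Q d2 e2]] := @param_extend eta p Q Q q z1 (d - h - eta).
- by rewrite subnK //; lia.
- exact: heta.
- by move=> q' k _ Qq' /(hr _ _ Qq'); lia.
- move=> q' k _ qq' hk; have e : Q = q' by apply: spec_ext => //; apply: chn_sub hk.
  by rewrite e in hk; apply: chn_refl hk.
have {e2} minQ : minover Q (iadd (gen z2) q).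
  by apply: dimle_minover e2; apply: iadd_sub => //; apply: gen_sub.
have [||||ys [sys ysp d3 e3]] := @param_extend r p p p Q (z2 ++ z1) (d - h - eta - r).
- by rewrite subnK //; lia.
- exact: hr.
- move=> q' k _ qq' hk; have e : p = q' by apply: spec_ext => //; apply: chn_sub hk.
  by rewrite e in hk; rewrite (chn_refl hk).
- move=> q' k _ qq' hk; have e : p = q' by apply: spec_ext => //; apply: chn_sub hk.
  by rewrite e in hk; apply: chn_refl hk.
have Qys q' k : gen (ys ++ z2 ++ z1) `<=` q' -> Q `<=` q' -> chn q' k p -> (k <= 0)%N.
  move=> h1 h2; apply: e3; apply: iadd_sub => //.
  by move=> x hx; apply: h1; apply: gen_catl.
have [||||ws [sws wsQ d4 _]] := @param_extend (d - h - eta - r) p p Q (gen (ys ++ z2 ++ z1)) (ys ++ z2 ++ z1) 0.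
- exact: d3.
- exact: d3.
- exact: Qys.
- by move=> q' k h1 h2 /(Qys _ _ h1 h2); rewrite leqn0 => /eqP.
case: ws sws wsQ d4 => [|xd ws] /= sws wsQ d4; first by lia.
have Qxd : Q xd by apply: wsQ; apply: mem_head.
have minp : minover p (gen (xd :: ws ++ ys ++ z2 ++ z1)).
  apply: dimle_minover d4; apply: (@gen_catE (xd :: ws)).
    by apply: gen_sub => w /wsQ/Qp.
  apply: gen_catE; first exact: gen_sub.
  apply: gen_catE; first by apply: gen_sub => z /z2Q/Qp.
  by apply: gen_sub => z /z1q/qQ/Qp.
have [sg [k0 [qsg hsg]]] := rad_pow noeR minq.
(* It suffices that sg is integral over q at Q, tested modulo powers of Q. The exponent a0 may be 0;
   the positive a replaces it so that the powers of z2 stay in Q. *)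
apply: qsg; apply: (@cl_prime _ Q q) => //; apply: cl_adic => // a0.
have [a [a_gt0 ha]] : exists a, (0 < a)%N /\ ideal_exp Q a `<=` ideal_exp Q a0.
  by exists a0.+1; split=> //; apply: ideal_exp_sub.
apply: (@clS _ _ (iadd q (ideal_exp Q a))); first exact: iaddS.
pose pw n := map (fun z : R => z ^+ n).
have pwP n zs z : z \in zs -> z ^+ n \in pw n zs by move=> zz; apply: map_f.
(* The powers of z2 still cut out Q modulo q, so at Q a power of xd falls into their ideal modulo
   q. *)
have [t [k [Qt htk]]] : exists t k, ~ Q t /\ iadd (gen (pw a z2)) q (t * xd ^+ k).
  apply: rad_elt => //; apply: minoverI.
    apply: iadd_sub => //; apply: gen_sub => _ /mapP[z zz ->].
    by rewrite -(prednK a_gt0) exprS; apply/idealMr/z2Q.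
  move=> q' hq' q'Q; rewrite (minQ.2 q') //; apply: iadd_sub; last first.
    by move=> x qx; apply/hq'/iaddr.
  by apply: (@pow_primes _ _ a) => z zz; apply/hq'/iaddl/mem_gen/pwP.
(* Raising t xd^k to the power k0 + 1 moves its part in q into q^k0, which sg carries into [gen z1].
   The extra factor xd keeps K positive even if k = 0. *)
pose K := (k * k0.+1).+1.
have rel : gen (pw a z2 ++ z1) (sg * t ^+ k0.+1 * xd ^+ K).
  have h1 : iadd (gen (pw a z2)) (ideal_exp q k0) ((t * xd ^+ k) ^+ (1 + k0)).
    have := iexp_iadd (m := 1) (n := k0) (iexpX (1 + k0) htk).
    by apply: iaddS => //; apply: iexp1E.
  have h2 : gen (pw a z2 ++ z1) (sg * (t * xd ^+ k) ^+ (1 + k0)).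
    have /iaddP[u [v [hu hv ->]]] := h1.
    rewrite mulrDr; apply: idealD; first by apply/idealM/gen_catl.
    by apply: gen_catr; apply: hsg.
  rewrite (_ : _ * _ = xd * (sg * (t * xd ^+ k) ^+ (1 + k0))); first exact: idealM.
  by rewrite /K (exprS xd) exprM add1n exprMn; ring.
(* The ys only complete a system of parameters at p. They occur with arbitrarily high powers, so
   [cl_adic] discards them next. *)
have clN N : cl p (gen (pw a ws ++ pw N.+1 ys ++ pw a z2 ++ z1)) (sg * t ^+ k0.+1).
  apply: (Dp _ (xd ^+ K) _ P1).
  - rewrite !size_cat !size_map sys sz2 sz1 (_ : (_ + _).+1 = d) //; lia.
  - apply: minoverI.
      apply: gen_sub => x; rewrite inE => /orP[/eqP ->|].
        by rewrite /K exprS; apply/idealMr/Qp.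
      have hpw n zs : (forall z, z \in zs -> p z) -> (0 < n)%N -> x \in pw n zs -> p x.
        by move=> hz n0 /mapP[z /hz pz ->]; rewrite -(prednK n0) exprS; apply: idealMr.
      rewrite !mem_cat => /or4P[]; [apply: hpw => // w ww|exact: hpw|apply: hpw => // z /z2Q/Qp //|].
        by apply/Qp/wsQ; rewrite inE ww orbT.
      by move=> /z1q/qQ/Qp.
    move=> q' hq' q'p; rewrite (minp.2 q') //; apply: gen_sub => x.
    have hin y : y \in pw a ws ++ pw N.+1 ys ++ pw a z2 ++ z1 -> q' y.
      by move=> hy; apply/hq'/mem_gen; rewrite inE hy orbT.
    rewrite inE !mem_cat => /orP[/eqP ->|/or4P[] h'].
    + by apply: (@prime_exp _ _ _ K); apply/hq'/mem_gen/mem_head.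
    + by apply: (@prime_exp _ _ _ a); apply: hin; rewrite !mem_cat (pwP _ _ _ h').
    + by apply: (@prime_exp _ _ _ N.+1); apply: hin; rewrite !mem_cat (pwP _ _ _ h') ?orbT.
    + by apply: (@prime_exp _ _ _ a); apply: hin; rewrite !mem_cat (pwP _ _ _ h') ?orbT.
    + by apply: hin; rewrite !mem_cat h' !orbT.
  - by do 2!apply: gen_catr.
have clp : cl p (gen (pw a ws ++ pw a z2 ++ z1)) (sg * t ^+ k0.+1).
  apply: cl_adic => // N; apply: clS (clN N).
  apply: gen_catE; first by move=> x hx; apply/iaddl/gen_catl.
  apply: gen_catE; last by move=> x hx; apply/iaddl/gen_catr.
  apply: gen_sub => _ /mapP[y yy ->]; apply/iaddr/(@ideal_exp_sub _ _ _ N.+1) => //.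
  by apply/iexpX/ysp.
(* At Q the factor t is invertible, and all remaining generators lie in q + Q^a. *)
have {}clp := cl_sub Qp clp.
apply: (@cl_denom _ _ _ _ (t ^+ k0.+1)); first exact: notin_primeX.
rewrite mulrC; apply: clS clp.
apply: gen_catE.
  apply: gen_sub => _ /mapP[w ww ->]; apply/iaddr/iexpX/wsQ.
  by rewrite inE ww orbT.
apply: gen_catE.
  by apply: gen_sub => _ /mapP[z zz ->]; apply/iaddr/iexpX/z2Q.
by apply: gen_sub => z /z1q qz; apply: iaddl.
Qed.

End Dimension.

(** * Descent of the colon property to smaller primes *)

Section Localize.
Variable R : comPzRingType.
Implicit Types (I J : ideal R) (p q P Q : spec R) (xs ys zs : seq R).
Hypothesis noeR : noetherian R.

Lemma isat_sub Q I J : I `<=` isat Q J -> isat Q I `<=` isat Q J.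
Proof. by move=> h a /isatP[s Qs /h]; apply: isat_sat. Qed.

Lemma isat_prime q Q I : q `<=` Q -> I `<=` q -> isat Q I `<=` q.
Proof. by move=> qQ Iq a /isatP[s Qs /Iq/spec_prime[/qQ//|]]. Qed.

(** Avoidance makes y + a a parameter at p unless some q of top dimension over [gen zs] contains y
    and the saturation at Q. Such a q lies in Q and has height at most [size zs], while Q has
    dimension at most [size ys] over q; [dimension_additive] would then bound d by d - 1. *)
Lemma param_lift1 p Q (P0 : spec R) d h ys zs y : colon_captured p -> Q `<=` p ->
  dimle p (princ 0) d -> (exists P, chn P d p) -> chn P0 h Q ->
  size ys + (size zs).+1 = h -> minover Q (gen (ys ++ y :: zs)) ->
  dimle p (gen zs) (d - size zs) ->
  exists a, [/\ isat Q (gen zs) a, dimle p (gen ((y + a) :: zs)) (d - (size zs).+1)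
    & minover Q (gen (ys ++ (y + a) :: zs))].
Proof.
move=> Dp Qp hd [P1 hP1] hh sz minQ dz.
have [l hl /(hd _ _ (@princ0_sub _ _))ld] := chn_extend hh Qp (chn0 p).
rewrite addn0 in hl.
have zsQ : gen zs `<=` Q.
  by move=> x hx; apply: (minQ.1); apply: gen_catr; apply: iaddr.
have yQ : Q y by apply: (minQ.1); apply: mem_gen; rewrite mem_cat mem_head orbT.
have e : (d - size zs = (d - (size zs).+1).+1)%N by lia.
rewrite e in dz.
have bad q : gen zs `<=` q -> chn q (d - (size zs).+1).+1 p -> ~ (isat Q (gen zs) `<=` q /\ q y).
  move=> zq hq [Kq qy].
  have [q2 minq2 q2q] := minover_exists noeR Kq.
  have q2Q : q2 `<=` Q.
    move=> s q2s; apply: contrapT => Qs.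
    have [t' [k' [q2t' hK]]] := rad_elt minq2 q2s.
    apply: q2t'; apply: (minq2.1); apply: (@isat_sat _ _ _ (s ^+ k')); first exact: notin_primeX.
    by rewrite mulrC.
  have e2 : q2 = q.
    apply: contrapT => ne; have := dz q2 _ _ (chnS q2q ne hq).
    rewrite ltnn => /(_ _)/negP; apply; first by apply: (subset_trans _ (minq2.1)); apply: sub_isat.
    by [].
  rewrite e2 in q2Q.
  have : (d <= size zs + size ys + (d - h))%N.
    apply: (@dimension_additive _ noeR p q Q P1) => //.
    - move=> P' k _ hk; have := hd _ _ (@princ0_sub _ _) (chn_cat hk hq); lia.
    - move=> q' k qq' hk; apply: (krull_height noeR _ hk).
      apply: minoverI.
        apply: iadd_sub (chn_sub hk) => x hx; apply: (minQ.1); exact: gen_catl.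
      move=> r hr rQ; rewrite (minQ.2 r) //; apply: gen_catE.
        by move=> x hx; apply/hr/iaddl.
      by apply: gen_sub => x; rewrite inE => /orP[/eqP ->|/mem_gen/zq]; [move: qy|]; move/qq' => h'; apply/hr/iaddr.
    - move=> q' k Qq' hk; have [l' hl' /(hd _ _ (@princ0_sub _ _))] := chn_extend hh Qq' hk.
      by lia.
  by lia.
have [a aK [d1 _]] := param_step noeR dz dz bad bad.
exists a; split=> //.
have Qa : Q a by apply: isat_prime aK.
apply: minoverI.
  apply: gen_catE; first by move=> x hx; apply: (minQ.1); apply: gen_catl.
  by apply: iadd_sub => //; apply/princ_sub/idealD.
move=> q hq qQ; rewrite (minQ.2 q) //; apply: gen_catE.
  by move=> x hx; apply: hq; apply: gen_catl.
have zq : gen zs `<=` q by move=> x hx; apply: hq; apply: gen_catr; apply: iaddr.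
apply: iadd_sub => //; apply: princ_sub; apply: (@idealDr _ _ y a).
  exact: (isat_prime qQ zq).
by apply/hq/mem_gen; rewrite mem_cat mem_head orbT.
Qed.

(** Each y is altered only by an element of the saturation at Q of the ideal of the later ones, so
    the ideal at Q does not change while the new elements become parameters at p. *)
Lemma param_lift p Q (P0 : spec R) d h ys zs : colon_captured p -> Q `<=` p ->
  dimle p (princ 0) d -> (exists P, chn P d p) -> chn P0 h Q ->
  size ys + size zs = h -> minover Q (gen (ys ++ zs)) ->
  exists zs', [/\ size zs' = size zs, gen zs `<=` isat Q (gen zs'), gen zs' `<=` isat Q (gen zs),
     dimle p (gen zs') (d - size zs) & minover Q (gen (ys ++ zs'))].
Proof.
move=> Dp Qp hd hP1 hh; elim: zs ys => [|y zs IH] ys sz minQ.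
  by exists [::]; split=> //; [apply: sub_isat|apply: sub_isat|rewrite subn0].
have [||zs' [sz' h1 h2 d1 min1]] := IH (rcons ys y).
- by rewrite size_rcons -sz /=; lia.
- by rewrite cat_rcons.
rewrite cat_rcons in min1; rewrite -sz' in d1.
have [|a [aK d2 min2]] := param_lift1 Dp Qp hd hP1 hh _ min1 d1; first by rewrite sz'.
have aK' : isat Q (gen zs) a by apply: (isat_sub h2).
exists ((y + a) :: zs'); split=> //; first by rewrite /= sz'.
- apply: iadd_sub; last by move=> x /h1; apply: isatS; apply: iaddr.
  apply: princ_sub; apply: (@idealDr _ _ y a).
    by move: aK; apply: isatS; apply: iaddr.
  by apply/sub_isat/mem_gen/mem_head.
- apply: iadd_sub; last by move=> x /h2; apply: isatS; apply: iaddr.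
  apply/princ_sub/idealD; first by apply/sub_isat/mem_gen/mem_head.
  by move: aK'; apply: isatS; apply: iaddr.
by rewrite /= -sz'.
Qed.

(** Replace xs by parameters at p with the same ideal at Q, change x modulo that ideal, and complete
    by powers ys^(N+1) to parameters of p. The colon property at p gives integrality up to ys^(N+1),
    [cl_adic] removes ys, and integrality at p implies integrality at Q. *)
Theorem colon_captured_sub p Q : colon_captured p -> Q `<=` p -> colon_captured Q.
Proof.
move=> Dp Qp xs x g P0 hh minQ gx.
have [d hd hP1] := exact_height noeR p.
have [xs' [sz' h1 h2 d1 min1]] :=
  @param_lift p Q P0 d _ [:: x] xs Dp Qp hd hP1 hh (add1n _) minQ.
rewrite -sz' in d1.
have [|a [aK d2 min2]] := @param_lift1 p Q P0 d _ [::] xs' x Dp Qp hd hP1 hh _ min1 d1.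
  by rewrite sz'.
have [l hl /(hd _ _ (@princ0_sub _ _))ld] := chn_extend hh Qp (chn0 p).
have sub : gen ((x + a) :: xs') `<=` p by move=> z /(min2.1)/Qp.
have [||ys [sys ysp d3 _]] := @param_extend _ noeR (d - (size xs').+1) p p p
  (gen ((x + a) :: xs')) ((x + a) :: xs') 0 d2 d2.
- move=> q k _ pq hk; have e : p = q by apply: spec_ext => //; apply: chn_sub hk.
  by rewrite e in hk; rewrite (chn_refl hk).
- move=> q k _ pq hk; have e : p = q by apply: spec_ext => //; apply: chn_sub hk.
  by rewrite e in hk; rewrite (chn_refl hk).
have minp : minover p (gen (ys ++ (x + a) :: xs')).
  by apply: dimle_minover d3; apply: gen_catE => //; apply: gen_sub.
have [s Qs hs] : exists2 s, ~ Q s & gen xs' (s * (g * (x + a))).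
  by apply/isatP; rewrite mulrDr; apply: idealD; [apply: h1|apply: idealM].
have [P1 hP1'] := hP1.
have clN N : cl p (gen (map (fun y : R => y ^+ N.+1) ys ++ xs')) (s * g).
  apply: (Dp _ (x + a) _ P1).
  - rewrite size_cat size_map sys (_ : _.+1 = d) //; lia.
  - apply: minoverI.
      apply: gen_sub => z; rewrite inE mem_cat => /or3P[/eqP ->|/mapP[y /ysp yp ->]|zx].
      + exact/sub/mem_gen/mem_head.
      + by rewrite exprS; apply: idealMr.
      + by apply/sub/mem_gen; rewrite inE zx orbT.
    move=> q hq qp; rewrite (minp.2 q) //; apply: gen_catE.
      apply: (@pow_primes _ _ _ N.+1) => y yy; apply/hq/mem_gen.
      by rewrite inE mem_cat (map_f (fun y : R => y ^+ N.+1) yy) orbT.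
    apply: iadd_sub; first by apply/princ_sub/hq/mem_gen/mem_head.
    by move=> z hz; apply: hq; apply: iaddr; apply: gen_catr.
  - by rewrite -mulrA; apply: gen_catr.
have clp : cl p (gen xs') (s * g).
  apply: cl_adic => // N; apply: clS (clN N); apply: gen_catE; last exact: iaddl.
  apply: gen_sub => _ /mapP[y yy ->]; apply/iaddr/(@ideal_exp_sub _ _ _ N.+1) => //.
  by apply/iexpX/ysp.
apply: (cl_equiv noeR h2); apply: (cl_denom Qs); exact: cl_sub clp.
Qed.

(* With P minimal, [dimension_additive] forces a longest chain below Q to be
   matched by one starting at P. *)
Theorem colon_captured_equidim p P P' k : colon_captured p -> (forall q, q `<=` P -> q = P) ->
  P `<=` p -> chn P' k p -> exists2 r : spec R, P `<=` r & chn r k p.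
Proof.
move=> Dp minP Pp hk.
have [n hn] := chn_bound noeR p.
have ex : exists d, `[< chn P d p >].
  have [e|ne] := pselect (P = p); first by exists 0%N; apply/asboolP; rewrite e; apply: chn0.
  by exists 1%N; apply/asboolP/chn1.
have bd d : `[< chn P d p >] -> (d <= n)%N by move=> /asboolP; apply: hn.
case: (ex_maxnP ex bd) => d /asboolP hd maxd.
have : (k <= 0 + d + 0)%N.
  apply: (@dimension_additive _ noeR p P p P') => //.
  - by move=> q l _ hl; have e := minP q (chn_sub hl); rewrite e in hl; rewrite (chn_refl hl).
  - move=> q l Pq hl; have [l' hl' h] := chn_extend (chn0 P) Pq hl.
    by rewrite add0n in hl'; apply: leq_trans hl' _; apply/maxd/asboolP.
  - move=> q l pq hl; have e : p = q by apply: spec_ext => //; apply: chn_sub hl.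
    by rewrite e in hl; rewrite (chn_refl hl).
rewrite add0n addn0 => kd.
rewrite -(subnK kd) in hd; have [r /chn_sub Pr hr] := chn_split hd.
by exists r.
Qed.

End Localize.

Local Open Scope card_scope.

(** * Universally catenary rings *)

Section Catenary.
Variable B : comPzRingType.
Implicit Types (p q r Z K N : spec B) (f : nat -> spec B).

Definition strict_chain f k : Prop :=
  forall i, (i < k)%N -> f i `<=` f i.+1 /\ f i <> f i.+1.

Lemma strict_chain_chn f k i j : strict_chain f k -> (i <= j)%N -> (j <= k)%N ->
  chn (f i) (j - i) (f j).
Proof.
move=> hf ij jk; rewrite -{2}(subnKC ij).
have : (i + (j - i) <= k)%N by rewrite subnKC.
elim: (j - i)%N => [|n IHn] h; first by rewrite addn0; apply: chn0.
rewrite -addn1; apply: (chn_cat (IHn _)); first by lia.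
by rewrite addn1 addnS; have [] := hf (i + n)%N; [lia|exact: chn1].
Qed.

Lemma chn_strict_chain p k q : chn p k q ->
  exists f, [/\ strict_chain f k, f 0%N = p & f k = q].
Proof.
elim=> {p k q} [p|p q r k pq npq _ [f [hf f0 fk]]]; first by exists (fun _ => p).
exists (fun i => if i is j.+1 then f j else p); split=> //.
by case=> [_|i]; rewrite ?f0 // ltnS; apply: hf.
Qed.

Lemma strict_chain_le f k i j : strict_chain f k -> (i <= j)%N -> (j <= k)%N -> f i `<=` f j.
Proof. by move=> hf ij jk; apply: chn_sub (strict_chain_chn hf ij jk). Qed.

Lemma strict_chain_inj f k : strict_chain f k -> {in `I_k.+1 &, injective f}.
Proof.
move=> hf; suff lt i j : (i < j)%N -> (j <= k)%N -> f i <> f j.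
  move=> i j /set_mem /= ik /set_mem /= jk e.
  have [ij|ji|//] := ltngtP i j; first by case: (lt i j ij jk).
  by case: (lt j i ji ik).
move=> ij jk; apply: (chn_gt0 _ (strict_chain_chn hf (ltnW ij) jk)); lia.
Qed.

Lemma strict_chain_card f k : strict_chain f k -> f @` `I_k.+1 #= `I_k.+1.
Proof. by move=> hf; apply: inj_card_eq; apply: strict_chain_inj. Qed.

Lemma strict_chain_between f k : strict_chain f k -> chain_between (f 0%N) (f k) (f @` `I_k.+1).
Proof.
move=> hf; split=> [_ [i /= ik <-]|_ _ [i /= ik <-] [j /= jk <-]].
  by split; apply: (strict_chain_le hf).
have [ij|ji] := leqP i j; [left|right]; apply: (strict_chain_le hf) => //; exact: ltnW.
Qed.

Definition covers p q := forall r, p `<=` r -> r `<=` q -> r = p \/ r = q.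

(** A prime r of a larger chain lies between the last f i that it contains and f i.+1. *)
Lemma saturated_maximal f k : strict_chain f k ->
  (forall i, (i < k)%N -> covers (f i) (f i.+1)) ->
  maximal_chain (f 0%N) (f k) (f @` `I_k.+1).
Proof.
move=> hf sat; split=> [|C [Cb Ctot] fC r Cr]; first exact: strict_chain_between.
have fin i : (i <= k)%N -> C (f i) by move=> ik; apply: fC; exists i.
have ex : exists i, (i <= k)%N && `[< f i `<=` r >].
  by exists 0%N; apply/asboolP; have [] := Cb r Cr.
have bd i : (i <= k)%N && `[< f i `<=` r >] -> (i <= k)%N by case/andP.
case: (ex_maxnP ex bd) => i /andP[ik /asboolP fir] maxi.
move: ik; rewrite leq_eqVlt => /orP[/eqP e|ik].
  by exists k => //=; apply: spec_ext; [rewrite -e|have [] := Cb r Cr].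
have [h|h] := Ctot _ _ Cr (fin i.+1 ik).
  by have [->|->] := sat i ik r fir h; [exists i => //=; exact: ltnW|exists i.+1].
have : (i < i)%N by apply: maxi; rewrite ik; apply/asboolP.
by rewrite ltnn.
Qed.

(** The maximal chains of [catenary] are arbitrary sets of primes, so even a finite chain is
    extended by Zorn's lemma. *)
Lemma chain_extend p q (C0 : set (spec B)) : chain_between p q C0 ->
  exists2 C, maximal_chain p q C & C0 `<=` C.
Proof.
move=> h0.
have [F FP Ftot|A [PA maxA]] := @Zorn_bigcup _ (fun F => chain_between p q (C0 `|` F)).
  split=> [r [C0r|[X FX Xr]]|r s [hr|[X FX Xr]] [hs|[Y FY Ys]]].
  - exact: h0.1.
  - by have [h _] := FP X FX; apply: h; right.
  - exact: h0.2.
  - by have [_ h] := FP Y FY; apply: h; [left|right].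
  - by have [_ h] := FP X FX; apply: h; [right|left].
  - have [XY|YX] := Ftot X Y FX FY.
      by have [_ h] := FP Y FY; apply: h; right => //; apply: XY.
    by have [_ h] := FP X FX; apply: h; right => //; apply: YX.
exists (C0 `|` A); last by move=> r; left.
split=> // C hC sC; apply: contrapT => nC.
apply: (maxA C); last by rewrite (_ : C0 `|` C = C) //; apply/seteqP; split=> r; [case=> // h; apply: sC; left|right].
split; first by move=> r Ar; apply: sC; right.
by move=> CA; apply: nC => r /CA; right.
Qed.

Lemma max_chn_saturated K k N : chn K k N -> (forall l, chn K l N -> (l <= k)%N) ->
  exists f, [/\ strict_chain f k, f 0%N = K, f k = N & forall i, (i < k)%N -> covers (f i) (f i.+1)].
Proof.
move=> /chn_strict_chain[f [hf f0 fk]] maxk; exists f; split=> // i ik r fr rf.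
apply: contrapT => /not_orP[n1 n2].
have h1 : chn K i (f i).
  by have := strict_chain_chn hf (leq0n i) (ltnW ik); rewrite subn0 f0.
have h2 := strict_chain_chn hf ik (leqnn k).
have := maxk (i + (2 + (k - i.+1)))%N; rewrite -fk => /(_ (chn_cat h1 _)) H.
suff : (i + (2 + (k - i.+1)) <= k)%N by lia.
apply: H; apply: (chnS fr) => [e|]; first exact: n1.
by apply: (chnS rf n2).
Qed.

(** A longest chain from K to N is saturated; preceded by Z, adjacent or equal to K, it is a maximal
    chain from Z to N and has the common length. That length bounds m, since the given chain extends
    to a maximal one. *)
Lemma catenary_chain Z K N m : noetherian B -> catenary B -> Z `<=` K -> K `<=` N ->
  covers Z K -> chn Z m N -> exists2 k, chn K k N & (m <= k.+1)%N.
Proof.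
move=> noeB catB ZK KN covZ hm.
have [n hn] := chn_bound noeB N.
have ex : exists k, `[< chn K k N >].
  have [->|ne] := pselect (K = N); first by exists 0%N; apply/asboolP/chn0.
  by exists 1%N; apply/asboolP/chn1.
have bd k : `[< chn K k N >] -> (k <= n)%N by move=> /asboolP/hn.
case: (ex_maxnP ex bd) => k /asboolP hk maxk; exists k => //.
have [|f [hf f0 fk sat]] := max_chn_saturated hk; first by move=> l hl; apply/maxk/asboolP.
have ZN : Z `<=` N by move=> x /ZK/KN.
have [c hc] := catB Z N ZN.
have lec : (m <= c)%N.
  have [h [hh h0 hm']] := chn_strict_chain hm.
  have := strict_chain_between hh; rewrite h0 hm' => /chain_extend[C maxC subC].
  have : `I_m.+1 #<= `I_c.+1.
    rewrite -(card_le_eql (strict_chain_card hh)).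
    apply: card_le_trans (subset_card_le subC) _.
    by have /card_eqPle[] := hc C maxC.
  by rewrite card_le_II.
apply: leq_trans lec _.
have final g l : strict_chain g l -> g 0%N = Z -> g l = N ->
   (forall i, (i < l)%N -> covers (g i) (g i.+1)) -> c = l.
  move=> hg g0 gl gsat; have := saturated_maximal hg gsat; rewrite g0 gl => /hc h.
  have : `I_c.+1 #= `I_l.+1 by rewrite -(card_eqr (strict_chain_card hg)) card_eq_sym.
  by move=> /card_eq_II[].
have [e|ne] := pselect (Z = K); first by rewrite (final f k) // ?f0.
rewrite (final (fun i => if i is j.+1 then f j else Z) k.+1) //.
- by case=> [_|i]; rewrite ?f0 // ltnS; apply: hf.
- by case=> [_|i]; rewrite ?f0 // ltnS; apply: sat.
Qed.

End Catenary.

Lemma chn_spre (A B : comPzRingType) (h : {rmorphism A -> B}) (p q : spec B) k :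
  (forall y, exists x, h x = y) -> chn p k q -> chn (spre h p) k (spre h q).
Proof.
move=> hs; elim=> {p k q} [p|p q r k pq npq _ IH]; first exact: chn0.
apply: chnS IH; first by move=> x /spreE/pq/spreE.
move=> e; apply: npq; apply: spec_ext => // y qy; have [x ex] := hs y.
by rewrite -ex; apply/spreE; rewrite e; apply/spreE; rewrite ex.
Qed.

Definition integral_ring (A : comPzRingType) := forall x y : A, x * y = 0 -> x = 0 \/ y = 0.

Lemma zero_spec (A : comPzRingType) : integral_ring A -> (1 : A) <> 0 ->
  exists K : spec A, forall x, K x <-> x = 0.
Proof.
move=> dA n1; unshelve eexists (@Spec _ (princ (0 : A)) _ _).
- by move/princP => [a]; rewrite mulr0.
- by move=> a b /princP[c]; rewrite mulr0 => /dA[->|->]; [left|right]; apply: ideal0.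
- move=> z; split=> [/princP[a ->]|->]; [exact: mulr0|exact: ideal0].
Qed.

Lemma generated_poly (R : comPzRingType) (E : comNzRingType) (f : {rmorphism R -> E}) zs :
  generated f zs -> generated (@polyC E \o f : {rmorphism R -> {poly E}}) ('X :: map polyC zs).
Proof.
move=> gf S S1 fS zS.
have Sc c : c%:P \in S.
  have := gf (fun c => c%:P \in S); apply.
  - case: S1 => a b d; split.
    + by rewrite unfold_in /= polyC1.
    + by move=> x y; rewrite !unfold_in /= rmorphB; apply: b.
    + by move=> x y; rewrite !unfold_in /= rmorphM; apply: d.
  - by move=> r; rewrite unfold_in; apply: fS.
  - by move=> z zz; rewrite unfold_in; apply: zS; rewrite inE map_f ?orbT.
case: S1 => _ SB SM.
have SX : 'X \in S by apply: zS; rewrite mem_head.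
have S0 : 0 \in S by rewrite -(subrr 'X); apply: SB.
have SN x : x \in S -> - x \in S by move=> xS; rewrite -sub0r; apply: SB.
apply: poly_ind => // p c pS; rewrite -[c%:P]opprK; apply: SB; first exact: SM.
exact/SN.
Qed.

(* Adjoining one fraction z = y/g with [N' = (N, z)]: in E[X] the prime
   [(N, X)] has a chain longer by one, while the kernel of [X |-> z] has height
   at most one, so catenarity gives the chain below N'. *)
Lemma chain_adjoin_fraction_nz (R : comPzRingType) (E E' : comNzRingType)
    (f : {rmorphism R -> E}) zs (iota : {rmorphism E -> E'}) (z : E') (g y : E)
    (N : spec E) (N' : spec E') r d :
  universally_catenary R -> generated f zs -> noetherian E ->
  integral_ring E -> integral_ring E' -> injective iota -> generated iota [:: z] ->
  g <> 0 -> iota g * z = iota y -> N' z -> (forall a, N' (iota a) <-> N a) ->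
  chn r d N -> exists r', chn r' d N'.
Proof.
move=> ucR gf noeE dE dE' inj gz g0 gzy N'z N'N hr.
have cz : commr_rmorph iota z by move=> x; apply: mulrC.
pose pi : {rmorphism {poly E} -> E'} := horner_morph cz.
have c0 : commr_rmorph (idfun : {rmorphism E -> E}) 0 by move=> x; apply: mulrC.
pose ev : {rmorphism {poly E} -> E} := horner_morph c0.
have piX : pi 'X = z by rewrite /pi /= horner_morphX.
have piC c : pi c%:P = iota c by rewrite /pi /= horner_morphC.
have evX : ev 'X = 0 by rewrite /ev /= horner_morphX.
have evC c : ev c%:P = c by rewrite /ev /= horner_morphC.
have pi_surj b : exists x, pi x = b.
  have [S1 S2 S3] := subring_closed_range pi.
  apply/asboolP; apply: (gz (fun b => `[< exists x, pi x = b >])) => //.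
    by move=> c; apply/asboolP; exists c%:P.
  by move=> x; rewrite inE => /eqP ->; apply/asboolP; exists 'X.
have ev_surj b : exists x, ev x = b by exists b%:P.
have noeP := hilbert_basis noeE.
have i1 : (1 : E') <> 0 by apply/eqP/oner_neq0.
have [K0 hK0] := zero_spec dE' i1.
pose K := spre pi K0.
have KE p : K p <-> pi p = 0 by rewrite -hK0; apply: spreE.
have dP : integral_ring {poly E}.
  move=> p q pq; apply: contrapT => /not_orP[/eqP p0 /eqP q0].
  have : lead_coef p * lead_coef q = 0.
    by rewrite mul_lead_coef pq coef0.
  by move=> /dE[] /eqP; rewrite lead_coef_eq0 ?(negbTE p0) ?(negbTE q0).
have p1 : (1 : {poly E}) <> 0 by apply/eqP/oner_neq0.
have [Z hZ] := zero_spec dP p1.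
pose x := g%:P * 'X - y%:P.
have pix : pi x = 0 by rewrite rmorphB rmorphM !piC piX gzy subrr.
(* Pseudo-division by the linear polynomial x: for p in the kernel of [pi] the remainder c is 0, so
   g^n p is a multiple of x. Hence K is minimal over x. *)
have pseudo (p : {poly E}) : exists n q c, (g ^+ n)%:P * p = x * q + c%:P.
  elim/poly_ind: p => [|p a [n [q [c e]]]]; first by exists 0%N, 0, 0; rewrite !mulr0 addr0.
  exists n.+1, (g%:P * 'X * q + c%:P), (c * y + g ^+ n.+1 * a).
  rewrite exprS polyCM polyCD !polyCM.
  have -> : g%:P * (g ^+ n)%:P * (p * 'X + a%:P)
     = g%:P * 'X * ((g ^+ n)%:P * p) + g%:P * (g ^+ n)%:P * a%:P by ring.
  by rewrite e /x; ring.
have ZK : Z `<=` K by move=> p /hZ ->; apply: ideal0.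
have minK : minover K (iadd (princ x) Z).
  apply: minoverI; first by apply: iadd_sub => //; apply/princ_sub/KE.
  move=> q hq qK p /KE pp0; have [n [s [c e]]] := pseudo p.
  have ic : iota c = 0.
    by have := congr1 pi e; rewrite rmorphM pp0 mulr0 rmorphD rmorphM pix mul0r add0r piC => <-.
  have {}ic : c = 0 by apply: inj; rewrite ic rmorph0.
  have : q ((g ^+ n)%:P * p).
    by rewrite e ic addr0; apply/idealMr/hq/iaddl/princ_id.
  move=> /spec_prime[/qK/KE|//]; rewrite piC -(rmorph0 iota) => /inj.
  elim: n {e} => [/eqP|n IHn]; first by rewrite expr0 oner_eq0.
  by rewrite exprS => /dE[/g0|/IHn].
have cov : covers Z K.
  move=> q Zq qK; have [->|ne] := pselect (q = K); first by right.
  by left; apply: (krull_principal noeP minK).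
(* Modulo z the maps [pi] and [ev] agree, which identifies the pullbacks of N' and N. *)
have decomp p : exists b, pi p = b * z + iota (ev p).
  elim/poly_ind: p => [|p a _]; first by exists 0; rewrite !rmorph0 mul0r addr0.
  by exists (pi p); rewrite !rmorphD !rmorphM piX evX piC evC rmorph0 mulr0 add0r.
have eN : spre pi N' = spre ev N.
  apply: spec_ext => p /spreE; have [b e] := decomp p => h; apply/spreE; move: h; rewrite ?e => h.
    by apply/N'N; apply: idealDl h; apply: idealM.
  by apply: idealD; [apply: idealM|apply/N'N].
have ucE : catenary {poly E}.
  apply: (ucR _ (@polyC E \o f : {rmorphism R -> {poly E}})).
  by exists ('X :: map polyC zs); apply: generated_poly.
(* The chain pulled back along [ev] starts at a prime containing X, so the zero ideal adds a
   step. *)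
have hZ' : chn Z d.+1 (spre pi N').
  rewrite eN; apply: (chnS _ _ (chn_spre ev_surj hr)).
    by move=> p /hZ ->; apply: ideal0.
  move=> e; have : Z 'X by rewrite e; apply/spreE; rewrite evX; apply: ideal0.
  by move/hZ/eqP; rewrite polyX_eq0.
have KN : K `<=` spre pi N' by move=> p /KE e; apply/spreE; rewrite e; apply: ideal0.
have [k hk dk] := catenary_chain noeP ucE ZK KN cov hZ'.
have hK0' b : K0 (pi b) <-> K b by split=> /spreE.
have [P' hP' eP'] := chn_surj pi_surj hK0' hk.
have e : P' = N'.
  by apply: spec_ext => b; have [c <-] := pi_surj b; [move/eP'/spreE|move/spreE/eP'].
rewrite e ltnS in hP' dk.
rewrite -(subnK dk) in hP'; have [r' _ hr'] := chn_split hP'.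
by exists r'.
Qed.

Lemma chain_adjoin_fraction (R E E' : comPzRingType)
    (f : {rmorphism R -> E}) zs (iota : {rmorphism E -> E'}) (z : E') (g y : E)
    (N : spec E) (N' : spec E') r d :
  universally_catenary R -> generated f zs -> noetherian E ->
  integral_ring E -> integral_ring E' -> injective iota -> generated iota [:: z] ->
  g <> 0 -> iota g * z = iota y -> N' z -> (forall a, N' (iota a) <-> N a) ->
  chn r d N -> exists r', chn r' d N'.
Proof.
have n1 (A : comPzRingType) (p : spec A) : (1 : A) <> 0.
  by move=> e; apply: (@spec_proper _ p); rewrite e; apply: ideal0.
have h1 := n1 _ N; have h2 := n1 _ N'; move: h1 h2.
move: E E' f zs iota z g y N N' r d.
pose T (E E' : comPzRingType) := forall (f : {rmorphism R -> E}) zs (iota : {rmorphism E -> E'}) (z : E') (g y : E)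
    (N : spec E) (N' : spec E') r d, universally_catenary R -> generated f zs -> noetherian E ->
  integral_ring E -> integral_ring E' -> injective iota -> generated iota [:: z] ->
  g <> 0 -> iota g * z = iota y -> N' z -> (forall a, N' (iota a) <-> N a) ->
  chn r d N -> exists r', chn r' d N'.
suff main : forall E : comPzRingType, (1 : E) <> 0 -> forall E' : comPzRingType, (1 : E') <> 0 -> T E E'.
  by move=> E E' f zs iota z g y N N' r d h1 h2; apply: main.
apply: (@nz_ring_ind (fun E => forall E' : comPzRingType, (1 : E') <> 0 -> T E E')) => E.
apply: (@nz_ring_ind (T E)) => E'.
exact: chain_adjoin_fraction_nz.
Qed.

Section Inclusion.
Variables (R F : comPzRingType) (f : {rmorphism R -> F}) (zs zs' : seq F).
Hypothesis szs : {subset zs <= zs'}.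

Lemma adj_pred_sub z : z \in adj_pred f zs -> z \in adj_pred f zs'.
Proof.
by move=> /asboolP h; apply/asboolP => S S1 fS zS; apply: h => // w /szs/zS.
Qed.

Definition adj_incl (x : adj f zs) : adj f zs' := Sub (val x) (adj_pred_sub (valP x)).

Fact adj_incl_zmod : zmod_morphism adj_incl.
Proof. by move=> x y; apply: val_inj. Qed.
Fact adj_incl_monoid : monoid_morphism adj_incl.
Proof. by split=> [|x y]; apply: val_inj. Qed.
HB.instance Definition _ := GRing.isZmodMorphism.Build _ _ adj_incl adj_incl_zmod.
HB.instance Definition _ := GRing.isMonoidMorphism.Build _ _ adj_incl adj_incl_monoid.

End Inclusion.

Lemma adj_incl_generated (R F : comPzRingType) (f : {rmorphism R -> F}) (zs : seq F) z
    (s : {subset zs <= z :: zs}) :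
  generated (adj_incl (f := f) s : {rmorphism _ -> adj f (z :: zs)}) [:: adj_mem f (mem_head z zs)].
Proof.
move=> S S1 fS zS; apply: (@adj_generated _ _ f (z :: zs)) => // [r|w].
  apply: (eq_ind (adj_incl s (adj_map f zs r)) (fun w => w \in S) (fS _)).
  exact: val_inj.
rewrite mem_pmap => /mapP[v vz]; rewrite insubT ?adj_gen // => h [->].
move: vz; rewrite inE => /orP[/eqP e|vz].
  apply: (eq_ind (adj_mem f (mem_head z zs)) (fun w => w \in S) (zS _ (mem_head _ _))).
  by apply: val_inj; rewrite /= e.
apply: (eq_ind (adj_incl s (adj_mem f vz)) (fun w => w \in S) (fS _)).
exact: val_inj.
Qed.

Lemma monic_val_sub (R : comPzRingType) (p : spec R) (I J : ideal R) g x : I `<=` J ->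
  monic_val p I g x -> monic_val p J g x.
Proof.
move=> IJ [s [n [ps h]]]; exists s, n; split=> //; case: n h => // n; exact: redS.
Qed.

(** * The colon property of universally catenary rings *)

Section UniversallyCatenary.
Variable R : comPzRingType.
Hypothesis noeR : noetherian R.
Hypothesis ucR : universally_catenary R.

(** Without fractions the chart is the image R/P of R, and the chain from r to p is carried over;
    every further fraction is handled by [chain_adjoin_fraction]. *)
Lemma chart_chain (F : comPzRingType) (phi : {rmorphism R -> F}) (p P r : spec R)
    g ginv xs d :
  (forall a, phi a = 0 <-> P a) -> integral_ring F -> phi g * ginv = 1 -> P `<=` r ->
  chn r d p -> (forall x, monic_val p (gen xs) g x -> ~ P x) ->
  forall N : spec (chart phi ginv xs),
    (forall z n a i, chart_rep g z n a i -> (N z <-> p a)) -> exists r', chn r' d N.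
Proof.
move=> phi0 dF gV Pr hr; elim: xs => [|x xs IH] hP N hN.
  have hc := generated_nil (@adj_generated _ _ phi [::]).
  have ker a : adj_map phi [::] a = 0 -> r a.
    by move=> /(congr1 val) /= /phi0/Pr.
  have [r' hr'] := simg hc ker.
  have [N' hN' eN'] := chn_surj hc hr' hr.
  exists r'; rewrite (_ : N = N') //; apply: spec_ext => b; have [a <-] := hc b.
    by move=> /(hN _ _ _ _ (chart_rep_base phi g ginv [::] a))/eN'.
  by move=> /eN'/(hN _ _ _ _ (chart_rep_base phi g ginv [::] a)).
have hP' y : monic_val p (gen xs) g y -> ~ P y.
  by move=> h; apply: hP; apply: monic_val_sub h; apply: iaddr.
have [N0 hN0] := chart_prime phi0 gV hP'.
have [r0 hr0] := IH hP' N0 hN0.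
pose z := phi x * ginv.
have sub : {subset chart_gens phi ginv xs <= z :: chart_gens phi ginv xs}.
  by move=> w hw; rewrite inE hw orbT.
pose io : {rmorphism chart phi ginv xs -> chart phi ginv (x :: xs)} := adj_incl (f := phi) sub.
pose w : chart phi ginv (x :: xs) := adj_mem phi (mem_head z (chart_gens phi ginv xs)).
apply: (@chain_adjoin_fraction R _ _ _ _ io w (adj_map phi _ g) (adj_map phi _ x) N0 N r0 d
  ucR (@adj_generated _ _ phi (chart_gens phi ginv xs))) => //.
- exact: chart_noetherian.
- exact: chart_domain.
- exact: chart_domain.
- by move=> a b /(congr1 val) /= h; apply: val_inj.
- exact: adj_incl_generated.
- move=> /(congr1 val) /= e; have : phi 1 = 0 by rewrite rmorph1 -gV e mul0r.
  by move=> /phi0; apply: spec_proper.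
- by apply: val_inj; rewrite /= /z mulrCA gV mulr1.
- apply/(hN w 1%N 0 x); last exact: ideal0.
  split; first by apply/redn1/mem_gen/mem_head.
  by rewrite mul0r add0r expr1 /= /z mulrCA gV mulr1.
- move=> a; have [n [b [i hb]]] := chart_repP gV a.
  rewrite (hN0 _ _ _ _ hb); apply: (hN _ n b i); case: hb => h1 h2; split=> //.
  by case: n h1 {h2} => // n; apply: redS; apply: iaddr.
Qed.

Theorem universally_catenary_colon_captured :
  (forall (p P P' : spec R) k, (forall q : spec R, q `<=` P -> q = P) -> P `<=` p ->
     chn P' k p -> exists2 r : spec R, P `<=` r & chn r k p) ->
  forall p : spec R, colon_captured p.
Proof.
move=> eqd p xs x g P0 hP0 minp gx; apply: contrapT => ncl.
have [P1 [P1p hP1 P1g]] := monic_val_prime ncl.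
(* The hypothesis [eqd] speaks of minimal primes. A smaller prime still misses g and the values of
   [monic_val]. *)
have [P minP PP1] := minover_exists noeR (@princ0_sub _ P1).
have [r Pr hr] : exists2 r : spec R, P `<=` r & chn r (size xs).+1 p.
  apply: eqd hP0; last by move=> y /PP1/P1p.
  by move=> q qP; apply: (minP.2) => //; apply: princ0_sub.
have hP y : monic_val p (gen xs) g y -> ~ P y by move=> /hP1 h /PP1.
have Pg : ~ P g by move=> /PP1.
have [F [phi [phi0 phiV F_dom]]] := residue_field P.
have [ginv gV] := phiV g Pg.
have [N hN] := chart_prime phi0 gV hP.
have [r' hr'] := chart_chain phi0 F_dom gV Pr hr hP hN.
pose c : {rmorphism R -> chart phi ginv xs} := @adj_map _ _ phi (chart_gens phi ginv xs).
have Nc a : N (c a) <-> p a by apply: hN; apply: chart_rep_base.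
pose zs : seq (chart phi ginv xs) := pmap insub (chart_gens phi ginv xs).
have szs : (size zs <= size xs)%N.
  by rewrite size_pmap; apply: leq_trans (count_size _ _) _; rewrite size_map.
have zsP z : z \in zs -> exists2 y, y \in xs & val z = phi y * ginv.
  rewrite mem_pmap => /mapP[v vg]; rewrite insubT ?adj_gen // => h [->].
  by have /mapP[y yx e] := vg; exists y => //; rewrite SubK.
have cg z y : val z = phi y * ginv -> c y = c g * z.
  by move=> e; apply: val_inj; rewrite /= e mulrCA gV mulr1.
have cinj z w : c g * z = c g * w -> z = w.
  move=> /(congr1 val) /= e; apply: val_inj.
  by rewrite -[val z]mul1r -[val w]mul1r -gV (mulrC (phi g)) -!mulrA e.
have zsN z : z \in zs -> N z.
  move=> /zsP[y yx ez]; apply/(hN z 1%N 0 y); last exact: ideal0.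
  split; first exact/redn1/mem_gen.
  by rewrite mul0r add0r expr1 ez mulrCA gV mulr1.
have gen_dvd y : gen xs y -> exists2 m, gen zs m & c y = c g * m.
  pose K : ideal R := idiv_def c (gen zs) (princ 0) 1 (c g).
  suff : gen xs `<=` K.
    move=> h /h[m hm /princP[b]]; rewrite mul1r mulr0 => /eqP.
    by rewrite subr_eq0 => /eqP; exists m.
  apply: gen_sub => {}y yx; have hz : phi y * ginv \in chart_gens phi ginv xs by apply: map_f.
  have zin : adj_mem phi hz \in zs.
    rewrite mem_pmap; apply/mapP; exists (phi y * ginv) => //.
    by rewrite insubT ?adj_gen // => h; congr Some; apply: val_inj.
  exists (adj_mem phi hz); first exact: mem_gen.
  by rewrite mul1r (cg (adj_mem phi hz) y erefl) subrr; apply: ideal0.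
have rep w : exists a, gen zs (w - c a).
  have := @adj_generated _ _ phi (chart_gens phi ginv xs) (fun w => `[< exists a, gen zs (w - c a) >]).
  move=> h; apply/asboolP; apply: h => {w}.
  - split=> [|u v /asboolP[a ha] /asboolP[b hb]|u v /asboolP[a ha] /asboolP[b hb]]; apply/asboolP.
    + by exists 1; rewrite rmorph1 subrr; apply: ideal0.
    + exists (a - b); rewrite rmorphB opprB addrACA [_ + (c b)]addrC -opprB -addrA.
      by rewrite (_ : _ + _ = (u - c a) - (v - c b)); [apply: idealB|ring].
    + exists (a * b); rewrite rmorphM.
      by rewrite (_ : _ - _ = (u - c a) * v + c a * (v - c b)); [apply: idealD; [apply: idealMr|apply: idealM]|ring].
  - by move=> a; apply/asboolP; exists a; rewrite subrr; apply: ideal0.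
  - by move=> z zz; apply/asboolP; exists 0; rewrite rmorph0 subr0; apply: mem_gen.
(* A prime q over the fractions contracts to a prime containing xs, and also x: g x = g m with m in
   the ideal of the fractions, and g cancels. So q contracts to p, and every element of the chart
   comes from R modulo the fractions, whence q = N. *)
have minN : minover N (iadd (gen zs) r').
  apply: minoverI; first by apply: iadd_sub (chn_sub hr'); apply: gen_sub.
  move=> q hq qN.
  have zq : gen zs `<=` q by move=> z hz; apply/hq/iaddl.
  have eq : spre c q = p.
    apply: (minp.2); last by move=> a /spreE/qN/Nc.
    apply: gen_sub => y; rewrite inE => /orP[/eqP ->|yx]; apply/spreE.
      have [m /zq qm] := gen_dvd _ gx; rewrite rmorphM => /cinj ->; exact: qm.
    by have [m /zq qm ->] := gen_dvd y (mem_gen yx); apply: idealM.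
  move=> w Nw; have [a ha] := rep w.
  have : p a.
    by apply/Nc; apply: (@idealDl _ _ (w - c a)); [apply/qN/zq|rewrite subrK].
  rewrite -eq => /spreE ca; rewrite -[w](subrK (c a)); apply: idealD => //; exact: zq.
have noeE : noetherian (chart phi ginv xs) by apply: chart_noetherian.
have := krull_height noeE minN hr'.
by rewrite ltnNge szs.
Qed.

End UniversallyCatenary.

(** * Completion *)

Section Cohen.
Variable A : comPzRingType.
Implicit Types (I J M : ideal A).

Lemma fg_add a M s : iadd (princ a) M = gen s ->
  exists ms, gen ms `<=` M /\ iadd (princ a) M = gen (a :: ms).
Proof.
move=> e; have : forall x, x \in s -> iadd (princ a) M x by rewrite e; apply: mem_gen.
have [ms [hms sms]] : exists ms, gen ms `<=` M /\
    ((forall x, x \in s -> iadd (princ a) M x) -> forall x, x \in s -> gen (a :: ms) x).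
  elim: {e} s => [|x s [ms [hms sms]]]; first by exists [::]; split=> //; apply: princ0_sub.
  have [/iaddP[u [m [ua Mm ex]]]|nx] := pselect (iadd (princ a) M x); last first.
    by exists ms; split=> // h; case: nx; apply: h; apply: mem_head.
  exists (m :: ms); split; first by apply: iadd_sub => //; apply: princ_sub.
  move=> h y; rewrite inE => /orP[/eqP ->|ys].
    by rewrite ex; apply: idealD; [apply: iaddl|apply/mem_gen; rewrite !inE eqxx orbT].
  have : gen (a :: ms) y by apply: sms => // z zs; apply: h; rewrite inE zs orbT.
  by apply: genS => z; rewrite !inE => /orP[->//|->]; rewrite !orbT.
move=> h; exists ms; split=> //; apply: ideal_ext.
  by rewrite {1}e; apply: gen_sub; apply: sms.
by apply: iaddS.
Qed.

(** An ideal M maximal among those without finite generating set is prime: if ab is in M, generators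
    of (a) + M and of the colon ideal (M : a) combine to generators of M. The relative form over J
    lets [completion_noetherian] treat the generators of [J 1] one at a time. *)
Theorem cohen J : (forall p : spec A, J `<=` p -> exists s, spec_ideal p = gen s) ->
  forall I, J `<=` I -> exists s, I = gen s.
Proof.
move=> hp I JI; apply: contrapT => nI.
have [C chC hC|M [nM IM maxM]] := @zorn_ideal _ (fun K => ~ exists s, K = gen s) I nI.
  have [U hU] := chain_union chC; exists U; last by move=> K CK x Kx; apply/hU; exists K.
  case: chC => [[K0 CK0] tot] [s es].
  have [K CK hK] : exists2 K, C K & forall x, x \in s -> K x.
    have : forall x, x \in s -> U x by rewrite es; apply: mem_gen.
    elim: s {es} => [_|x s IHs hs]; first by exists K0.
    have [|K CK sK] := IHs; first by move=> y ys; apply: hs; rewrite inE ys orbT.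
    have /hU[K' CK' Kx] := hs x (mem_head _ _).
    have [JK|KJ] := tot K K' CK CK'.
      by exists K' => // y; rewrite inE => /orP[/eqP ->|/sK/JK].
    by exists K => // y; rewrite inE => /orP[/eqP ->|/sK] //; apply: KJ.
  apply: (hC K CK); exists s; apply: ideal_ext; last exact: gen_sub.
  by rewrite -es => x Kx; apply/hU; exists K.
have fg_up (K : ideal A) : M `<=` K -> K <> M -> exists s, K = gen s.
  by move=> MK ne; apply: contrapT => nK; apply: ne; exact: (maxM K nK MK).
have M1 : ~ M 1.
  move=> h; apply: nM; exists [:: 1]; apply: ideal_ext; last by apply: gen_sub => x; rewrite inE => /eqP ->.
  by move=> x _; rewrite -[x]mulr1; apply/idealM/mem_gen/mem_head.
have Mp a b : M (a * b) -> M a \/ M b.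
  move=> Mab; apply: contrapT => /not_orP[Ma Mb].
  have [|s es] := fg_up (iadd (princ a) M) (@iaddr _ _ _).
    by move=> e; apply: Ma; rewrite -e; apply/iaddl/princ_id.
  have [ms [hms {}es]] := fg_add es.
  have c0 : M (0 * a) by rewrite mul0r; apply: ideal0.
  have cD x y : M (x * a) -> M (y * a) -> M ((x + y) * a) by rewrite mulrDl; apply: idealD.
  have cM x y : M (y * a) -> M (x * y * a) by rewrite -mulrA; apply: idealM.
  pose K : ideal A := Ideal c0 cD cM.
  have [||ks eK] := fg_up K.
  - by move=> x Mx; apply: idealMr.
  - by move=> e; apply: Mb; rewrite -e /K /= mulrC.
  apply: nM; exists (ms ++ map (fun k => k * a) ks); apply: ideal_ext.
    move=> x Mx; have : gen (a :: ms) x by rewrite -es; apply: iaddr.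
    move=> /iaddP[_ [m [/princP[r ->] hm ex]]].
    rewrite ex addrC; apply: idealD; first exact: gen_catl.
    apply: gen_catr; have : K r by rewrite /K /=; apply: (@idealDr _ _ _ m); [apply: hms|rewrite -ex].
    rewrite eK; elim: (ks) r {ex} => [|k ks' IH] r.
      by move=> /gen_nil ->; rewrite mul0r; apply: ideal0.
    move=> /iaddP[_ [y [/princP[t ->] hy ->]]]; rewrite mulrDl -mulrA; apply: idealD.
      by apply/iaddl/idealM/princ_id.
    by apply/iaddr/IH.
  apply: gen_catE => //; apply: gen_sub => _ /mapP[k kk ->].
  by have : K k by rewrite eK; apply: mem_gen.
have [|s es] := hp (Spec M1 Mp); first by move=> x /JI/IM.
by apply: nM; exists s.
Qed.

End Cohen.

(** * Convergent series and Noetherianity of the completion *)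

Section Completion.
Variables (R A : comPzRingType) (f : {rmorphism R -> A}) (p : ideal R).
Local Notation C := (compl f p).
Local Notation J := (adic f p).
Local Notation iota := (compl_map f p).
Implicit Types (x y z : C) (a b c : A) (s : nat -> A).

Definition ap x l a : Prop := x l = \pi_(quot (J l)) a.

Lemma ap_ex x l : exists a, ap x l a.
Proof. by exists (repr (x l)); rewrite /ap reprK. Qed.

Lemma ap_mono x l m a : (l <= m)%N -> ap x m a -> ap x l a.
Proof. by move=> lm h; rewrite /ap (compl_compat x lm) h trans_pi. Qed.

Lemma ap_eq x l a b : ap x l a -> ap x l b -> J l (a - b).
Proof. by rewrite /ap => -> /quotP. Qed.

Lemma ap_cong x l a b : J l (a - b) -> ap x l a -> ap x l b.
Proof. by rewrite /ap => /quotP <-. Qed.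

Lemma ap_iota a l : ap (iota a) l a.
Proof. by []. Qed.

Lemma apB x y l a b : ap x l a -> ap y l b -> ap (x - y) l (a - b).
Proof. by rewrite /ap => hx hy; rewrite pi_quotB -hx -hy. Qed.

Lemma apD x y l a b : ap x l a -> ap y l b -> ap (x + y) l (a + b).
Proof. by rewrite /ap => hx hy; rewrite pi_quotD -hx -hy. Qed.

Lemma apM x y l a b : ap x l a -> ap y l b -> ap (x * y) l (a * b).
Proof. by rewrite /ap => hx hy; rewrite pi_quotM -hx -hy. Qed.

Lemma ap0 l : ap 0 l 0. Proof. by []. Qed.

Lemma ap_inj x y : (forall l, exists2 a, ap x l a & ap y l a) -> x = y.
Proof. by move=> h; apply: compl_eq => l; have [a -> ->] := h l. Qed.

Lemma ap_lim s : (forall l, J l (s l.+1 - s l)) -> exists x, forall l, ap x l (s l).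
Proof.
move=> hs; have hs' l m : (l <= m)%N -> J l (s m - s l).
  move=> /subnK <-; elim: (m - l)%N => [|k IHk]; first by rewrite subrr; apply: ideal0.
  rewrite addSn -(subrK (s (k + l)%N) (s _.+1)) -addrA; apply: idealD => //.
  by apply: (@adic_sub _ _ f p l (k + l)); [apply: leq_addl|apply: hs].
have compat l m : (l <= m)%N ->
    \pi_(quot (J l)) (s l) = \pi_(quot (J l)) (repr (\pi_(quot (J m)) (s m))).
  by move=> lm; rewrite trans_pi //; apply/quotP; rewrite -opprB; apply/idealN/hs'.
by exists (Compl compat).
Qed.

(** The kernel of the projection to A/J l; that the image of J l generates it is the content of
    [fil_gen]. *)
Definition fil (l : nat) : ideal C.
Proof.
exists (fun x => ap x l 0).
- exact: ap0.
- by move=> x y hx hy; rewrite -[0](addr0 0); apply: apD.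
- by move=> x y hy; have [a ha] := ap_ex x l; rewrite -(mulr0 a); apply: apM.
Defined.

Lemma filE l x : fil l x <-> ap x l 0. Proof. by []. Qed.

Lemma fil_ap l x a : fil l (x - iota a) <-> ap x l a.
Proof.
split=> h.
  by have := apD h (ap_iota a l); rewrite subrK add0r.
by have := apB h (ap_iota a l); rewrite subrr.
Qed.

Lemma fil_sub l m : (l <= m)%N -> fil m `<=` fil l.
Proof. by move=> lm x; apply: ap_mono. Qed.

Lemma fil_sep x : (forall l, fil l x) -> x = 0.
Proof. by move=> h; apply: ap_inj => l; exists 0; [apply: h|]. Qed.

Lemma fil_iota l a : fil l (iota a) <-> J l a.
Proof.
split=> h; first by rewrite -[a]subr0; apply: ap_eq (ap_iota a l) h.
by apply: (ap_cong _ (ap_iota a l)); rewrite subr0.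
Qed.

Lemma adic_mul l m a b : J l a -> J m b -> J (l + m) (a * b).
Proof.
move=> ha; have c0 : J (l + m) (0 * b) by rewrite mul0r; apply: ideal0.
have cD (x y : A) : J (l + m) (x * b) -> J (l + m) (y * b) -> J (l + m) ((x + y) * b).
  by rewrite mulrDl; apply: idealD.
have cM (x y : A) : J (l + m) (y * b) -> J (l + m) (x * y * b) by rewrite -mulrA; apply: idealM.
move=> hb; apply: (ideal_gen_sub (I := Ideal c0 cD cM)) ha => _ /= [r hr <-].
move: b hb {c0 cD cM}.
have c0 : J (l + m) (f r * 0) by rewrite mulr0; apply: ideal0.
have cD (x y : A) : J (l + m) (f r * x) -> J (l + m) (f r * y) -> J (l + m) (f r * (x + y)).
  by rewrite mulrDr; apply: idealD.
have cM (x y : A) : J (l + m) (f r * y) -> J (l + m) (f r * (x * y)) by rewrite mulrCA; apply: idealM.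
move=> b; apply: (ideal_gen_sub (I := Ideal c0 cD cM)) => _ /= [t ht <-].
by rewrite -rmorphM; apply: sub_ideal_gen; exists (r * t) => //; apply: iexpD.
Qed.

Lemma adic_split l m : J (l + m) `<=` ideal_mul (J l) (J m).
Proof.
apply: ideal_gen_sub => _ [r + <-].
suff : ideal_exp p (l + m) `<=` ipre f (ideal_mul (J l) (J m)) by move=> h /h/ipreE.
elim: l => [|l IHl].
  move=> t ht; apply/ipreE; rewrite -[f t]mul1r; apply: imulM.
    by apply: sub_ideal_gen; exists 1; [apply: iexp0|rewrite rmorph1].
  by apply: sub_ideal_gen; exists t.
rewrite addSn iexpS; apply: imul_sub => a b pa /IHl/ipreE hb; apply/ipreE; rewrite rmorphM.
have c0 : ideal_mul (J l.+1) (J m) (f a * 0) by rewrite mulr0; apply: ideal0.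
have cD (x y : A) : ideal_mul (J l.+1) (J m) (f a * x) -> ideal_mul (J l.+1) (J m) (f a * y) ->
  ideal_mul (J l.+1) (J m) (f a * (x + y)) by rewrite mulrDr; apply: idealD.
have cM (x y : A) : ideal_mul (J l.+1) (J m) (f a * y) -> ideal_mul (J l.+1) (J m) (f a * (x * y)).
  by rewrite mulrCA; apply: idealM.
apply: (@imul_sub _ _ _ (Ideal c0 cD cM)) hb => x y hx hy.
change (ideal_mul (J l.+1) (J m) (f a * (x * y))); rewrite mulrA; apply: imulM => //.
apply: (@adic_mul 1 l) => //; apply: sub_ideal_gen; exists a => //; exact: iexp1.
Qed.

Lemma fil_mul l m x y : fil l x -> fil m y -> fil (l + m) (x * y).
Proof.
move=> hx hy; have [a ha] := ap_ex x (l + m); have [b hb] := ap_ex y (l + m).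
apply: (ap_cong _ (apM ha hb)); rewrite subr0; apply: adic_mul.
  by rewrite -[a]subr0; apply: ap_eq (ap_mono _ ha) hx; apply: leq_addr.
by rewrite -[b]subr0; apply: ap_eq (ap_mono _ hb) hy; apply: leq_addl.
Qed.

Lemma fil0 x : fil 0 x.
Proof.
have [a ha] := ap_ex x 0; apply: (ap_cong _ ha).
rewrite -[_ - _]mulr1; apply: idealM; apply: sub_ideal_gen.
by exists 1; [apply: iexp0|rewrite rmorph1].
Qed.

Lemma series (s : nat -> C) : (forall k, fil k (s k)) ->
  exists z, forall n, fil n (z - \sum_(k < n) s k).
Proof.
move=> hs; have [b hb] := choice (fun n => ap_ex (\sum_(k < n) s k) n).
have [|z hz] := @ap_lim b.
  move=> l; have h := ap_mono (leqnSn l) (hb l.+1).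
  rewrite big_ord_recr /= in h; rewrite -[b l]addr0.
  exact: ap_eq h (apD (hb l) (hs l)).
by exists z => n; rewrite filE -(subrr (b n)); apply: apB.
Qed.

(** The sum stays in the ideal because the coefficients of each of the finitely many generators are
    summed separately. *)
Lemma series_ideal (u : C) (ms : seq C) (m : nat -> C) : fil 1 u -> (forall k, gen ms (m k)) ->
  exists2 w, gen ms w & forall n, fil n (w - \sum_(k < n) u ^+ k * m k).
Proof.
move=> fu; elim: ms m => [|a ms IH] m hm.
  exists 0; first exact: ideal0.
  move=> n; rewrite big1 ?subrr; first exact: ideal0.
  by move=> k _; rewrite (gen_nil (hm k)) mulr0.
have hc k : exists c : C, gen ms (m k - c * a).
  have /iaddP[_ [y [/princP[c ->] hy ->]]] := hm k.
  by exists c; rewrite addrAC subrr add0r.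
have [c {}hc] := choice hc.
have [w' hw' fw'] := IH _ hc.
have fX k : fil k (u ^+ k).
  by elim: k => [|k IHk]; [exact: fil0|rewrite exprS -add1n; apply: fil_mul].
have [z hz] := @series (fun k => u ^+ k * c k) (fun k => idealMr _ (fX k)).
exists (z * a + w').
  by apply: idealD; [apply/iaddl/idealM/princ_id|apply: iaddr].
move=> n.
have -> : \sum_(k < n) u ^+ k * m k =
    (\sum_(k < n) u ^+ k * c k) * a + \sum_(k < n) u ^+ k * (m k - c k * a).
  by rewrite mulr_suml -big_split; apply: eq_bigr => k _ /=; ring.
rewrite opprD addrACA -mulrBl; apply: idealD => //; exact: idealMr.
Qed.

Lemma series_gen (js : seq A) s : (forall k, ideal_mul (J k) (gen js) (s k)) ->
  exists2 z, gen (map iota js) z & forall n, ap z n (\sum_(k < n) s k).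
Proof.
elim: js s => [|j js IH] s hs.
  exists 0; first exact: ideal0.
  move=> n; rewrite (_ : \sum_(k < n) s k = 0) // big1 // => k _.
  have := hs k; have -> : gen [::] = princ (0 : A) by [].
  by move=> /imul_subr/gen_nil.
have hc k : exists c, J k c /\ ideal_mul (J k) (gen js) (s k - c * j).
  have c0 : exists c, J k c /\ ideal_mul (J k) (gen js) (0 - c * j).
    by exists 0; rewrite mul0r subrr; split; apply: ideal0.
  have cD (x y : A) : (exists c, J k c /\ ideal_mul (J k) (gen js) (x - c * j)) ->
     (exists c, J k c /\ ideal_mul (J k) (gen js) (y - c * j)) ->
     exists c, J k c /\ ideal_mul (J k) (gen js) (x + y - c * j).
    move=> [c [hc h]] [d [hd h']]; exists (c + d); split; first exact: idealD.
    by rewrite mulrDl opprD addrACA; apply: idealD.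
  have cM (x y : A) : (exists c, J k c /\ ideal_mul (J k) (gen js) (y - c * j)) ->
     exists c, J k c /\ ideal_mul (J k) (gen js) (x * y - c * j).
    move=> [c [hc h]]; exists (x * c); split; first exact: idealM.
    by rewrite -mulrA -mulrBr; apply: idealM.
  apply: (@imul_sub _ (J k) (gen (j :: js)) (Ideal c0 cD cM)) (hs k) => x y hx.
  move=> /iaddP[_ [w [/princP[r ->] hw ->]]]; exists (x * r); split; first exact: idealMr.
  by rewrite mulrDr mulrA addrAC subrr add0r; apply: imulM.
have [c hc'] := choice hc.
have [y hy apy] := IH (fun k => s k - c k * j) (fun k => (hc' k).2).
have [|t ht] := @ap_lim (fun n => \sum_(k < n) c k).
  by move=> l; rewrite big_ord_recr /= addrAC subrr add0r; apply: (hc' l).1.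
exists (t * iota j + y).
  by apply: idealD; [apply/iaddl/idealM/princ_id|apply: iaddr].
move=> n; rewrite (_ : \sum_(k < n) s k = (\sum_(k < n) c k) * j + \sum_(k < n) (s k - c k * j)).
  by apply: apD => //; apply: apM.
by rewrite sumrB -mulr_suml addrC subrK.
Qed.

(** Beyond its approximation a_l, x is the telescoping series of the differences a_(k+1+l) -
    a_(k+l). These lie in J (k + l), inside the product of J k and J l, so [series_gen] sums them
    within the ideal of the generators. *)
Lemma fil_gen l js : J l = gen js -> fil l = gen (map iota js).
Proof.
move=> ej; apply: ideal_ext; last first.
  by apply: gen_sub => _ /mapP[j jj ->]; apply/fil_iota; rewrite ej; apply: mem_gen.
move=> x hx; have [a ha] := choice (ap_ex x).
have [|z hz apz] := @series_gen js (fun k => a (k.+1 + l)%N - a (k + l)%N).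
  move=> k; rewrite -ej; apply: adic_split.
  by apply: (@ap_eq x) => //; apply: (@ap_mono x _ (k.+1 + l)).
have hal : J l (a l) by rewrite -[a l]subr0; apply: (@ap_eq x).
rewrite (_ : x = iota (a l) + z).
  by apply: idealD => //; apply: gen_map; rewrite -ej.
apply: ap_inj => n; exists (a (n + l)%N); first by apply: (@ap_mono x _ (n + l)); rewrite ?leq_addr.
have -> : a (n + l)%N = a l + \sum_(k < n) (a (k.+1 + l)%N - a (k + l)%N).
  elim: n => [|n IHn]; first by rewrite big_ord0 addr0.
  by rewrite big_ord_recr /= addrA -IHn addrC subrK.
exact: apD.
Qed.

Hypothesis noeA : noetherian A.

Theorem completion_noetherian : noetherian C.
Proof.
have [js ej] := noeth_gen noeA (J 1).
suff main ys zs : js = ys ++ zs -> forall I : ideal C, gen (map iota zs) `<=` I ->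
    exists s : seq C, I = gen s.
  apply: noeth_of_gen => I; apply: (main js [::]); first by rewrite cats0.
  exact: princ0_sub.
elim/last_ind: ys zs => [|ys y IH] zs ejs.
  move=> I hI; have fI : fil 1 `<=` I by rewrite (fil_gen ej) ejs.
  have [s es] := noeth_gen noeA (ipre iota I).
  exists (map iota s ++ map iota js); apply: ideal_ext.
    move=> x Ix; have [a ha] := ap_ex x 1.
    have hf : fil 1 (x - iota a) by apply/fil_ap.
    rewrite -[x](subrK (iota a)) addrC; apply: idealD.
      apply: gen_catl; apply: gen_map; rewrite -es; apply/ipreE.
      by have := idealB Ix (fI _ hf); rewrite subKr.
    by apply: gen_catr; rewrite -(fil_gen ej).
  apply: gen_catE; last by rewrite -(fil_gen ej).
  apply: gen_sub => _ /mapP[a aa ->]; apply/ipreE; rewrite es; exact: mem_gen.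
have {}IH : forall I : ideal C, gen (map iota (y :: zs)) `<=` I -> exists s : seq C, I = gen s.
  by apply: IH; rewrite ejs cat_rcons.
apply: cohen => N zN.
have [Ny|Ny] := pselect (N (iota y)).
  by apply: IH; apply: iadd_sub => //; apply: princ_sub.
have [|s es] := IH (iadd (princ (iota y)) N).
  by apply: iaddS.
have [ms [msN {}es]] := fg_add es.
have fy : fil 1 (iota y).
  by apply/fil_iota; rewrite ej ejs; apply: mem_gen; rewrite mem_cat mem_rcons mem_head.
exists ms; apply: ideal_ext => // x Nx.
(* Since y is outside N, the cofactor of y is again in N. Iterating writes x as the series of the
   y^k m_k with m_k in [gen ms]; the pair (0, 0) is a default outside N. *)
have step u : exists v : C * C, N u -> [/\ N v.1, gen ms v.2 & u = iota y * v.1 + v.2].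
  have [Nu|nu] := pselect (N u); last by exists (0, 0) => /nu.
  have : gen (iota y :: ms) u by rewrite -es; apply: iaddr.
  move=> /iaddP[_ [m [/princP[r ->] hm eu]]]; exists (r, m) => _ /=.
  split=> //; last by rewrite mulrC.
  have : N (r * iota y) by apply: (@idealDr _ _ _ m); [apply: msN|rewrite -eu].
  by move=> /spec_prime[].
have [st hst] := choice step.
pose X n := iter n (fun u => (st u).1) x.
have NX n : N (X n) by elim: n => //= n /hst[].
have hm k : gen ms (st (X k)).2 by have [] := hst _ (NX k).
have [w hw fw] := series_ideal fy hm.
suff -> : x = w by [].
apply/eqP; rewrite eq_sym -subr_eq0; apply/eqP/fil_sep => n.
have -> : x = \sum_(k < n) iota y ^+ k * (st (X k)).2 + iota y ^+ n * X n.
  elim: n => [|n IHn]; first by rewrite big_ord0 add0r expr0 mul1r.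
  rewrite IHn big_ord_recr /= -addrA; congr (_ + _).
  by have [_ _ {1}->] := hst _ (NX n); rewrite mulrDr addrC exprSr mulrA.
rewrite opprD addrA; apply: idealB; first exact: fw.
apply: idealMr; rewrite -[X in fil X](mul1n n).
elim: n => [|n IHn]; first exact: fil0.
by rewrite exprS mulnS; apply: fil_mul.
Qed.

End Completion.

Section IdealMap.
Variables (A B : comPzRingType) (h : {rmorphism A -> B}).
Implicit Types (I J : ideal A) (xs : seq A).

Lemma imul_map I J (I' J' : ideal B) z : (forall x, I x -> I' (h x)) ->
  (forall x, J x -> J' (h x)) -> ideal_mul I J z -> ideal_mul I' J' (h z).
Proof.
move=> hI hJ hz; apply/ipreE; move: z hz; apply: imul_sub => x y /hI ? /hJ ?.
by apply/ipreE; rewrite rmorphM; apply: imulM.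
Qed.

Lemma iexp_map I (I' : ideal B) n z : (forall x, I x -> I' (h x)) ->
  ideal_exp I n z -> ideal_exp I' n (h z).
Proof.
move=> hI; elim: n z => [|n IHn] z; first by move=> _; apply: iexp0.
by rewrite !iexpS; apply: imul_map.
Qed.

Lemma cl_map (n : spec B) xs g : cl (spre h n) (gen xs) g -> cl n (gen (map h xs)) (h g).
Proof.
move=> [s ns [k hk]]; exists (h s); first by move=> hs; apply: ns; apply/spreE.
exists k; rewrite -rmorphXn -rmorphM; move: hk; apply: imul_map.
  by move=> x; apply: gen_map.
move=> z; apply: iexp_map => {}z /iaddP[u [_ [hu /princP[a ->] ->]]].
rewrite rmorphD rmorphM; apply: idealD; first by apply/iaddl/gen_map.
by apply/idealM/iaddr/princ_id.
Qed.

End IdealMap.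

Section IdealPowers.
Variable A : comPzRingType.
Implicit Types (I J : ideal A).

Lemma iexp_addE I m n : ideal_exp I (m + n) `<=` ideal_mul (ideal_exp I m) (ideal_exp I n).
Proof.
elim: m => [|m IHm].
  by move=> z hz; rewrite -[z]mul1r; apply: imulM => //; apply: iexp0.
rewrite addSn iexpS; apply: imul_sub => x y Ix /IHm hy.
have c0 : ideal_mul (ideal_exp I m.+1) (ideal_exp I n) (x * 0) by rewrite mulr0; apply: ideal0.
have cD u v : ideal_mul (ideal_exp I m.+1) (ideal_exp I n) (x * u) ->
  ideal_mul (ideal_exp I m.+1) (ideal_exp I n) (x * v) ->
  ideal_mul (ideal_exp I m.+1) (ideal_exp I n) (x * (u + v)) by rewrite mulrDr; apply: idealD.
have cM u v : ideal_mul (ideal_exp I m.+1) (ideal_exp I n) (x * v) ->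
  ideal_mul (ideal_exp I m.+1) (ideal_exp I n) (x * (u * v)) by rewrite mulrCA; apply: idealM.
apply: (@imul_sub _ _ _ (Ideal c0 cD cM)) hy => u v hu hv.
change (ideal_mul (ideal_exp I m.+1) (ideal_exp I n) (x * (u * v))).
by rewrite mulrA; apply: imulM => //; rewrite iexpS; apply: imulM.
Qed.

Lemma iexp_mulE I m n : ideal_exp I (m * n) `<=` ideal_exp (ideal_exp I m) n.
Proof.
elim: n => [|n IHn]; first by move=> z _; apply: iexp0.
by rewrite mulnS => z /iexp_addE; rewrite iexpS; apply: imulS.
Qed.

End IdealPowers.

(** * The colon property of the completion *)

Section CompletionColon.
Variables (R A : comPzRingType) (f : {rmorphism R -> A}) (p : ideal R).
Local Notation C := (compl f p).
Local Notation J := (adic f p).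
Local Notation iota := (compl_map f p : {rmorphism A -> C}).
Hypothesis noeA : noetherian A.

(** For u in [fil 1] the geometric series inverts 1 - u, so [fil 1] lies in the Jacobson radical. *)
Lemma maximal_fil (n : spec C) : maximal_ideal n -> fil f p 1 `<=` n.
Proof.
move=> maxn x fx; apply: contrapT => nx.
have [/iaddP[_ [v [/princP[r ->] nv e]]]|h] := pselect (iadd (princ x) n 1); last first.
  have [q hq] := prime_over_ideal h.
  apply: nx; rewrite -(maxn q); last by move=> y ny; apply/hq/iaddr.
  by apply/hq/iaddl/princ_id.
pose u := r * x; have fu : fil f p 1 u by apply: idealM.
have fX k : fil f p k (u ^+ k).
  by elim: k => [|k IHk]; [exact: fil0|rewrite exprS -add1n; apply: fil_mul].
have [z hz] := series fX.
have z1 : z * (1 - u) = 1.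
  apply/eqP; rewrite -subr_eq0; apply/eqP/fil_sep => k.
  have -> : z * (1 - u) - 1 = (z - \sum_(i < k) u ^+ i) * (1 - u) - u ^+ k.
    suff e' : (\sum_(i < k) u ^+ i) * (1 - u) = 1 - u ^+ k by rewrite mulrBl e'; ring.
    elim: k => [|k IHk]; first by rewrite big_ord0 expr0 mul0r subrr.
    by rewrite big_ord_recr /= mulrDl IHk exprS; ring.
  by apply: idealB => //; apply: idealMr.
apply: (@spec_proper _ n); rewrite -z1; apply: idealM.
by rewrite e /u addrAC subrr add0r.
Qed.

Lemma fil_sub_ideal (n : spec C) l : J 1 `<=` spre iota n -> fil f p l `<=` ideal_exp n l.
Proof.
move=> h; have [js ej] := noeth_gen noeA (J l).
rewrite (fil_gen ej); apply: gen_sub => _ /mapP[a aa ->].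
have : J l a by rewrite ej; apply: mem_gen.
have sub : J l `<=` ideal_exp (spre iota n) l.
  elim: l {js ej a aa} => [|l IHl]; first by move=> z _; apply: iexp0.
  rewrite -add1n => z /adic_split; rewrite add1n iexpS; exact: imulS.
move=> /sub; apply: iexp_map => x; exact: (spreE _ _ _).1.
Qed.

(* Ideals of A containing the l-th power of the ideal of completion are
   contracted from the completion. *)
Lemma approx_ideal (I : ideal A) l as' : J l `<=` I -> (forall a, a \in as' -> I a) ->
  forall c a, gen (map iota as') c -> ap c l a -> I a.
Proof.
move=> JI hI c a hc; elim: as' hI c hc a => [|b bs IH] hI c.
  by move=> /gen_nil -> a ha; apply: JI; rewrite -[a]subr0; apply: (ap_eq ha); apply: ap0.
move=> /iaddP[_ [d [/princP[r ->] hd ->]]] a ha.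
have [s hs] := ap_ex r l; have [t ht] := ap_ex d l.
have It : I t by apply: IH ht => // y yy; apply: hI; rewrite inE yy orbT.
have : J l (a - (s * b + t)).
  by apply: (ap_eq ha); apply: apD => //; apply: apM.
move=> /JI h; rewrite -[a](subrK (s * b + t)); apply: idealD => //.
by apply: idealD => //; apply/idealM/hI/mem_head.
Qed.

Variable n : spec C.
Hypothesis maxn : maximal_ideal n.
Let m := spre iota n.

Lemma Jm : J 1 `<=` m.
Proof. by move=> a ha; apply/spreE; apply: (maximal_fil maxn); apply/fil_iota. Qed.

Lemma fil_n l : (0 < l)%N -> fil f p l `<=` n.
Proof. by move=> l0 x hx; apply: (maximal_fil maxn); apply: fil_sub hx. Qed.

(** Elements of A represent C modulo [fil 1], and [fil 1] is itself generated by the image of [J 1],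
    which lies in m. *)
Lemma n_gen ms : spec_ideal m = gen ms -> spec_ideal n = gen (map iota ms).
Proof.
move=> em; apply: ideal_ext; last first.
  by apply: gen_sub => _ /mapP[a aa ->]; apply/spreE; change (m a); rewrite em; apply: mem_gen.
have [js ej] := noeth_gen noeA (J 1).
have J1 : fil f p 1 `<=` gen (map iota ms).
  rewrite (fil_gen ej); apply: gen_sub => _ /mapP[a aa ->]; apply: gen_map; rewrite -em.
  by apply: Jm; rewrite ej; apply: mem_gen.
move=> x nx; have [a ha] := ap_ex x 1.
have fx : fil f p 1 (x - iota a) by apply/fil_ap.
rewrite -[x](subrK (iota a)); apply: idealD; first exact: J1.
apply: gen_map; rewrite -em; apply/spreE.
by have := idealB nx (fil_n (ltn0Sn 0) fx); rewrite subKr.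
Qed.

Lemma n_minover ys : minover m (gen ys) -> minover n (gen (map iota ys)).
Proof.
move=> minm; apply: minoverI.
  by apply: gen_sub => _ /mapP[a aa ->]; apply/spreE; apply/minm.1/mem_gen.
move=> q' hq' q'n; have [ms em] := noeth_gen noeA m.
rewrite (n_gen em); apply: gen_sub => _ /mapP[a aa ->].
have ma : m a by rewrite em; apply: mem_gen.
rewrite -(minm.2 (spre iota q')) in ma; first exact/spreE.
  by apply: gen_sub => y yy; apply/spreE/hq'/mem_gen/map_f.
by move=> y /spreE/q'n/spreE.
Qed.

Lemma n_exp_gen l bs : ideal_exp m l = gen bs -> ideal_exp n l `<=` gen (map iota bs).
Proof.
elim: l bs => [|l IHl] bs eb x hx.
  have : gen bs 1 by rewrite -eb; apply: iexp0.
  by move=> /(gen_map iota); rewrite rmorph1 => h; rewrite -[x]mulr1; apply: idealM.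
have [ms em] := noeth_gen noeA m; have [cs ec] := noeth_gen noeA (ideal_exp m l).
have key u v : gen (map iota ms) u -> gen (map iota cs) v -> gen (map iota bs) (u * v).
  move=> hu hv; move: u hu.
  have c0 : gen (map iota bs) (0 * v) by rewrite mul0r; apply: ideal0.
  have cD u w : gen (map iota bs) (u * v) -> gen (map iota bs) (w * v) ->
    gen (map iota bs) ((u + w) * v) by rewrite mulrDl; apply: idealD.
  have cM u w : gen (map iota bs) (w * v) -> gen (map iota bs) (u * w * v).
    by rewrite -mulrA; apply: idealM.
  apply: (@gen_sub _ _ (Ideal c0 cD cM)) => _ /mapP[a aa ->].
  change (gen (map iota bs) (iota a * v)); move: v hv {c0 cD cM}.
  have c0 : gen (map iota bs) (iota a * 0) by rewrite mulr0; apply: ideal0.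
  have cD u w : gen (map iota bs) (iota a * u) -> gen (map iota bs) (iota a * w) ->
    gen (map iota bs) (iota a * (u + w)) by rewrite mulrDr; apply: idealD.
  have cM u w : gen (map iota bs) (iota a * w) -> gen (map iota bs) (iota a * (u * w)).
    by rewrite mulrCA; apply: idealM.
  move=> v; apply: (@gen_sub _ _ (Ideal c0 cD cM)) => _ /mapP[c cc ->].
  change (gen (map iota bs) (iota a * iota c)).
  rewrite -rmorphM; apply: gen_map; rewrite -eb iexpS; apply: imulM.
    by rewrite em; apply: mem_gen.
  by rewrite ec; apply: mem_gen.
move: x hx; rewrite iexpS; apply: imul_sub => u v nu hv; apply: key.
  by rewrite -(n_gen em).
exact: IHl.
Qed.

Lemma approx_mem xs l a : iadd (gen (map iota xs)) (ideal_exp n l) (iota a) ->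
  iadd (gen xs) (ideal_exp m l) a.
Proof.
move=> h; have [bs eb] := noeth_gen noeA (ideal_exp m l).
apply: (@approx_ideal _ l (xs ++ bs) _ _ (iota a)) => //.
- move=> z Jz; apply: iaddr.
  elim: l {h bs eb} z Jz => [|l IHl] z; first by move=> _; apply: iexp0.
  rewrite -add1n => /adic_split; rewrite add1n iexpS; apply: imulS => //; exact: Jm.
- move=> z; rewrite mem_cat => /orP[]/mem_gen hz; first exact: iaddl.
  by apply: iaddr; rewrite eb.
- rewrite map_cat; apply: iadd_sub h; first exact: gen_catl.
  by move=> x /(n_exp_gen eb); apply: gen_catr.
Qed.

(** Modulo n^N all elements are replaced by approximations x', xs', g' from A. The relation then
    holds up to an error in m^M; a multiple of x s' kind is avoided by subtracting c x'^N from a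
    multiple of g', a change that is invisible modulo n^N. *)
Theorem completion_colon_captured : colon_captured m -> colon_captured n.
Proof.
move=> Dm xs x g P0 hP0 minn gx.
have noeC : noetherian C by apply: completion_noetherian.
apply: cl_adic => // N.
have [t [L [nt ht]]] := rad_pow noeC minn.
(* The denominator t is a unit modulo the maximal ideal n, so it can be removed modulo every power
   of n. *)
have nL M z : ideal_exp n L z -> iadd (gen (x :: xs)) (ideal_exp n M) z.
  have nu : exists2 u, n u & exists r, 1 = r * t + u.
    have [/iaddP[_ [u [/princP[r ->] nu e]]]|h] := pselect (iadd (princ t) n 1).
      by exists u => //; exists r.
    have [q hq] := prime_over_ideal h; case: nt.
    rewrite -(maxn (q := q)); first by apply/hq/iaddl/princ_id.
    by move=> y ny; apply/hq/iaddr.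
  have [u nu' [r e]] := nu => hz.
  suff h k : iadd (gen (x :: xs)) (ideal_exp n (L + k)) z.
    apply: iaddS (h M) => //; apply: ideal_exp_sub; exact: leq_addl.
  elim: k => [|k IHk]; first by rewrite addn0; apply: iaddr.
  have /iaddP[v [w [hv hw ->]]] := IHk.
  apply: idealD; first exact: iaddl.
  rewrite -[w]mul1r e mulrDl; apply: idealD.
    apply/iaddl; rewrite -mulrA; apply/idealM/ht.
    by apply: (ideal_exp_sub (leq_addr k L)).
  by apply: iaddr; rewrite addnS iexpS; apply: imulM.
(* M is at least L + 1 for Nakayama's lemma in [hs], at least L (N + 2) so that s^(N+2) m^M lies in
   (x'^(N+1)) + (xs') in [mM], and at least N so that approximation errors vanish modulo n^N. *)
pose M := (L * N.+2 + L.+1 + N)%N.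
have [apx hapx] := choice (fun y : C => ap_ex y M).
have apxn y : ideal_exp n M (y - iota (apx y)).
  apply: fil_sub_ideal => //; first exact: Jm.
  exact/fil_ap.
have nM : ideal_exp n M `<=` n by apply: iexp_sub; rewrite /M; lia.
pose x' := apx x; pose xs' := map apx xs; pose g' := apx g.
have sub_apx zs : gen zs `<=` iadd (gen (map iota (map apx zs))) (ideal_exp n M).
  apply: gen_sub => z zz; rewrite -[z](subrK (iota (apx z))) addrC.
  apply: idealD; last by apply: iaddr.
  by apply/iaddl/mem_gen/map_f/map_f.
have sub_apx' zs : gen (map iota (map apx zs)) `<=` iadd (gen zs) (ideal_exp n M).
  apply: gen_sub => _ /mapP[_ /mapP[z zz ->] ->]; rewrite -[iota _](subKr z).
  by apply: idealB; [apply/iaddl/mem_gen|apply: iaddr].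
have [s ms hs] : exists2 s, ~ m s & forall a, ideal_exp m L a -> gen (x' :: xs') (s * a).
  apply: (@nakayama _ noeA m _ m) => // a ha; exists 1; first exact: spec_proper.
  rewrite mul1r.
  have na : ideal_exp n L (iota a) by apply: iexp_map ha => b /spreE.
  have : iadd (gen (x' :: xs')) (ideal_exp m M) a.
    apply: approx_mem; have := nL M _ na.
    by apply: iadd_sub; [exact: (sub_apx (x :: xs))|apply: iaddr].
  apply: iaddS => //; rewrite -iexpS; apply: ideal_exp_sub.
  by rewrite /M; lia.
have inm z : n z -> m (apx z).
  move=> nz; apply/spreE; rewrite -[iota _](subKr z); apply: idealB => //.
  exact/nM/apxn.
have minm : minover m (gen (x' :: xs')).
  apply: minoverI.
    apply: gen_sub => y; rewrite inE => /orP[/eqP ->|/mapP[z zz ->]]; apply: inm; apply: (minn.1).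
      exact/mem_gen/mem_head.
    by apply/mem_gen; rewrite inE zz orbT.
  move=> q hq qm a ma; have := hs _ (iexpX L ma) => /hq /spec_prime[/qm//|]; exact: prime_exp.
have sxs : size xs' = size xs by rewrite size_map.
(* The height d of m is at least the length of the chain below n: d parameters at m also cut out n,
   and Krull's height theorem applies in C. *)
have [P1 hP1] : exists P, chn P (size xs').+1 m.
  have [d hd [P1 hP1]] := exact_height noeA m.
  have dle : (d <= (size xs').+1)%N.
    apply: (krull_height (xs := x' :: xs') noeA _ hP1); apply: (minoverS minm (@iaddl _ _ _)).
    by apply: iadd_sub (chn_sub hP1); apply: (minm.1).
  suff : ((size xs').+1 <= d)%N.
    by move=> h; exists P1; rewrite (_ : _.+1 = d) //; apply/eqP; rewrite eqn_leq dle h.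
  have [||||ys [sys ysm d3 _]] := @param_extend _ noeA d m m m (princ 0) [::] 0.
  - by rewrite add0n.
  - exact: hd.
  - move=> q k _ pq hk; have e : m = q by apply: spec_ext => //; apply: chn_sub hk.
    by rewrite -e in hk; rewrite (chn_refl hk).
  - move=> q k _ pq hk; have e : m = q by apply: spec_ext => //; apply: chn_sub hk.
    by rewrite -e in hk; rewrite (chn_refl hk).
  rewrite cats0 in d3.
  have minys : minover m (gen ys) by apply: dimle_minover d3; apply: gen_sub.
  rewrite sxs -sys -(size_map iota ys).
  apply: (krull_height noeC _ hP0); apply: (minoverS (n_minover minys) (@iaddl _ _ _)).
  by apply: iadd_sub (chn_sub hP0); apply: ((n_minover minys).1).
have rel : iadd (gen xs') (ideal_exp m M) (g' * x').
  apply: approx_mem; rewrite rmorphM.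
  have e : iota g' * iota x' = g * x - (g * (x - iota x') + iota x' * (g - iota g')) by ring.
  rewrite e; apply: idealB; last by apply/iaddr/idealD; apply: idealM.
  by have := sub_apx xs _ gx; apply: iadd_sub; [apply: iaddl|apply: iaddr].
have mM z : ideal_exp m M z -> iadd (princ (x' ^+ N.+1)) (gen xs') (s ^+ N.+2 * z).
  move=> hz.
  have h1 : ideal_exp (gen (x' :: xs')) N.+2 (s ^+ N.+2 * z).
    apply: (exp_scale (I := ideal_exp m L)); first exact: hs.
    by apply: iexp_mulE; apply: ideal_exp_sub hz; rewrite /M; lia.
  have : iadd (ideal_exp (princ x') N.+1) (ideal_exp (gen xs') 1) (s ^+ N.+2 * z).
    by apply: iexp_iadd; rewrite addn1.
  by apply: iaddS; [apply: princX|apply: iexp1E].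
have [c hc] : exists c, gen xs' ((s ^+ N.+2 * g' - c * x' ^+ N) * x').
  have /iaddP[u [v [hu hv e]]] := rel.
  have /iaddP[_ [w [/princP[c ->] hw e']]] := mM v hv.
  exists c; rewrite (_ : _ * x' = s ^+ N.+2 * u + w).
    by apply: idealD => //; apply: idealM.
  transitivity (s ^+ N.+2 * (g' * x') - c * x' ^+ N.+1); first by rewrite (exprS x'); ring.
  by rewrite e mulrDr e'; ring.
have := Dm _ _ _ _ hP1 minm hc.
move=> /cl_map; rewrite -/xs' => hcl.
have {}hcl : cl n (iadd (gen xs) (ideal_exp n N)) (iota (s ^+ N.+2 * g' - c * x' ^+ N)).
  apply: clS hcl => z /sub_apx'; apply: iaddS => //; apply: ideal_exp_sub.
  by rewrite /M; lia.
have nx' : n (iota x').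
  by apply/spreE/inm/(minn.1)/mem_gen/mem_head.
have h1 : iadd (gen xs) (ideal_exp n N) (iota (c * x' ^+ N)).
  by rewrite rmorphM rmorphXn; apply/idealM/iaddr/iexpX.
have h2 : iadd (gen xs) (ideal_exp n N) (iota (s ^+ N.+2) * (g - iota g')).
  by apply/idealM/iaddr; apply: ideal_exp_sub (apxn g); rewrite /M; lia.
have := cl_shift h2 (cl_shift h1 hcl).
rewrite (_ : _ + _ = iota (s ^+ N.+2) * g); last by rewrite rmorphB !rmorphM; ring.
apply: cl_denom; rewrite rmorphXn => /prime_exp h.
exact/ms/spreE.
Qed.

End CompletionColon.

(** * Localization *)

Section Fractions.
Variables (R A : comPzRingType) (f : {rmorphism R -> A}) (p : spec R).
Local Notation L := (loc f p).
Local Notation lam := (loc_map f p : {rmorphism A -> L}).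

Lemma loc_unit s : ~ p s -> exists t, lam (f s) * t = 1.
Proof.
move=> ps; have hs : `[< ~ p s >] by apply/asboolP.
exists (\pi_L (1, Sub s hs)).
transitivity (loc_mul (\pi_L (f s, denom1 p)) (\pi_L (1, Sub s hs))) => //.
by rewrite loc_mulE; apply: loc_eq; rewrite /= !rmorphM rmorph1 /=; ring.
Qed.

Lemma loc_rep (z : L) : exists a s, ~ p s /\ z * lam (f s) = lam a.
Proof.
elim/locI: z => -[b s]; exists b, (val s); split; first exact: denomP.
transitivity (loc_mul (\pi_L (b, s)) (\pi_L (f (val s), denom1 p))) => //.
by rewrite loc_mulE; apply: loc_eq; rewrite /= !rmorphM rmorph1 /=; ring.
Qed.

Lemma loc_map0 a : lam a = 0 -> exists2 u, ~ p u & f u * a = 0.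
Proof.
move=> /locP[u h]; exists (val u); first exact: denomP.
by move: h; rewrite /= rmorph1 mul1r mulr0 subr0.
Qed.

Lemma loc_notin (q : spec L) s : ~ p s -> ~ q (lam (f s)).
Proof.
move=> /loc_unit[t e] h; apply: (@spec_proper _ q); rewrite -e; exact: idealMr.
Qed.

Definition lext (I : ideal A) : ideal L.
Proof.
exists [set z | exists a s, [/\ ~ p s, z * lam (f s) = lam a & I a]].
- exists 0, 1; split; [exact: spec_proper|by rewrite mul0r rmorph0|exact: ideal0].
- move=> x y [a [s [ps ex Ia]]] [b [t [pt ey Ib]]].
  exists (f t * a + f s * b), (s * t); split; first exact: notin_primeM.
    by rewrite mulrDl !rmorphD !rmorphM -ex -ey; ring.
  by apply: idealD; apply: idealM.
- move=> x y [a [s [ps ey Ia]]]; have [b [t [pt ex]]] := loc_rep x.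
  exists (b * a), (t * s); split; first exact: notin_primeM.
    by rewrite !rmorphM -ex -ey; ring.
  exact: idealM.
Defined.

Lemma lext_sub (I : ideal A) (K : ideal L) : (forall a, I a -> K (lam a)) -> lext I `<=` K.
Proof.
move=> h z [a [s [ps e Ia]]]; have [t st] := loc_unit ps.
by rewrite -[z]mulr1 -st mulrA e; apply/idealMr/h.
Qed.

Lemma lext_lam (I : ideal A) a : lext I (lam a) <-> exists2 u, ~ p u & I (f u * a).
Proof.
split=> [[b [s [ps e Ib]]]|[u pu Iu]]; last first.
  by exists (f u * a), u; split=> //; rewrite rmorphM mulrC.
have [|u pu hu] := @loc_map0 (a * f s - b); first by rewrite rmorphB rmorphM e subrr.
exists (u * s); first exact: notin_primeM.
have -> : f (u * s) * a = f u * (a * f s - b) + f u * b by rewrite rmorphM; ring.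
by rewrite hu add0r; apply: idealM.
Qed.

Lemma loc_prime (q0 : spec A) : (forall s, ~ p s -> ~ q0 (f s)) ->
  exists q : spec L, forall a, q (lam a) <-> q0 a.
Proof.
move=> h; have key a : lext q0 (lam a) <-> q0 a.
  rewrite lext_lam; split=> [[u pu /spec_prime[/(h u pu)//|//]]|qa].
  by exists 1; [exact: spec_proper|rewrite rmorph1 mul1r].
unshelve eexists (@Spec _ (lext q0) _ _) => //.
  by rewrite -(rmorph1 lam) => /key; apply: spec_proper.
move=> x y; have [a [s [ps ex]]] := loc_rep x; have [b [t [pt ey]]] := loc_rep y => hxy.
have : lext q0 (lam (a * b)).
  by rewrite rmorphM -ex -ey mulrACA; apply: idealMr.
move=> /key/spec_prime[qa|qb]; [left; exists a, s|right; exists b, t]; split=> //.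
Qed.

Lemma loc_spec_sub (q q' : spec L) : spre lam q `<=` spre lam q' -> q `<=` q'.
Proof.
move=> h z qz; have [a [s [ps e]]] := loc_rep z.
have : spre lam q a by apply/spreE; rewrite -e; apply: idealMr.
move=> /h/spreE; rewrite -e => /spec_prime[//|]; by move/(loc_notin ps).
Qed.

Lemma loc_spec_inj (q q' : spec L) : spre lam q = spre lam q' -> q = q'.
Proof. by move=> e; apply: spec_ext; apply: loc_spec_sub; rewrite e. Qed.

Lemma loc_lift (q0 : spec A) (q' : spec L) : q0 `<=` spre lam q' ->
  exists2 q : spec L, spre lam q = q0 & q `<=` q'.
Proof.
move=> h; have [s ps /h/spreE/(loc_notin ps)//|q hq] := @loc_prime q0.
have e : spre lam q = q0 by apply: spec_ext => a; [move/spreE/hq|move/hq/spreE].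
by exists q => //; apply: loc_spec_sub; rewrite e.
Qed.

Lemma loc_chn (q q' : spec L) k : chn q k q' -> chn (spre lam q) k (spre lam q').
Proof.
elim=> {q k q'} [q|q r q' k qr nqr _ IH]; first exact: chn0.
apply: chnS IH; first by move=> a /spreE/qr/spreE.
by move/loc_spec_inj.
Qed.

Lemma loc_chn_lift (q0 : spec A) (q' : spec L) k : chn q0 k (spre lam q') ->
  exists2 q : spec L, spre lam q = q0 & chn q k q'.
Proof.
move e : (spre lam q') => q1 h; elim: h e => {q0 k q1} [q0|q0 r q1 k qr nqr _ IH] e.
  by exists q' => //; apply: chn0.
have [r1 er hr] := IH e; rewrite -er in qr nqr.
have [q eq qr1] := loc_lift qr; exists q => //.
by apply: (chnS qr1 _ hr) => e'; apply: nqr; rewrite -eq e'.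
Qed.

Hypothesis noeA : noetherian A.

Lemma loc_noetherian : noetherian L.
Proof.
apply: noeth_of_gen => I; have [s es] := noeth_gen noeA (ipre lam I).
exists (map lam s); apply: ideal_ext; last first.
  by apply: gen_sub => _ /mapP[a aa ->]; apply/ipreE; rewrite es; apply: mem_gen.
move=> z Iz; have [a [t [pt e]]] := loc_rep z.
have ha : gen s a by rewrite -es; apply/ipreE; rewrite -e; apply: idealMr.
by apply: (@lext_sub (gen s)); [apply: gen_map|exists a, t].
Qed.

(** Up to units every element of L is the image of a numerator, so the relation descends to A at the
    cost of a factor f u that is a unit in L. *)
Theorem loc_colon_captured (q : spec L) : colon_captured (spre lam q) -> colon_captured q.
Proof.
move=> D xs x g P0 hP0 minq gx.
have [num hnum] := choice loc_rep.
pose x' := num x; pose xs' := map num xs; pose g' := num g.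
have unitE z : exists2 t, z = lam (num z) * t & exists2 s, ~ p s & z * lam (f s) = lam (num z).
  have [s [ps e]] := hnum z; have [t st] := loc_unit ps; exists t; last by exists s.
  by rewrite -e -mulrA st mulr1.
have genE zs : gen zs `<=` gen (map lam (map num zs)).
  apply: gen_sub => z zz; have [t e _] := unitE z.
  by rewrite [X in gen _ X]e; apply: idealMr; apply/mem_gen/map_f/map_f.
have genE' zs : gen (map lam (map num zs)) `<=` gen zs.
  apply: gen_sub => _ /mapP[_ /mapP[z zz ->] ->]; have [_ _ [s _ <-]] := unitE z.
  exact/idealMr/mem_gen.
have minq0 : minover (spre lam q) (gen (x' :: xs')).
  apply: minoverI.
    move=> a ha; apply/spreE; apply: (minq.1); apply: (genE' (x :: xs)).
    exact: (gen_map lam (xs := x' :: xs')).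
  move=> r0 hr r0q; have [r er rq] := loc_lift r0q.
  rewrite -er (minq.2 r) // => z /(genE (x :: xs)); move: z; apply: gen_sub.
  move=> _ /mapP[a aa ->]; apply/spreE; change (spre lam r a); rewrite er; exact/hr/mem_gen.
have [u pu hu] : exists2 u, ~ p u & gen xs' (f u * (g' * x')).
  apply/lext_lam; rewrite rmorphM.
  have [_ _ [s ps es]] := unitE g; have [_ _ [t pt et]] := unitE x.
  rewrite -/x' -/g' in es et; rewrite -es -et mulrACA; apply: idealMr.
  move: (g * x) gx => z /genE; move: z; apply: gen_sub => _ /mapP[a aa ->].
  by apply/lext_lam; exists 1; [exact: spec_proper|rewrite rmorph1 mul1r; apply: mem_gen].
have hc : chn (spre lam P0) (size xs').+1 (spre lam q) by rewrite size_map; apply: loc_chn.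
have fu : ~ spre lam q (f u) by move=> /spreE; apply: loc_notin.
have := D xs' x' (f u * g') _ hc minq0.
rewrite -mulrA => /(_ hu)/(cl_denom fu)/cl_map h.
have [_ _ [s ps es]] := unitE g.
apply: (@cl_denom _ q _ g (lam (f s))); first exact: loc_notin.
by rewrite mulrC es; apply: clS h; apply: genE'.
Qed.

End Fractions.

(** * Equidimensionality *)

Section KrullDim.
Variable A : comPzRingType.
Implicit Types (p q : spec A) (D : seq (spec A)).

Lemma path_chn p D : path (fun p q : spec A => `[< p `<` q >]) p D -> chn p (size D) (last p D).
Proof.
elim: D p => [|q D IH] p /=; first by move=> _; apply: chn0.
move=> /andP[/asboolP[pq nqp] /IH h]; apply: chnS h => // e.
by apply: nqp; rewrite e.
Qed.

Lemma chn_path p k q : chn p k q ->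
  exists D, path (fun p q : spec A => `[< p `<` q >]) p D /\ size D = k.
Proof.
elim=> {p k q} [p|p q r k pq npq _ [D [hD sD]]]; first by exists [::].
exists (q :: D); rewrite /= sD; split=> //; rewrite hD andbT; apply/asboolP.
by split=> // qp; apply: npq; apply: spec_ext.
Qed.

Lemma flag_chn k : (exists D, flag D /\ size D = k.+1) <-> exists p q, chn p k q.
Proof.
split=> [[[|p D] [[//= _ hD] [sD]]]|[p [q /chn_path[D [hD sD]]]]].
  by exists p, (last p D); rewrite -sD; apply: path_chn.
by exists (p :: D); rewrite /= sD.
Qed.

Definition chain_lengths : set nat := [set k | exists p q, chn p k q].

Lemma krull_dimE : krull_dim A = supremum -oo%E [set (n%:Z)%:E | n in chain_lengths].
Proof.
rewrite /krull_dim; congr (supremum _ [set _ | n in _]).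
by apply/seteqP; split=> n /flag_chn.
Qed.

Lemma krull_dim_max n : chain_lengths n -> (forall k, chain_lengths k -> (k <= n)%N) ->
  krull_dim A = (n%:Z)%:E.
Proof.
move=> hn maxn; rewrite krull_dimE /supremum.
set S := [set _ | _ in _]; have Sn : S (n%:Z)%:E by exists n.
have sup : supremums S (n%:Z)%:E.
  split=> [_ [k hk <-]|y hy]; last exact: hy.
  by rewrite lee_fin lez_nat; apply: maxn.
case: ifPn => [/eqP S0|_]; first by move: Sn; rewrite S0.
by case: xgetP => [y _ hy|/(_ _ sup)//]; apply: (is_subset1_supremums hy sup).
Qed.

Lemma chn_shorten p l q k : (k <= l)%N -> chn p l q -> exists2 r : spec A, p `<=` r & chn r k q.
Proof.
move=> kl; rewrite -(subnK kl) => h; have [r /chn_sub pr hr] := chn_split h.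
by exists r.
Qed.

End KrullDim.

(** * Equidimensionality of local rings in terms of chains *)

Section LocalRing.
Variables (A : comPzRingType) (Q : spec A).
Hypothesis noeA : noetherian A.
Local Notation L := (local_ring Q).
Local Notation lam := (loc_map (idfun : {rmorphism A -> A}) Q : {rmorphism A -> L}).

Lemma local_max : exists2 M : spec L, spre lam M = Q & forall q : spec L, q `<=` M.
Proof.
have [//|M hM] := @loc_prime A A idfun Q Q.
have e : spre lam M = Q by apply: spec_ext => a; [move/spreE/hM|move/hM/spreE].
exists M => // q; apply: loc_spec_sub => a /spreE qa; apply/spreE/hM.
by apply: contrapT => Qa; apply: (@loc_notin A A idfun Q q a Qa).
Qed.

(** A chain of primes of L can be prolonged up to the maximal ideal and then shortened at its lower
    end, so chains ending at Q give all lengths. *)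
Lemma chain_lengths_local k : chain_lengths L k <-> exists P, chn P k Q.
Proof.
have [M eM hM] := local_max; split=> [[q [q' h]]|[P]].
  have [l hl h'] := chn_extend h (hM q') (chn0 M).
  have [|r _ hr] := @chn_shorten L _ l _ k _ h'; first exact: leq_trans (leq_addr 0 k) hl.
  by exists (spre lam r); have := @loc_chn A A idfun Q _ _ _ hr; rewrite eM.
move=> h; have [|q _ h'] := @loc_chn_lift A A idfun Q P M k; first by rewrite eM.
by exists q, M.
Qed.

Lemma chain_lengths_quot (P : spec L) k :
  chain_lengths (quot P) k <-> exists2 r : spec A, spre lam P `<=` r & chn r k Q.
Proof.
have [M eM hM] := local_max.
pose q := @quot_map L P : {rmorphism L -> quot P}.
have qs y : exists x, q x = y := quot_map_surj y.
split=> [[p1 [p2 /(chn_spre qs) h]]|[r Pr]].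
  have [l hl h'] := chn_extend h (hM _) (chn0 M).
  have [|r hr1 hr] := @chn_shorten L _ l _ k _ h'; first exact: leq_trans (leq_addr 0 k) hl.
  exists (spre lam r); last by have := @loc_chn A A idfun Q _ _ _ hr; rewrite eM.
  move=> a /spreE Pa; apply/spreE/hr1/spreE.
  by rewrite (_ : q (lam a) = 0); [apply: ideal0|apply/quot_map0].
move=> hr; have [|r1 er h] := @loc_chn_lift A A idfun Q r M k; first by rewrite eM.
have Pr1 : P `<=` r1 by apply: loc_spec_sub; rewrite er.
have ker z : q z = 0 -> r1 z by move=> /quot_map0/Pr1.
have [P' hP'] := simg qs ker.
have [P'' h' _] := chn_surj qs hP' h.
by exists P', P''.
Qed.

Lemma local_minimal (P : spec L) : minimal_prime P -> forall q : spec A, q `<=` spre lam P -> q = spre lam P.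
Proof.
move=> minP q /loc_lift[q1 e q1P]; rewrite -e; congr (spre _ _).
by apply: spec_ext => //; apply: minP.
Qed.

(** The two Krull dimensions are suprema of the same set of chain lengths, so no maximum has to be
    found. *)
Lemma equidimensional_local :
  (forall (P : spec A) k P', (forall q : spec A, q `<=` P -> q = P) -> P `<=` Q -> chn P' k Q ->
     exists2 r : spec A, P `<=` r & chn r k Q) -> equidimensional L.
Proof.
move=> h; split; first exact: loc_noetherian.
move=> P minP; rewrite !krull_dimE; congr (supremum _ [set _ | n in _]).
apply/seteqP; split=> k; last first.
  by move=> /chain_lengths_quot[r _ hr]; apply/chain_lengths_local; exists r.
move=> /chain_lengths_local[P' hP']; apply/chain_lengths_quot.
apply: h hP'; first exact: local_minimal.
have [M eM hM] := local_max; move=> a /spreE h'.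
have : spre lam M a by apply/spreE; apply: (hM P).
by rewrite eM.
Qed.

(** Chains ending at Q have bounded length, so both dimensions are attained maxima; a longest chain
    over P is then shortened to length k. *)
Lemma local_equidimensional (P : spec A) k P' : equidimensional L ->
  (forall q : spec A, q `<=` P -> q = P) -> P `<=` Q -> chn P' k Q ->
  exists2 r : spec A, P `<=` r & chn r k Q.
Proof.
move=> [_ eqd] minP PQ hk.
have [M eM hM] := local_max.
have [P1 eP1 _] : exists2 P1 : spec L, spre lam P1 = P & P1 `<=` M by apply: loc_lift; rewrite eM.
have minP1 : minimal_prime P1.
  move=> q qP1; apply: loc_spec_sub; rewrite eP1 (minP (spre lam q)) //.
  by rewrite -eP1 => a /spreE/qP1/spreE.
have [n hn] := chn_bound noeA Q.
have exmax (S : set nat) m : S m -> (forall k, S k -> (k <= n)%N) ->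
    exists2 d, S d & forall k, S k -> (k <= d)%N.
  move=> Sm hS; have ex : exists d, `[< S d >] by exists m; apply/asboolP.
  have bd d : `[< S d >] -> (d <= n)%N by move=> /asboolP/hS.
  case: (ex_maxnP ex bd) => d /asboolP Sd maxd; exists d => // l Sl.
  by apply/maxd/asboolP.
have [||d hd maxd] := exmax (chain_lengths L) k.
- by apply/chain_lengths_local; exists P'.
- by move=> l /chain_lengths_local[P2 /hn].
have [||e he maxe] := exmax (chain_lengths (quot P1)) 0%N.
- by apply/chain_lengths_quot; exists Q; [rewrite eP1|apply: chn0].
- by move=> l /chain_lengths_quot[P2 _ /hn].
have := eqd P1 minP1; rewrite (krull_dim_max hd maxd) (krull_dim_max he maxe) => -[de].
have [r] := (chain_lengths_quot P1 e).1 he; rewrite eP1 => Pr hr.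
have ke : (k <= e)%N by rewrite -de; apply: maxd; apply/chain_lengths_local; exists P'.
have [r' rr' hr'] := chn_shorten ke hr.
by exists r' => // a /Pr/rr'.
Qed.

End LocalRing.

Theorem theorem1p19 (R : comPzRingType) (Delta : seq (spec R))
    (hR_noetherian : noetherian R)
    (hR_ucatenary : universally_catenary R)
    (hR_loceqdim : locally_equidimensional R)
    (hDelta : flag Delta \/ Delta = [::]) :
  locally_equidimensional (indpro_completion Delta).
Proof.
suff [noeD hD] : noetherian (indpro_completion Delta) /\
    forall Q : spec (indpro_completion Delta), colon_captured Q.
  split=> // Q; apply: equidimensional_local => // P k P'.
  exact: colon_captured_equidim.
elim: Delta {hDelta} => [|p D [noeD hD]] /=.
  split=> //; apply: universally_catenary_colon_captured => // p P P' k.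
  by apply: local_equidimensional => //; case: hR_loceqdim.
set B := indpro_completion D in noeD hD *.
have noeL : noetherian (localization p B) by apply: loc_noetherian.
split; first exact: completion_noetherian.
move=> Q; have [n maxn Qn] := maximal_over Q.
apply: colon_captured_sub Qn; first exact: completion_noetherian.
apply: completion_colon_captured => //.
by apply: loc_colon_captured.
Qed.
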